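(* Let $1<p_0<2$ be such that $\pi_{p_0}^2c_{p_0}=\frac{\pi^3}{\pi^2-8}$. Then, for every $s>1$ ($s<\infty$) and every $p$ with $p_0\le p\le 2$, the family $\{\cos_p(n\pi_p\,\cdot)\}_{n=0}^\infty$ is a Schauder basis of $L_s(0,1)$.
   Context: For $1<p<\infty$ let $F_p(y)=\int_0^y(1-t^p)^{-1/p}\,dt$ for $y\in[0,1]$, and $\pi_p:=2F_p(1)=\frac{2\pi}{p\sin(\pi/p)}$. The function $\sin_p:[0,\frac{\pi_p}{2}]\to[0,1]$ is the inverse of $F_p$, extended to $\mathbb{R}$ by $\sin_p(-x)=-\sin_p(x)$ and $\sin_p(\frac{\pi_p}{2}-x)=\sin_p(\frac{\pi_p}{2}+x)$ (so it is $2\pi_p$-periodic). Define $\cos_p x:=\frac{d}{dx}\sin_p x$ for all $x\in\mathbb{R}$. $\cos_p(n\pi_p\,\cdot)$ denotes the function $x\mapsto\cos_p(n\pi_p x)$ on $(0,1)$. The Schauder basis is ordered by $n=0,1,2,\dots$. For $1<p<2$, $c_p:=(p-1)^{\frac{p-1}{p}}(2-p)^{\frac{2-p}{p}}$. *)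

(* Defs.v *)
From HB Require Import structures.
From mathcomp Require Import all_boot all_order all_algebra.
From mathcomp Require Import all_classical all_reals all_analysis.
From mathcomp Require Import lra ring.

Set Implicit Arguments.
Unset Strict Implicit.
Unset Printing Implicit Defensive.
Import Order.TTheory GRing.Theory Num.Theory.
Import numFieldNormedType.Exports.

Local Open Scope classical_set_scope.
Local Open Scope ring_scope.

Section generalized_trigonometry.
Context {R : realType}.
Implicit Types p x y : R.

(* At t = 1 the integrand is [0 `^ (- p^-1) = 0] by convention, instead of
   +oo; a single point does not affect the integral. *)
Definition Fp p y : R :=
  \int[lebesgue_measure]_(t in `[0, y]) (1 - t `^ p) `^ (- p^-1).

Definition pip p : R := 2 * Fp p 1.

(* The inverse of Fp on [0, 1]; its values outside of Fp @` [0, 1], that is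
   outside of [0, pip p / 2], are not used. *)
Definition sinp_quarter p : R -> R := 'pinv_(fun=> 0) `[0, 1] (Fp p).

(* Reduction to the quarter period: x = n * pip p + r with n integer and
   - pip p / 2 <= r < pip p / 2. The two extension rules
   sinp p (- x) = - sinp p x and
   sinp p (pip p / 2 - x) = sinp p (pip p / 2 + x) together force
   sinp p (r + n * pip p) = (-1) ^ n * sinp p r. They hold by sinpN and
   sinp_refl, and sinpK states that sinp p inverts Fp p on [0, 1]. *)
Definition sinp p x : R :=
  let n : int := Num.floor (x / pip p + 2^-1) in
  let r := x - n%:~R * pip p in
  (-1) ^ n * (Num.sg r * sinp_quarter p `|r|).

Lemma sinp_shift p x (n : int) : pip p != 0 ->
  sinp p (x + n%:~R * pip p) = (-1) ^ n * sinp p x.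
Proof.
move=> pi0; rewrite /sinp mulrDl mulfK// addrAC floorDrz ?intr_int//.
rewrite intrKfloor; set m := Num.floor _.
rewrite intrD mulrDl opprD addrACA subrr addr0 expfzDr ?oppr_eq0 ?oner_eq0//.
by rewrite [_ ^ m * _]mulrC -mulrA.
Qed.

Lemma sinp_small p x : 0 < pip p -> `|x| <= pip p / 2 ->
  sinp p x = Num.sg x * sinp_quarter p `|x|.
Proof.
move=> pi0; rewrite le_eqVlt => /predU1P[xE|]; last first.
  rewrite ltr_norml => /andP[lx xr].
  have n0 : Num.floor (x / pip p + 2^-1) = 0.
    apply/floor_def; rewrite add0r -lerBlDr -ltrBrDr !(ltr_pdivrMr, ler_pdivlMr)//.
    by apply/andP; split; lra.
  by rewrite /sinp n0 mul0r subr0 expr0z mul1r.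
have [x0|x0] := leP 0 x.
  move: xE; rewrite ger0_norm// => xE.
  have -> : sinp p x = sinp p (- x + 1%:~R * pip p) by congr sinp; lra.
  rewrite sinp_shift ?gt_eqF// expr1z mulN1r.
  have n0 : Num.floor (- x / pip p + 2^-1) = 0.
    by rewrite xE mulNr mulrAC mulfV ?gt_eqF// mul1r addNr floor0.
  rewrite /sinp n0 mul0r subr0 expr0z mul1r sgrN normrN.
  by rewrite mulNr opprK ger0_norm.
move: xE; rewrite ltr0_norm// => xE.
have n0 : Num.floor (x / pip p + 2^-1) = 0.
  have -> : x = - (pip p / 2) by rewrite -xE opprK.
  by rewrite mulNr mulrAC mulfV ?gt_eqF// mul1r addNr floor0.
by rewrite /sinp n0 mul0r subr0 expr0z mul1r ltr0_norm.
Qed.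

Lemma sinpN p x : 0 < pip p -> sinp p (- x) = - sinp p x.
Proof.
move=> pi0.
have [n [r [xE rle]]] : exists (n : int) (r : R),
    x = r + n%:~R * pip p /\ `|r| <= pip p / 2.
  set n := Num.floor (x / pip p + 2^-1).
  exists n, (x - n%:~R * pip p); split; first by rewrite subrK.
  have /andP[] := floor_itv (x / pip p + 2^-1); rewrite -/n intrD.
  rewrite -lerBlDr -ltrBrDr ler_pdivlMr// ltr_pdivrMr// ler_norml.
  by move=> *; apply/andP; split; lra.
have -> : - x = - r + (- n)%:~R * pip p by rewrite xE opprD mulrNz mulNr.
rewrite xE !sinp_shift ?gt_eqF// !sinp_small ?normrN// sgrN mulNr mulrN.
by rewrite -exprz_inv invrN1.
Qed.

Lemma sinp_refl p x : 0 < pip p ->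
  sinp p (pip p / 2 - x) = sinp p (pip p / 2 + x).
Proof.
move=> pi0.
have -> : pip p / 2 - x = - (pip p / 2 + x) + 1%:~R * pip p by lra.
by rewrite sinp_shift ?gt_eqF// sinpN// expr1z mulN1r opprK.
Qed.

Lemma sinpK p y : {in `[0, 1] &, {mono Fp p : x y / x <= y}} ->
  y \in `[0, 1] -> sinp p (Fp p y) = y.
Proof.
move=> Fmono yI.
have F0 : Fp p 0 = 0 by rewrite /Fp set_itv1 Rintegral_set1.
have [I0 I1] : 0 \in `[0, 1 : R] /\ 1 \in `[0, 1 : R].
  by rewrite !in_itv/= !lexx !ler01.
have pi0 : 0 < pip p.
  by rewrite mulr_gt0// -F0 (leW_mono_in Fmono)// ltr01.
have Fy0 : 0 <= Fp p y by rewrite -F0 Fmono// (itvP yI).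
have Fy1 : Fp p y <= pip p / 2.
  by rewrite /pip mulrAC mulfV// mul1r Fmono// (itvP yI).
have Finj : {in `[0, 1]%classic &, injective (Fp p)}.
  move=> a b /set_mem aI /set_mem bI ab; apply/le_anti.
  by rewrite -(Fmono a b)// -(Fmono b a)// ab lexx.
rewrite sinp_small ?ger0_norm//.
have [y0|y0] := eqVneq y 0; first by rewrite y0 F0 sgr0 mul0r.
rewrite gtr0_sg ?mul1r.
  by rewrite /sinp_quarter pinvKV//; apply/mem_set.
by rewrite -F0 (leW_mono_in Fmono)// lt_neqAle eq_sym y0/= (itvP yI).
Qed.

Definition cosp p : R -> R := derive1 (sinp p).

Definition cp p : R := (p - 1) `^ ((p - 1) / p) * (2 - p) `^ ((2 - p) / p).

End generalized_trigonometry.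

(* Elements of L_s(mu) are given by representatives; equality in L_s(mu) is
   vanishing of the norm of the difference. *)
Definition schauder_basis d (T : measurableType d) (R : realType)
    (mu : {measure set T -> \bar R}) (s : \bar R) (e : nat -> T -> R) : Prop :=
  (forall n, e n \in Lfun mu s) /\
  (forall f : T -> R, f \in Lfun mu s ->
    exists! a : nat -> R,
      (fun N => Lnorm mu s
           (fun x => (f x - \sum_(0 <= n < N) a n * e n x)%:E))
        @ \oo --> 0%E).

Definition lebesgue01 (R : realType) :
    {measure set (measurableTypeR R) -> \bar R} :=
  mrestr lebesgue_measure (measurable_itv `]0%R, 1%R[).

(* Main.v *)
(* Write c_n = cos (n pi x) and e_n = cosp p (n pip x). By the theorem of M. Riesz
   on conjugate functions, the partial sums of cosine series are uniformly
   bounded in L_s; since cosine polynomials are dense, (c_n) is a Schauder basis.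
   This settles p = 2, where cosp 2 = cos.

   For p < 2, expand e_1 = sum_j tau_j c_j; then e_n = sum_j tau_j c_(nj), so
   that T : c_n |-> e_n is the operator sum_j tau_j M_j with M_j g (x) = g (j x).
   Each M_j is isometric on cosine polynomials, so T is bounded below and has
   dense range as soon as sum_(j >= 2) |tau_j| < tau_1, and it then transports the
   basis (c_n) to (e_n).

   tau_j vanishes for j even. Integrating by parts twice, |tau_j| is at most
   8 pip M / (j pi)^2 for j odd, where M is the maximum of |cosp'|, and
   sum_(j odd, j >= 3) 1 / j^2 <= pi^2 / 8 - 1 by Bessel's inequality. On the other
   hand tau_1 > pi / pip because sinp (pip x) > sin (pi x) on (0, 1/2). Hence it
   suffices that pip^2 M (pi^2 - 8) <= pi^3. Equality holds for the bound
   M <= cp p0 at p0, and pip p is log-convex in 1 / p, so the estimate extends to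
   p0 <= p < 2 by interpolation with p = 2. *)
Require Import Defs.
From HB Require Import structures.
From mathcomp Require Import all_boot all_order all_algebra.
From mathcomp Require Import all_classical all_reals all_analysis.
From mathcomp Require Import measurable_realfun lra ring zify.

Set Implicit Arguments.
Unset Strict Implicit.
Unset Printing Implicit Defensive.
Import Order.TTheory GRing.Theory Num.Theory.
Import numFieldNormedType.Exports.

Local Open Scope classical_set_scope.
Local Open Scope ring_scope.

(** * Integrals of continuous functions *)

(** The second integration by parts is the delicate one. For 1 < p < 2, on (0, pip/2), -cosp' =
    sinp^(p-1) cosp^(2-p) vanishes at both ends, but its own derivative is unbounded near 0. What is
    used is that -cosp' rises and then falls: its integral against sin(kx) then costs at most twice
    its maximum over k, and no integral of its derivative is ever formed. The interpolation in p
    bears on pip^2 |cosp'| at a fixed value w = sinp^p. The slope is w^(1-1/p) (1-w)^(2/p-1), with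
    exponents affine in 1/p, so the log-convexity of pip carries over to the product. At p = 2 the
    product is at most pi^2; this end also lies below K = pi^3/(pi^2-8) provided pi^2 - 8 <= pi,
    whence the numerical bound on pi. M. Riesz's theorem is obtained for s <= 2 by a convexity
    argument on explicit harmonic extensions of trigonometric polynomials, and for s > 2 by duality.
    The operator T acts on cosine polynomials only; its dense range comes from a Neumann iteration,
    each step truncating the series at a controlled error. *)

Section calc.
Context {R : realType}.
Implicit Types (a b c x y : R) (f g F G : R -> R).

(** Not oriented: for [b < a] the interval is empty and the integral is 0, hence the side conditions
    [a <= b] below. *)
Definition RI a b g : R := \int[lebesgue_measure]_(x in `[a, b]) g x.

Lemma cont_int a b g (cg : continuous g) :
  lebesgue_measure.-integrable `[a, b] (EFin \o g).
Proof.
apply: continuous_compact_integrable; first exact: segment_compact.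
exact: continuous_subspaceT.
Qed.

Lemma der_cont f x d : is_derive x 1 f d -> {for x, continuous f}.
Proof. by move=> fd; apply: differentiable_continuous; apply/derivable1_diffP; case: fd. Qed.

Lemma eq_RI a b f g : (forall x, a <= x <= b -> f x = g x) -> RI a b f = RI a b g.
Proof. by move=> fg; apply: eq_Rintegral => x /set_mem/=; rewrite in_itv/= => /fg. Qed.

Lemma RI_FTC a b f F : a <= b -> continuous f ->
  (forall x, a <= x <= b -> is_derive x 1 F (f x)) -> RI a b f = F b - F a.
Proof.
rewrite le_eqVlt => /predU1P[->|ab] cf dF.
  by rewrite /RI set_itv1 Rintegral_set1 subrr.
rewrite /RI /Rintegral (@continuous_FTC2 _ f F)//.
- exact: continuous_subspaceT.
- split.
  + by move=> x; rewrite in_itv/= => /andP[xa xb]; have [] := dF x; rewrite ?ltW.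
  + by apply: cvg_at_right_filter; apply: der_cont (dF a _); rewrite lexx ltW.
  + by apply: cvg_at_left_filter; apply: der_cont (dF b _); rewrite lexx ltW.
- move=> x; rewrite in_itv/= => /andP[xa xb]; rewrite derive1E.
  by apply: (@derive_val _ _ _ _ _ _ _ (dF x _)); rewrite !ltW.
Qed.

(** Strictness of [c < x] makes the derivative two-sided at [x]. This is why primitives are later
    based at a point such as [a - 1], to the left of the interval of interest. *)
Lemma RI_prim c f x : continuous f -> c < x ->
  is_derive x 1 (fun y => RI c y f) (f x).
Proof.
move=> cf cx.
have [d1 d2] := @continuous_FTC1_closed R f c x (x + 1) (ltr_pwDr ltr01 (lexx _)) (cont_int _ _ cf) cx (cf x).
by apply: (DeriveDef d1); rewrite -derive1E; exact: d2.
Qed.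

Lemma RI_D a b f g : continuous f -> continuous g ->
  RI a b (fun x => f x + g x) = RI a b f + RI a b g.
Proof. by move=> cf cg; apply: RintegralD (cont_int _ _ cf) (cont_int _ _ cg). Qed.

Lemma RI_B a b f g : continuous f -> continuous g ->
  RI a b (fun x => f x - g x) = RI a b f - RI a b g.
Proof. by move=> cf cg; apply: RintegralB (cont_int _ _ cf) (cont_int _ _ cg). Qed.

Lemma RI_Z a b k f : continuous f -> RI a b (fun x => k * f x) = k * RI a b f.
Proof. by move=> cf; apply: RintegralZl (cont_int _ _ cf). Qed.

Lemma RI_le a b f g : continuous f -> continuous g ->
  (forall x, a <= x <= b -> f x <= g x) -> RI a b f <= RI a b g.
Proof.
by move=> cf cg fg; apply: (le_Rintegral _ (cont_int _ _ cf) (cont_int _ _ cg)).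
Qed.

Lemma RI_ge0 a b f : (forall x, a <= x <= b -> 0 <= f x) -> 0 <= RI a b f.
Proof. by move=> f0; apply: Rintegral_ge0 => x /=; rewrite in_itv/= => /f0. Qed.

Lemma RI_abs a b f : continuous f -> `|RI a b f| <= RI a b (fun x => `|f x|).
Proof. by move=> cf; apply: le_normr_Rintegral (cont_int _ _ cf). Qed.

Lemma RI_cst a b k : a <= b -> RI a b (fun=> k) = k * (b - a).
Proof.
move=> ab; rewrite /RI Rintegral_cst//= lebesgue_measure_itv/= lte_fin.
by move: ab; rewrite le_eqVlt => /predU1P[->|->]//; rewrite ltxx subrr/=.
Qed.

Lemma rcontM f g (cf : continuous f) (cg : continuous g) : continuous (fun x => f x * g x).
Proof. by move=> x; apply: cvgM; [exact: cf|exact: cg]. Qed.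

Lemma rcontD f g (cf : continuous f) (cg : continuous g) : continuous (fun x => f x + g x).
Proof. by move=> x; apply: cvgD; [exact: cf|exact: cg]. Qed.

Lemma rcontN f (cf : continuous f) : continuous (fun x => - f x).
Proof. by move=> x; apply: cvgN; exact: cf. Qed.

Lemma rcontK k : continuous (cst k : R -> R).
Proof. by move=> x; exact: cvg_cst. Qed.

Lemma cont_sum (I : Type) (r : seq I) (P : pred I) (f : I -> R -> R) :
  (forall i, continuous (f i)) -> continuous (fun x => \sum_(i <- r | P i) f i x).
Proof.
move=> cf; elim: r => [|i r IH].
  rewrite (_ : (fun x => _) = cst 0); first by move=> x; exact: cvg_cst.
  by apply/funext => x; rewrite big_nil.
case Pi : (P i); last first.
  rewrite (_ : (fun x => _) = (fun x => \sum_(i <- r | P i) f i x))//.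
  by apply/funext => x; rewrite big_cons Pi.
rewrite (_ : (fun x => _) = (fun x => f i x + \sum_(i <- r | P i) f i x)); last first.
  by apply/funext => x; rewrite big_cons Pi.
by move=> x; apply: cvgD; [exact: cf|exact: IH].
Qed.

Lemma RI_sum a b (I : Type) (r : seq I) (P : pred I) (f : I -> R -> R) :
  (forall i, continuous (f i)) ->
  RI a b (fun x => \sum_(i <- r | P i) f i x) = \sum_(i <- r | P i) RI a b (f i).
Proof.
move=> cf; elim: r => [|i r IH].
  rewrite big_nil (_ : (fun x => _) = cst 0); last by apply/funext => x; rewrite big_nil.
  by rewrite /RI/= Rintegral_cst// mul0r.
rewrite big_cons -IH; case: ifPn => Pi; last first.
  by apply: eq_RI => x _; rewrite big_cons (negbTE Pi).
rewrite -RI_D//; first by apply: eq_RI => x _; rewrite big_cons Pi.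
exact: cont_sum.
Qed.

Lemma isdD f g x df dg : is_derive x 1 f df -> is_derive x 1 g dg ->
  is_derive x 1 (fun y => f y + g y) (df + dg).
Proof. exact: is_deriveD. Qed.

Lemma isdN f x df : is_derive x 1 f df -> is_derive x 1 (fun y => - f y) (- df).
Proof. exact: is_deriveN. Qed.

Lemma isdB f g x df dg : is_derive x 1 f df -> is_derive x 1 g dg ->
  is_derive x 1 (fun y => f y - g y) (df - dg).
Proof. exact: is_deriveB. Qed.

Lemma isdM f g x df dg : is_derive x 1 f df -> is_derive x 1 g dg ->
  is_derive x 1 (fun y => f y * g y) (df * g x + f x * dg).
Proof.
move=> Hf Hg; apply: (is_derive_eq (is_deriveM Hf Hg)).
by rewrite addrC; congr (_ + _); rewrite /GRing.scale/= mulrC.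
Qed.

Lemma isdZ k f x df : is_derive x 1 f df -> is_derive x 1 (fun y => k * f y) (k * df).
Proof. exact: is_deriveZ. Qed.

Lemma isdC f g x df dg : is_derive (g x) 1 f df -> is_derive x 1 g dg ->
  is_derive x 1 (fun y => f (g y)) (df * dg).
Proof. exact: is_derive1_comp. Qed.

Lemma isd_id x : is_derive x (1 : R) (fun y : R => y) (1 : R).
Proof. exact: is_derive_id. Qed.

Lemma isd_cst k x : is_derive x (1 : R) (fun _ : R => k) (0 : R).
Proof. exact: is_derive_cst. Qed.

Lemma isd_affine k h x : is_derive x 1 (fun y => k * y + h) k.
Proof.
apply: (is_derive_eq (isdD (isdZ k (isd_id x)) (isd_cst h x))).
by rewrite mulr1 addr0.
Qed.

Lemma isd_sum (I : Type) (r : seq I) (P : pred I) (f : I -> R -> R) (df : I -> R) x :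
  (forall i, is_derive x 1 (f i) (df i)) ->
  is_derive x 1 (fun y => \sum_(i <- r | P i) f i y) (\sum_(i <- r | P i) df i).
Proof.
move=> H; elim: r => [|i r IH].
  rewrite big_nil (_ : (fun y => _) = fun=> 0); first exact: isd_cst.
  by apply/funext => y; rewrite big_nil.
rewrite big_cons; case Pi : (P i); last first.
  rewrite (_ : (fun y => _) = (fun y => \sum_(i <- r | P i) f i y))//.
  by apply/funext => y; rewrite big_cons Pi.
rewrite (_ : (fun y => _) = (fun y => f i y + \sum_(i <- r | P i) f i y)).
  exact: isdD.
by apply/funext => y; rewrite big_cons Pi.
Qed.

Lemma RI_cat a b c f : a <= b -> b <= c -> continuous f ->
  RI a c f = RI a b f + RI b c f.
Proof.
move=> ab bc cf.
have P x : a <= x -> is_derive x 1 (fun y => RI (a - 1) y f) (f x).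
  by move=> ax; apply: RI_prim => //; lra.
have E u v : a <= u -> u <= v -> RI u v f = RI (a - 1) v f - RI (a - 1) u f.
  move=> au uv; apply: (RI_FTC (F := fun y => RI (a - 1) y f) uv cf) => x /andP[ux _]; apply: P.
  exact: le_trans ux.
have ac := le_trans ab bc; rewrite (E a c)// (E a b)// (E b c)//; ring.
Qed.

Lemma cont_affine k h f : continuous f -> continuous (fun x => f (k * x + h)).
Proof.
move=> cf x; apply: (@continuous_comp _ _ _ (fun x => k * x + h) f); last exact: cf.
exact: der_cont (isd_affine k h x).
Qed.

Lemma RI_affine k h a b f : a <= b -> 0 < k -> continuous f ->
  k * RI a b (fun x => f (k * x + h)) = RI (k * a + h) (k * b + h) f.
Proof.
move=> ab k0 cf; have kab : k * a + h <= k * b + h by rewrite lerD2r ler_pM2l.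
pose F y := RI (k * a + h - 1) y f.
have P x : k * a + h <= x -> is_derive x 1 F (f x).
  by move=> ax; apply: RI_prim => //; lra.
rewrite -RI_Z; last exact: cont_affine.
rewrite (RI_FTC (F := F) kab cf (fun x H => P x (andP H).1)).
apply: (RI_FTC (F := fun x => F (k * x + h)) ab).
  move=> x; apply: cvgM; first exact: cvg_cst.
  exact: (@cont_affine k h f cf x).
move=> x /andP[ax _]; rewrite mulrC; apply: isdC; last exact: isd_affine.
by apply: P; rewrite lerD2r ler_pM2l.
Qed.

Lemma RI_refl h a b f : a <= b -> continuous f ->
  RI a b (fun x => f (h - x)) = RI (h - b) (h - a) f.
Proof.
move=> ab cf; pose F y := RI (h - b - 1) y f.
have P x : h - b <= x -> is_derive x 1 F (f x).
  by move=> ax; apply: RI_prim => //; lra.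
have hab : h - b <= h - a by lra.
rewrite (RI_FTC (F := F) hab cf (fun x H => P x (andP H).1)).
have E x : h - x = -1 * x + h by rewrite mulN1r addrC.
transitivity ((fun x => - F (-1 * x + h)) b - (fun x => - F (-1 * x + h)) a); last first.
  by rewrite opprK -!E addrC.
apply: (RI_FTC (F := fun x => - F (-1 * x + h)) ab).
- rewrite (_ : (fun x => _) = (fun x => f (-1 * x + h))); first exact: cont_affine.
  by apply/funext => x; rewrite E.
- move=> x /andP[_ xb]; rewrite -[X in is_derive _ _ _ X]opprK; apply: isdN.
  rewrite -[X in is_derive _ _ _ X]mulrN1; apply: isdC; last exact: isd_affine.
  by rewrite -E; apply: P; lra.
Qed.

(** If the integral vanished, the primitive of [f] based at [a] would be 0 throughout (a, b),
    whereas its derivative at [x] is [f x > 0]. *)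
Lemma RI_gt0 a b f x : continuous f -> (forall x, a <= x <= b -> 0 <= f x) ->
  a < x < b -> 0 < f x -> 0 < RI a b f.
Proof.
move=> cf f0 /andP[ax xb] fx0; rewrite lt0r RI_ge0// andbT; apply/eqP => I0.
pose F y := RI a y f.
have F0 y : a < y < b -> F y = 0.
  move=> /andP[ay yb]; apply/eqP; rewrite eq_le RI_ge0 ?andbT; last first.
    by move=> z /andP[az zy]; apply: f0; lra.
  rewrite -I0 (@RI_cat a y b)//; [|by lra..].
  by rewrite lerDl RI_ge0// => z /andP[az zy]; apply: f0; lra.
have dF : is_derive x 1 F (f x) by exact: RI_prim.
have : 'D_1 F x = 'D_1 (cst 0 : R -> R) x.
  apply: near_eq_derive.
  near=> y; apply: F0; apply/andP; split; near: y; [exact: lt_nbhsr|exact: lt_nbhsl].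
by rewrite derive_cst (@derive_val _ _ _ _ _ _ _ (dF)) => fx; rewrite fx ltxx in fx0.
Unshelve. all: by end_near. Qed.

Lemma der_nondecr a b f df : (forall x, a < x < b -> is_derive x 1 f (df x)) ->
  {within `[a, b], continuous f} -> (forall x, a < x < b -> 0 <= df x) ->
  forall x y, a <= x -> x <= y -> y <= b -> f x <= f y.
Proof.
move=> d cf df0 x y ax xy yb; apply: (@ger0_derive1_le_cc _ f a b) => //.
- by move=> z; rewrite in_itv/= => /d[].
- by move=> z; rewrite in_itv/= => zab; rewrite derive1E (@derive_val _ _ _ _ _ _ _ (d z zab)) df0.
- by rewrite in_itv/= ax (le_trans xy).
- by rewrite in_itv/= yb (le_trans ax).
Qed.

Lemma der_incr a b f df : (forall x, a < x < b -> is_derive x 1 f (df x)) ->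
  {within `[a, b], continuous f} -> (forall x, a < x < b -> 0 < df x) ->
  forall x y, a <= x -> x < y -> y <= b -> f x < f y.
Proof.
move=> d cf df0 x y ax xy yb; apply: (@gtr0_derive1_lt_cc _ f a b) => //.
- by move=> z; rewrite in_itv/= => /d[].
- by move=> z; rewrite in_itv/= => zab; rewrite derive1E (@derive_val _ _ _ _ _ _ _ (d z zab)) df0.
- by rewrite in_itv/= ax (le_trans (ltW xy)).
- by rewrite in_itv/= yb (le_trans ax (ltW xy)).
Qed.

(** By the mean value theorem, the difference quotients at [x] are values of [k] at points tending
    to [x]. This serves at 0 and [pip p / 2], where the branches of [sinp] meet. *)
Lemma isd_puncture f k x d : 0 < d ->
  (forall y, y != x -> `|y - x| < d -> is_derive y 1 f (k y)) ->
  {for x, continuous f} -> {for x, continuous k} -> is_derive x 1 f (k x).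
Proof.
move=> d0 df cf ck.
suff H : (fun h : R => h^-1 *: (f (h *: (1:R) + x) - f x)) @ 0^' --> k x.
  split; first by apply/cvg_ex; exists (k x).
  by apply/cvg_lim => //; exact: Rhausdorff.
apply/cvgrPdist_le => e e0.
move/cvgrPdist_le : ck => /(_ e e0)[r /= r0 kr].
exists (Num.min r d) => /=; first by rewrite lt_min r0.
move=> h /=; rewrite sub0r normrN lt_min => /andP[hr hd] h0.
have [c [ce cx]] : exists c, `|c - x| <= `|h| /\
    h^-1 *: (f (h *: (1:R) + x) - f x) = k c.
  have cfy y : `|y - x| < d -> {for y, continuous f}.
    have [->//|yx yd] := eqVneq y x.
    exact: der_cont (df y yx yd).
  have [hp|hn|hz] := ltgtP h 0; last by rewrite hz eqxx in h0.
  - have [|||c] := @MVT _ f k (h + x) x.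
    + by lra.
    + move=> z; rewrite in_itv/= => /andP[z1 z2]; apply: df; first by rewrite lt_eqF.
      by rewrite ltr0_norm in hd => //; rewrite ltr0_norm; lra.
    + apply: continuous_in_subspaceT => z /set_mem/=; rewrite in_itv/= => /andP[z1 z2].
      apply: cfy; rewrite ltr0_norm in hd => //; rewrite ler0_norm; lra.
    + rewrite in_itv/= => /andP[z1 z2] E; exists c; split.
        by rewrite ltr0_norm ?ler0_norm; lra.
      rewrite /GRing.scale/= mulr1; apply: (mulfI h0); rewrite mulVKf//; lra.
  - have [|||c] := @MVT _ f k x (h + x).
    + by lra.
    + move=> z; rewrite in_itv/= => /andP[z1 z2]; apply: df; first by rewrite gt_eqF.
      by rewrite gtr0_norm in hd => //; rewrite gtr0_norm; lra.
    + apply: continuous_in_subspaceT => z /set_mem/=; rewrite in_itv/= => /andP[z1 z2].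
      apply: cfy; rewrite gtr0_norm in hd => //; rewrite ger0_norm; lra.
    + rewrite in_itv/= => /andP[z1 z2] E; exists c; split.
        by rewrite gtr0_norm ?ger0_norm; lra.
      rewrite /GRing.scale/= mulr1; apply: (mulfI h0); rewrite mulVKf//; lra.
rewrite cx; apply: kr => /=; rewrite distrC; exact: le_lt_trans ce hr.
Qed.

End calc.
Arguments rcontM {R f g} cf cg.
Arguments rcontD {R f g} cf cg.
Arguments rcontN {R f} cf.
Arguments rcontK {R} k.

Unset Implicit Arguments.

(** * Uniform continuity and boundedness on a segment *)

Section heine.
Context {R : realType}.

Lemma heine (g : R -> R) (a b e : R) : continuous g -> 0 < e ->
  exists2 d : R, 0 < d & forall x y, a <= x <= b -> `|x - y| < d -> `|g x - g y| < e.
Proof.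
move=> cg e0.
have H : forall x : R^o, `[a, b]%classic x ->
    \forall x' \near x & i \near 0^'+, forall y, `|x' - y| < i -> `|g x' - g y| < e.
  move=> x _.
  have e20 : 0 < e / 2 by rewrite divr_gt0.
  move/cvgrPdist_lt : (cg x) => /(_ _ e20)[d /= d0 gd].
  have d20 : 0 < d / 2 by rewrite divr_gt0.
  exists (ball x (d / 2), [set i | i < d / 2]).
    split; first by exists (d / 2).
    exact: nbhs_right_lt.
  move=> [x' i] /= [xx' id] y x'y.
  have h1 : `|g x - g x'| < e / 2.
    by apply: gd; apply: lt_trans xx' _; rewrite ltr_pdivrMr// ltr_pMr// ltr1n.
  have h2 : `|g x - g y| < e / 2.
    apply: gd => /=; rewrite (_ : x - y = (x - x') + (x' - y)); last by ring.
    rewrite [ltRHS]splitr; apply: le_lt_trans (ler_normD _ _) _; apply: ltrD => //.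
    exact: lt_trans id.
  rewrite (_ : g x' - g y = - (g x - g x') + (g x - g y)); last by ring.
  rewrite [ltRHS]splitr; apply: le_lt_trans (ler_normD _ _) _.
  by rewrite normrN ltrD.
have [d /= d0 gd] := (@compact_near_coveringP R^o `[a, b]%classic).1 (@segment_compact R a b)
  R (nbhs (0 : R)^'+) (fun d x => forall y : R, `|x - y| < d -> `|g x - g y| < e) _ H.
have d20 : 0 < d / 2 by rewrite divr_gt0.
exists (d / 2) => // x y xab xy; apply: (gd (d / 2)) => //=.
by rewrite sub0r normrN gtr0_norm// ltr_pdivrMr// ltr_pMr// ltr1n.
Qed.

Lemma cont_bounded (g : R -> R) (a b : R) : continuous g ->
  exists2 B : R, 0 <= B & forall x, a <= x <= b -> `|g x| <= B.
Proof.
move=> cg; have [ab|ab] := leP a b; last first.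
  by exists 0 => // x /andP[ax xb]; have := le_lt_trans (le_trans ax xb) ab; rewrite ltxx.
have cg' : {within `[a, b], continuous g} by exact: continuous_subspaceT.
have [M Mab hM] := EVT_max ab cg'; have [m mab hm] := EVT_min ab cg'.
exists (`|g M| + `|g m|); first by rewrite addr_ge0.
move=> x xab; have /hM h1 : x \in `[a, b] by rewrite in_itv.
have /hm h2 : x \in `[a, b] by rewrite in_itv.
have := ler_norm (g M); have := ler_norm (- g m); rewrite normrN => *.
have := normr_ge0 (g M); have := normr_ge0 (g m) => *.
by rewrite ler_norml; apply/andP; split; lra.
Qed.

End heine.
Arguments heine {R g} a b {e} _ _.
Arguments cont_bounded {R g} a b _.

(** * Cosine polynomials *)

Section cosine_polynomials.
Context {R : realType}.
Implicit Types (a b : nat -> R) (x y d e z : R) (f g : R -> R).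

Definition cosn (n : nat) x : R := cos (n%:R * pi * x).
Definition cpoly a N x : R := \sum_(0 <= n < N) a n * cosn n x.

Lemma cont_cosn n : continuous (cosn n).
Proof.
move=> x; apply: (@continuous_comp _ _ _ (fun x => n%:R * pi * x) (@cos R)); last exact: continuous_cos.
exact: (der_cont (isdZ (n%:R * pi) (isd_id x))).
Qed.

Lemma cont_cpoly a N : continuous (cpoly a N).
Proof. by apply: cont_sum => n; exact: (rcontM (rcontK (a n)) (cont_cosn n)). Qed.

Lemma cpolyD a b N x : cpoly (fun n => a n + b n) N x = cpoly a N x + cpoly b N x.
Proof. by rewrite -big_split/=; apply: eq_bigr => n _; rewrite mulrDl. Qed.

Lemma cpolyZ k a N x : cpoly (fun n => k * a n) N x = k * cpoly a N x.
Proof. by rewrite mulr_sumr; apply: eq_bigr => n _; rewrite mulrA. Qed.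

(** Cutting coefficients off at [N] lets polynomials of different lengths be rewritten with a common
    length and added termwise. *)
Definition trunc_seq a N n := if (n < N)%N then a n else 0.

Lemma cpoly_pad a N L : (N <= L)%N -> cpoly (trunc_seq a N) L =1 cpoly a N.
Proof.
move=> NL x; rewrite /cpoly (big_cat_nat (n := N))//= [X in _ + X]big1_seq ?addr0.
  by apply: eq_big_nat => n /andP[_ nN]; rewrite /trunc_seq nN.
by move=> n /=; rewrite mem_index_iota /trunc_seq => /andP[Nn _]; rewrite ltnNge Nn mul0r.
Qed.

Definition is_cpoly f := exists a N, f =1 cpoly a N.

Lemma is_cpolyD f g : is_cpoly f -> is_cpoly g -> is_cpoly (fun x => f x + g x).
Proof.
move=> [a [N fE]] [b [M gE]].
exists (fun n => trunc_seq a N n + trunc_seq b M n), (maxn N M) => x.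
by rewrite cpolyD !cpoly_pad ?leq_maxl ?leq_maxr// fE gE.
Qed.
Arguments is_cpolyD {f g} _ _.

Lemma is_cpolyZ k f : is_cpoly f -> is_cpoly (fun x => k * f x).
Proof. by move=> [a [N fE]]; exists (fun n => k * a n), N => x; rewrite cpolyZ fE. Qed.
Arguments is_cpolyZ k {f} _.

Lemma is_cpoly_cosn n : is_cpoly (cosn n).
Proof.
exists (fun i => (i == n)%:R), n.+1 => x; rewrite /cpoly big_nat_recr//= eqxx mul1r.
rewrite big1_seq ?add0r// => i; rewrite mem_index_iota => /andP[_ /andP[_ iltn]].
by rewrite ltn_eqF// mul0r.
Qed.

Lemma is_cpoly_ext f g : is_cpoly g -> f =1 g -> is_cpoly f.
Proof. by move=> [a [N gE]] fg; exists a, N => x; rewrite fg. Qed.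
Arguments is_cpoly_ext {f g} _ _.

Lemma is_cpoly_sum (I : Type) (r : seq I) (F : I -> R -> R) :
  (forall i, is_cpoly (F i)) -> is_cpoly (fun x => \sum_(i <- r) F i x).
Proof.
move=> H; elim: r => [|i r IH].
  by exists (fun=> 0), 0%N => x; rewrite big_nil /cpoly big_geq.
apply: is_cpoly_ext (is_cpolyD (H i) IH) _ => x.
by rewrite big_cons.
Qed.
Arguments is_cpoly_sum {I} r {F} _.

Lemma cosn0 x : cosn 0 x = 1.
Proof. by rewrite /cosn !mul0r cos0. Qed.

Lemma cosn1M n x : cosn 1 x * cosn n.+1 x = 2^-1 * cosn n x + 2^-1 * cosn n.+2 x.
Proof.
rewrite /cosn.
have -> : n%:R * pi * x = n.+1%:R * pi * x - 1%:R * pi * x by rewrite -natr1; ring.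
have -> : n.+2%:R * pi * x = n.+1%:R * pi * x + 1%:R * pi * x by rewrite -[n.+2%:R]natr1; ring.
by rewrite cosB cosD; field.
Qed.

(** This closure property is what makes the recursion of [bern], taken at an affine function of cos
    (pi x), stay among cosine polynomials. *)
Lemma is_cpoly_cos1M f : is_cpoly f -> is_cpoly (fun x => cosn 1 x * f x).
Proof.
move=> [a [N fE]].
apply: (@is_cpoly_ext _ (fun x => \sum_(n <- index_iota 0 N) a n * (cosn 1 x * cosn n x))); last first.
  by move=> x; rewrite fE mulr_sumr; apply: eq_bigr => n _; rewrite mulrCA.
apply: is_cpoly_sum => -[|n]; apply: is_cpolyZ.
  by apply: is_cpoly_ext (is_cpoly_cosn 1) _ => x; rewrite cosn0 mulr1.
apply: is_cpoly_ext (is_cpolyD (is_cpolyZ 2^-1 (is_cpoly_cosn n)) (is_cpolyZ 2^-1 (is_cpoly_cosn n.+2))) _.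
by move=> x; rewrite cosn1M.
Qed.
Arguments is_cpoly_cos1M {f} _.

(* The Bernstein operator as an n-step expectation: [bern z n phi] is
   E phi(S_n) for a sum S_n of n independent Bernoulli(z) variables. *)
Fixpoint bern (z : R) (n : nat) (phi : nat -> R) : R :=
  if n is m.+1 then z * bern z m (fun k => phi k.+1) + (1 - z) * bern z m phi
  else phi 0%N.

Lemma bern_cst z n k : bern z n (fun=> k) = k.
Proof. by elim: n => //= n ->; ring. Qed.

(** Second moment of a binomial variable about [c]: its variance plus the square of the bias. *)
Lemma bern_sqr z n (c : R) :
  bern z n (fun k => (k%:R - c) ^+ 2) = n%:R * z * (1 - z) + (n%:R * z - c) ^+ 2.
Proof.
elim: n c => [|n IH] c /=; first by ring.
have -> : (fun k : nat => (k.+1%:R - c) ^+ 2) = (fun k => (k%:R - (c - 1)) ^+ 2).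
  by apply/funext => k; rewrite -natr1; ring.
by rewrite !IH -natr1; ring.
Qed.

Lemma bern_le z n phi psi : 0 <= z <= 1 ->
  (forall k, (k <= n)%N -> phi k <= psi k) -> bern z n phi <= bern z n psi.
Proof.
move=> /andP[z0 z1]; elim: n phi psi => [|n IH] phi psi H /=; first exact: H.
apply: lerD; rewrite ler_wpM2l ?subr_ge0//; apply: IH => k kn; apply: H => //.
exact: leqW.
Qed.

Lemma bern_lin z n (c k : R) (phi psi : nat -> R) :
  bern z n (fun i => c * phi i + k * psi i) = c * bern z n phi + k * bern z n psi.
Proof. by elim: n phi psi => //= n IH phi psi; rewrite !IH; ring. Qed.

(** This is cos^2 (pi x / 2), a decreasing bijection of [0, 1] onto itself that turns Bernstein
    polynomials into cosine polynomials. *)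
Definition zcos x : R := (1 + cosn 1 x) / 2.

Lemma zcos01 x : 0 <= zcos x <= 1.
Proof.
rewrite /zcos; have h1 : -1 <= cosn 1 x by exact: cos_geN1.
have h2 : cosn 1 x <= 1 by exact: cos_le1.
by apply/andP; split; lra.
Qed.

Lemma is_cpoly_bern n phi : is_cpoly (fun x => bern (zcos x) n phi).
Proof.
elim: n phi => [|n IH] phi /=.
  by apply: is_cpoly_ext (is_cpolyZ (phi 0%N) (is_cpoly_cosn 0)) _ => x; rewrite cosn0 mulr1.
have H (z : nat -> R) := is_cpolyD (is_cpolyZ 2^-1 (IH z)) (is_cpolyZ 2^-1 (is_cpoly_cos1M (IH z))).
have H' (z : nat -> R) := is_cpolyD (is_cpolyZ 2^-1 (IH z)) (is_cpolyZ (- 2^-1) (is_cpoly_cos1M (IH z))).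
apply: is_cpoly_ext (is_cpolyD (H (fun k => phi k.+1)) (H' phi)) _ => x.
by rewrite /zcos; field.
Qed.

(* [z x - z y = sin (pi (x + y) / 2) * sin (pi (y - x) / 2)] *)
Lemma zcos_far d x y : 0 < d -> 0 <= x <= 1 -> 0 <= y <= 1 -> d <= `|x - y| ->
  sin (pi * d / 2) ^+ 2 <= `|zcos x - zcos y|.
Proof.
wlog xy : x y / x <= y.
  move=> H; have [|/ltW yx] := leP x y; first exact: H.
  by move=> d0 x01 y01 dxy; rewrite distrC; apply: H => //; rewrite distrC.
move=> d0 /andP[x0 x1] /andP[y0 y1]; rewrite ler0_norm ?subr_le0// opprB => dxy.
set p := pi * (x + y) / 2; set q := pi * (y - x) / 2.
have -> : zcos x - zcos y = sin p * sin q.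
  rewrite /zcos /cosn !mul1r.
  have -> : pi * x = p - q by rewrite /p /q; field.
  have -> : pi * y = p + q by rewrite /p /q; field.
  by rewrite cosB cosD; field.
have pi0 := pi_gt0 R.
(* The map z |-> sin (pi z / 2) is symmetric about 1 and increases up to 1, so on [d, 2 - d] it is
   smallest at the ends. Both x + y and y - x lie in that interval. *)
have sinq z : d <= z -> z <= 2 - d -> sin (pi * d / 2) <= sin (pi * z / 2).
  move=> dz zd; have dd : d <= 1 by lra.
  have H w : d <= w -> w <= 1 -> sin (pi * d / 2) <= sin (pi * w / 2).
    move=> dw w1; rewrite -[X in X <= _]opprK -[X in _ <= X]opprK lerN2 -!cosDpihalf.
    rewrite leNgt ltr_cos ?in_itv/=.
    - by rewrite ltrD2r -leNgt ler_pM2r// ler_pM2l.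
    - by apply/andP; split; nra.
    - by apply/andP; split; nra.
  have [z1|z1] := leP z 1; first exact: H.
  have -> : sin (pi * z / 2) = sin (pi * (2 - z) / 2).
    have -> : pi * (2 - z) / 2 = pi - pi * z / 2 by field.
    by rewrite sinB sinpi cospi; ring.
  by apply: H; lra.
have sd0 : 0 <= sin (pi * d / 2).
  by apply: sin_ge0_pi; apply/andP; split; nra.
have sp : sin (pi * d / 2) <= sin p by apply: sinq; lra.
have sq : sin (pi * d / 2) <= sin q by apply: sinq; lra.
rewrite normrM !ger0_norm ?(le_trans sd0)// expr2.
exact: ler_pM.
Qed.

(** Bernstein's proof in the variable [zcos x]: the oscillation of [g] is dominated by a constant
    plus a multiple of the squared distance in that variable, whose expectation is of order 1/n. *)
Theorem weierstrass_cos g (e : R) : continuous g -> 0 < e ->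
  exists a N, forall x, 0 <= x <= 1 -> `|g x - cpoly a N x| <= e.
Proof.
move=> cg e0; have e20 : 0 < e / 2 by rewrite divr_gt0.
have [d d0 gd] := heine 0 1 cg e20; have [B B0 gB] := cont_bounded 0 1 cg.
pose d' := Num.min d 1.
have d'0 : 0 < d' by rewrite lt_min d0 ltr01.
pose m := sin (pi * d' / 2) ^+ 2.
have m0 : 0 < m.
  rewrite exprn_gt0// sin_gt0_pi//; have := pi_gt0 R.
  have : d' <= 1 by rewrite ge_min lexx orbT.
  by move=> *; apply/andP; split; nra.
(* For nearby points uniform continuity suffices; for the others [zcos] moves by at least [m], so
   the quadratic term alone exceeds [2 * B]. *)
have key x y : 0 <= x <= 1 -> 0 <= y <= 1 ->
    `|g x - g y| <= e / 2 + 2 * B / m ^+ 2 * (zcos y - zcos x) ^+ 2.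
  move=> x01 y01; have [xy|xy] := ltP `|x - y| d'.
    apply: (@le_trans _ _ (e / 2)).
      by apply/ltW/gd => //; apply: lt_le_trans xy _; rewrite ge_min lexx.
    by rewrite lerDl mulr_ge0 ?sqr_ge0// divr_ge0 ?sqr_ge0// mulr_ge0.
  apply: (@le_trans _ _ (2 * B)).
    apply: le_trans (ler_normB _ _) _.
    by rewrite [2 * B]mulrC mulr_natr mulr2n lerD ?gB.
  have mz : m ^+ 2 <= (zcos y - zcos x) ^+ 2.
    rewrite -[leRHS]real_normK ?num_real// ler_sqr ?nnegrE ?(ltW m0)//.
    by rewrite distrC; exact: zcos_far.
  apply: (@le_trans _ _ (2 * B / m ^+ 2 * (zcos y - zcos x) ^+ 2)); last by rewrite lerDr ltW.
  rewrite -mulrA ler_peMr ?mulr_ge0//.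
  have m20 : 0 < m ^+ 2 by rewrite exprn_gt0.
  by rewrite mulrC (ler_pdivlMr _ _ m20) mul1r.
have c0 : 0 <= 2 * B / m ^+ 2 by rewrite divr_ge0 ?sqr_ge0// mulr_ge0.
(* The variance term is at most 1/n, so this [n] keeps the quadratic part below [e / 2]. *)
have [n] : exists n : nat, 2 * B / m ^+ 2 / (e / 2) < n%:R.
  exists (Num.bound (2 * B / m ^+ 2 / (e / 2))); apply: archi_boundP.
  by rewrite divr_ge0// ltW.
rewrite ltr_pdivrMr// => nB.
have n0 : (0 < n)%N.
  rewrite lt0n; apply/eqP => n0; move: nB; rewrite n0 mul0r ltNge => /negP; apply.
  exact: c0.
have n0R : 0 < n%:R :> R by rewrite ltr0n.
(* [X k] is the node of [0, 1] at which [zcos] equals k/n. *)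
pose X k : R := acos (2 * (k%:R / n%:R) - 1) / pi.
have Xk k : (k <= n)%N -> 0 <= X k <= 1 /\ zcos (X k) = k%:R / n%:R.
  move=> kn; have k1 : 0 <= (k%:R / n%:R : R) <= 1.
    by rewrite divr_ge0//= ler_pdivrMr// mul1r ler_nat.
  have B1 : -1 <= 2 * (k%:R / n%:R : R) - 1 <= 1.
    by move: k1 => /andP[? ?]; apply/andP; split; lra.
  have pi0 := pi_gt0 R.
  split; first by rewrite /X divr_ge0 ?acos_ge0 ?(ltW pi0)//= ler_pdivrMr// mul1r acos_lepi.
  rewrite /zcos /cosn mul1r /X [pi * _]mulrC divfK ?gt_eqF// acosK ?in_itv//=.
  by field; rewrite gt_eqF.
have [a [N aE]] := is_cpoly_bern n (fun k => g (X k)).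
exists a, N => x x01; rewrite -aE.
have bE : bern (zcos x) n (fun k => (k%:R / n%:R - zcos x) ^+ 2) <= n%:R^-1.
  rewrite (_ : (fun k : nat => _) = (fun k => n%:R ^- 2 * (k%:R - n%:R * zcos x) ^+ 2 + 0 * 0)); last first.
    by apply/funext => k; field; rewrite gt_eqF.
  rewrite bern_lin mul0r addr0 bern_sqr subrr expr0n addr0 /=.
  rewrite -mulrA mulrA expr2 invfM -[X in X * _]mulrA mulVf ?gt_eqF// mulr1.
  rewrite ler_piMr ?invr_ge0 ?ler0n//.
  by have /andP[z0 z1] := zcos01 x; rewrite mulr_ile1 ?subr_ge0// gerBl.
have up : bern (zcos x) n (fun k => e / 2 * 1 + 2 * B / m ^+ 2 * (k%:R / n%:R - zcos x) ^+ 2) <= e.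
  rewrite bern_lin bern_cst mulr1 [leRHS]splitr lerD2l.
  apply: (@le_trans _ _ (2 * B / m ^+ 2 * n%:R^-1)).
    exact: ler_wpM2l.
  by rewrite ler_pdivrMr// [leRHS]mulrC ltW.
have z01 := zcos01 x.
have kx k : (k <= n)%N -> `|g x - g (X k)| <= e / 2 * 1 + 2 * B / m ^+ 2 * (k%:R / n%:R - zcos x) ^+ 2.
  by move=> kn; have [X01 XE] := Xk k kn; rewrite mulr1 -XE; exact: key.
set D := (fun k : nat => _) in up;
have lin c : bern (zcos x) n (fun k => g x * 1 + c * D k) = g x + c * bern (zcos x) n D.
  by rewrite bern_lin bern_cst mulr1.
have h1 : bern (zcos x) n (fun k => g x * 1 + (-1) * D k) <= bern (zcos x) n (fun k => g (X k)).
  apply: bern_le => // k /kx; rewrite -/(D k) ler_norml => /andP[_]; lra.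
have h2 : bern (zcos x) n (fun k => g (X k)) <= bern (zcos x) n (fun k => g x * 1 + 1 * D k).
  apply: bern_le => // k /kx; rewrite -/(D k) ler_norml => /andP[]; lra.
by move: h1 h2; rewrite !lin ler_norml => *; apply/andP; split; lra.
Qed.

End cosine_polynomials.
Arguments cont_cosn {R} n.
Arguments cont_cpoly {R} a N.

Set Implicit Arguments.

(** * Conjugate trigonometric polynomials *)

Section under_integral.
Context {R : realType}.
Implicit Types (f ft : R -> R -> R).

Lemma isd_RI (a b t0 B : R) f ft : a <= b ->
  (forall t, continuous (f t)) ->
  (forall t x : R, is_derive t 1 (f ^~ x) (ft t x)) ->
  (forall t x : R, t0 - 1 < t < t0 + 1 -> `|ft t x| <= B) ->
  is_derive t0 1 (fun t => RI a b (f t)) (RI a b (ft t0)).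
Proof.
move=> ab cf df bf.
have d1E t x : partial1of2 f t x = ft t x.
  by rewrite /partial1of2 derive1E (@derive_val _ _ _ _ _ _ _ (df t x)).
have It0 : `]t0 - 1, t0 + 1[%classic t0 by rewrite /= in_itv/=; apply/andP; split; lra.
have B0 : 0 <= B by apply: le_trans (normr_ge0 (ft t0 0)) (bf _ _ _); move: It0; rewrite /= in_itv.
have mD : measurable (`[a, b]%classic : set (measurableTypeR R)) by exact: measurable_itv.
have intf t : `]t0 - 1, t0 + 1[%classic t ->
   (@lebesgue_measure R).-integrable `[a, b] (EFin \o f t) by move=> _; exact: cont_int.
have derf t x : `]t0 - 1, t0 + 1[%classic t -> `[a, b]%classic x -> derivable (f ^~ x) t 1.
  by move=> _ _; have [] := df t x.
have intG : (@lebesgue_measure R).-integrable `[a, b] (EFin \o (fun=> B)).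
  by apply: cont_int => x; exact: cvg_cst.
have Gub t x : `]t0 - 1, t0 + 1[%classic t -> `[a, b]%classic x ->
  `|partial1of2 f t x| <= (fun=> B) x.
  by move=> tI _; rewrite d1E; apply: bf; move: tI; rewrite /= in_itv.
apply: DeriveDef.
  exact: (derivable_under_integral mD It0 intf derf (fun=> B0) intG Gub).
rewrite -derive1E (differentiation_under_integral mD It0 intf derf (fun=> B0) intG Gub).
by apply: eq_RI => x _; rewrite d1E.
Qed.

(** Bounds uniform over all [x] and locally in [t]: they supply the dominating constants for
    differentiation under the integral, and are stable under sums and products. *)
Definition tbound f := forall T : R, exists B, forall t x : R, `|t| <= T -> `|f t x| <= B.

Lemma tboundD f g : tbound f -> tbound g -> tbound (fun t x => f t x + g t x).
Proof.
move=> bf bg T; have [B1 h1] := bf T; have [B2 h2] := bg T.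
exists (B1 + B2) => t x tT; apply: le_trans (ler_normD _ _) _.
by rewrite lerD ?h1 ?h2.
Qed.

Lemma tboundM f g : tbound f -> tbound g -> tbound (fun t x => f t x * g t x).
Proof.
move=> bf bg T; have [B1 h1] := bf T; have [B2 h2] := bg T.
by exists (B1 * B2) => t x tT; rewrite normrM ler_pM ?h1 ?h2.
Qed.

Lemma tbound_cst k : tbound (fun t x => k).
Proof. by move=> T; exists `|k|. Qed.

Lemma tboundN f : tbound f -> tbound (fun t x => - f t x).
Proof. by move=> bf T; have [B h] := bf T; exists B => t x /h; rewrite normrN; apply. Qed.

Lemma tbound_near f t0 : tbound f -> exists B, forall t x : R, t0 - 1 < t < t0 + 1 -> `|f t x| <= B.
Proof.
move=> /(_ (`|t0| + 1))[B h]; exists B => t x /andP[t1 t2]; apply: h.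
have := ler_norm t0; have := ler_norm (- t0); rewrite normrN => *.
by rewrite ler_norml; apply/andP; split; lra.
Qed.

Lemma powR_ge_npos (e x r : R) : 0 < e -> e <= x -> r <= 0 -> x `^ r <= e `^ r.
Proof.
move=> e0 ex r0; rewrite -[r]opprK [x `^ _]powRN [e `^ _]powRN lef_pV2 ?posrE ?powR_gt0//.
  by rewrite ge0_ler_powR ?nnegrE ?oppr_ge0// ltW//; exact: lt_le_trans ex.
exact: lt_le_trans ex.
Qed.

Section power_mean.
Variables (e sg : R) (w wt wx wtt wxx : R -> R -> R).
Hypotheses (e0 : 0 < e) (sg1 : sg <= 1) (ew : forall t x : R, e <= w t x)
  (dt : forall t x : R, is_derive t 1 (w ^~ x) (wt t x))
  (dtt : forall t x : R, is_derive t 1 (wt ^~ x) (wtt t x))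
  (dx : forall t x : R, is_derive x 1 (w t) (wx t x))
  (dxx : forall t x : R, is_derive x 1 (wx t) (wxx t x))
  (cwt : forall t, continuous (wt t))
  (cwtt : forall t, continuous (wtt t)) (cwxx : forall t, continuous (wxx t))
  (bwt : tbound wt) (bwtt : tbound wtt)
  (pw : forall t, w t 2 = w t 0) (pwx : forall t, wx t 2 = wx t 0).

Let w0 t x : 0 < w t x. Proof. exact: lt_le_trans (ew t x). Qed.

Let cw t : continuous (w t). Proof. by move=> x; exact: der_cont (dx t x). Qed.
Let cwx t : continuous (wx t). Proof. by move=> x; exact: der_cont (dxx t x). Qed.

Let cpow (r t : R) : continuous (fun x => w t x `^ r).
Proof.
move=> x; exact: der_cont (isdC (is_derive1_powR r (w0 t x)) (dx t x)).
Qed.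

Let bpow (r : R) : r <= 0 -> tbound (fun t x => w t x `^ r).
Proof.
move=> r0 T; exists (e `^ r) => t x _; rewrite ger0_norm ?powR_ge0//.
exact: powR_ge_npos.
Qed.

Let s1 : sg - 1 <= 0. Proof. by rewrite subr_le0. Qed.
Let s2 : sg - 2 <= 0. Proof. by rewrite subr_le0 (le_trans sg1)// ler1n. Qed.

Definition pm_t t x := sg * (w t x `^ (sg - 1) * wt t x).
Definition pm_tt t x :=
  sg * ((sg - 1) * w t x `^ (sg - 2) * wt t x * wt t x + w t x `^ (sg - 1) * wtt t x).
(** The Laplacian of [w ^ sg] in the variables (t, x); [pm_t] and [pm_tt] are its first two
    t-derivatives. *)
Definition pm_lap t x :=
  sg * ((sg - 1) * w t x `^ (sg - 2) * (wt t x * wt t x + wx t x * wx t x) +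
        w t x `^ (sg - 1) * (wtt t x + wxx t x)).

Lemma cont_pm_t t : continuous (pm_t t).
Proof.
move=> x; apply: cvgM; first exact: cvg_cst.
by apply: cvgM; [exact: (cpow (r := sg - 1))|exact: cwt].
Qed.

Lemma isd_pm (t : R) : is_derive t 1 (fun t => RI 0 2 (fun x => w t x `^ sg)) (RI 0 2 (pm_t t)).
Proof.
have [|B hB] := @tbound_near pm_t t.
  apply: tboundM; first exact: tbound_cst.
  by apply: tboundM => //; exact: bpow.
apply: (@isd_RI _ _ t B (fun t x => w t x `^ sg) pm_t) => //.
move=> t' x; rewrite /pm_t mulrA.
exact: (isdC (is_derive1_powR sg (w0 t' x)) (dt t' x)).
Qed.

Lemma isd_pm_t (t : R) : is_derive t 1 (fun t => RI 0 2 (pm_t t)) (RI 0 2 (pm_tt t)).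
Proof.
have [|B hB] := @tbound_near pm_tt t.
  apply: tboundM; first exact: tbound_cst.
  apply: tboundD; last by apply: tboundM => //; exact: bpow.
  apply: tboundM => //; apply: tboundM => //; apply: tboundM; first exact: tbound_cst.
  by exact: bpow.
apply: (@isd_RI _ _ t B pm_t pm_tt) => //; first exact: cont_pm_t.
move=> t' x; apply: isdZ; apply: isdM => //.
apply: (is_derive_eq (isdC (is_derive1_powR (sg - 1) (w0 t' x)) (dt t' x))).
by congr (_ * _ `^ _ * _); ring.
Qed.

Lemma RI_pm_xx t :
  RI 0 2 (fun x => sg * ((sg - 1) * w t x `^ (sg - 2) * wx t x * wx t x +
     w t x `^ (sg - 1) * wxx t x)) = 0.
Proof.
transitivity (sg * (w t 2 `^ (sg - 1) * wx t 2) - sg * (w t 0 `^ (sg - 1) * wx t 0));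
  last by rewrite pw pwx subrr.
apply: (RI_FTC (F := fun x => sg * (w t x `^ (sg - 1) * wx t x))) => //.
  move=> x; apply: cvgM; first exact: cvg_cst.
  apply: cvgD; last by apply: cvgM; [exact: (cpow (r := sg - 1))|exact: cwxx].
  apply: cvgM; last exact: cwx.
  apply: cvgM; last exact: cwx.
  by apply: cvgM; [exact: cvg_cst|exact: (cpow (r := sg - 2))].
move=> x _; apply: isdZ; apply: isdM => //.
apply: (is_derive_eq (isdC (is_derive1_powR (sg - 1) (w0 t x)) (dx t x))).
by congr (_ * _ `^ _ * _); ring.
Qed.

Lemma cont_pm_lap t : continuous (pm_lap t).
Proof.
move=> x; apply: cvgM; first exact: cvg_cst.
apply: cvgD; last first.
  apply: cvgM; first exact: (cpow (r := sg - 1)).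
  by apply: cvgD; [exact: cwtt|exact: cwxx].
apply: cvgM; last first.
  by apply: cvgD; apply: cvgM; [exact: cwt|exact: cwt|exact: cwx|exact: cwx].
by apply: cvgM; [exact: cvg_cst|exact: (cpow (r := sg - 2))].
Qed.

(** The second x-derivative of [w ^ sg] integrates to 0 over a period, so adding it changes the
    second t-derivative into the Laplacian for free. *)
Lemma RI_pm_tt t : RI 0 2 (pm_tt t) = RI 0 2 (pm_lap t).
Proof.
rewrite -[LHS]addr0 -[X in _ + X](RI_pm_xx t) -RI_D.
- by apply: eq_RI => x _; rewrite /pm_tt /pm_lap; ring.
- move=> x; apply: cvgM; first exact: cvg_cst.
  apply: cvgD; last by apply: cvgM; [exact: (cpow (r := sg - 1))|exact: cwtt].
  apply: cvgM; last exact: cwt.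
  apply: cvgM; last exact: cwt.
  by apply: cvgM; [exact: cvg_cst|exact: (cpow (r := sg - 2))].
- move=> x; apply: cvgM; first exact: cvg_cst.
  apply: cvgD; last by apply: cvgM; [exact: (cpow (r := sg - 1))|exact: cwxx].
  apply: cvgM; last exact: cwx.
  apply: cvgM; last exact: cwx.
  by apply: cvgM; [exact: cvg_cst|exact: (cpow (r := sg - 2))].
Qed.

End power_mean.
End under_integral.
Arguments cont_pm_lap {R e} sg {w wt wx wtt wxx} e0 ew dx dxx cwt cwtt cwxx t.

Unset Implicit Arguments.

Section conjugate.
Context {R : realType}.
Implicit Types (r : seq (nat * R * R)) (z : nat * R * R) (t x s : R).

(* A list of triples (k, a, b) encodes the trigonometric polynomial
   sum (a cos (k pi x) + b sin (k pi x)); [tpre] is its harmonic extension to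
   t >= 0 and [tpim] the harmonic conjugate of that extension. *)
Definition freq z : R := z.1.1%:R * pi.
Definition tre z t x : R :=
  expR (- freq z * t) * (z.1.2 * cos (freq z * x) + z.2 * sin (freq z * x)).
Definition tim z t x : R :=
  expR (- freq z * t) * (z.1.2 * sin (freq z * x) - z.2 * cos (freq z * x)).
Definition tpre r t x := \sum_(z <- r) tre z t x.
Definition tpim r t x := \sum_(z <- r) tim z t x.
(** Multiplying each term by its frequency is minus the t-derivative on codes. The Cauchy-Riemann
    equations for [tpre] and [tpim] can thus be iterated without leaving the encoding. *)
Definition tpD r := [seq (z.1.1, freq z * z.1.2, freq z * z.2) | z <- r].

Lemma tpreD r t x : tpre (tpD r) t x = \sum_(z <- r) freq z * tre z t x.
Proof. by rewrite /tpre big_map; apply: eq_bigr => z _; rewrite /tre/freq/=; ring. Qed.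

Lemma tpimD r t x : tpim (tpD r) t x = \sum_(z <- r) freq z * tim z t x.
Proof. by rewrite /tpim big_map; apply: eq_bigr => z _; rewrite /tim/freq/=; ring. Qed.

Lemma isd_cosZ k x : is_derive x 1 (fun x => cos (k * x)) (- (k * sin (k * x))).
Proof.
apply: (is_derive_eq (isdC (is_derive_cos (k * x)) (isdZ k (isd_id x)))).
by ring.
Qed.

Lemma isd_sinZ k x : is_derive x 1 (fun x => sin (k * x)) (k * cos (k * x)).
Proof.
apply: (is_derive_eq (isdC (is_derive_sin (k * x)) (isdZ k (isd_id x)))).
by ring.
Qed.

Lemma isd_expZ k x : is_derive x 1 (fun x => expR (k * x)) (k * expR (k * x)).
Proof.
apply: (is_derive_eq (isdC (is_derive_expR (k * x)) (isdZ k (isd_id x)))).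
by ring.
Qed.

Lemma tpre_x r t x : is_derive x 1 (tpre r t) (- tpim (tpD r) t x).
Proof.
rewrite tpimD -sumrN; apply: isd_sum => z.
apply: (is_derive_eq (isdZ _ (isdD (isdZ _ (isd_cosZ (freq z) x)) (isdZ _ (isd_sinZ (freq z) x))))).
by rewrite /tim; ring.
Qed.

Lemma tpim_x r t x : is_derive x 1 (tpim r t) (tpre (tpD r) t x).
Proof.
rewrite tpreD; apply: isd_sum => z.
apply: (is_derive_eq (isdZ _ (isdB (isdZ _ (isd_sinZ (freq z) x)) (isdZ _ (isd_cosZ (freq z) x))))).
by rewrite /tre; ring.
Qed.

Lemma tpre_t r t x : is_derive t 1 (fun t => tpre r t x) (- tpre (tpD r) t x).
Proof.
rewrite tpreD -sumrN; apply: isd_sum => z.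
apply: (is_derive_eq (isdM (isd_expZ (- freq z) t) (isd_cst _ t))).
by rewrite /tre; ring.
Qed.

Lemma tpim_t r t x : is_derive t 1 (fun t => tpim r t x) (- tpim (tpD r) t x).
Proof.
rewrite tpimD -sumrN; apply: isd_sum => z.
apply: (is_derive_eq (isdM (isd_expZ (- freq z) t) (isd_cst _ t))).
by rewrite /tim; ring.
Qed.

Lemma cont_tpre r t : continuous (tpre r t).
Proof. by move=> x; exact: der_cont (tpre_x r t x). Qed.

Lemma cont_tpim r t : continuous (tpim r t).
Proof. by move=> x; exact: der_cont (tpim_x r t x). Qed.

Lemma cos_period2 (k : nat) x : cos (k%:R * pi * (x + 2)) = cos (k%:R * pi * x).
Proof.
rewrite (_ : _ * (x + 2) = k%:R * pi * x + (pi *+ 2) *+ k).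
  by rewrite (periodicn (@cosD2pi R)).
by rewrite -[_ *+ k]mulr_natr; ring.
Qed.

Lemma sin_period2 (k : nat) x : sin (k%:R * pi * (x + 2)) = sin (k%:R * pi * x).
Proof.
rewrite (_ : _ * (x + 2) = k%:R * pi * x + (pi *+ 2) *+ k).
  by rewrite (periodicn (@sinD2pi R)).
by rewrite -[_ *+ k]mulr_natr; ring.
Qed.

Lemma tpre_period r t : tpre r t 2 = tpre r t 0.
Proof. by apply: eq_bigr => z _; rewrite /tre /freq -[2]add0r cos_period2 sin_period2. Qed.

Lemma tpim_period r t : tpim r t 2 = tpim r t 0.
Proof. by apply: eq_bigr => z _; rewrite /tim /freq -[2]add0r cos_period2 sin_period2. Qed.

Definition tpnorm r := \sum_(z <- r) (`|z.1.2| + `|z.2|).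

Lemma freq_ge0 z : 0 <= freq z.
Proof. by rewrite mulr_ge0// pi_ge0. Qed.

Lemma tpnorm_ge0 r : 0 <= tpnorm r.
Proof. by apply: sumr_ge0 => z _; rewrite addr_ge0. Qed.

Lemma trig_comb_le (a b k x : R) : `|a * cos (k * x) + b * sin (k * x)| <= `|a| + `|b|.
Proof.
apply: le_trans (ler_normD _ _) _; rewrite !normrM lerD//.
  by rewrite ler_piMr// cos_max.
by rewrite ler_piMr// sin_max.
Qed.

Lemma trig_comb_le' (a b k x : R) : `|a * sin (k * x) - b * cos (k * x)| <= `|a| + `|b|.
Proof.
apply: le_trans (ler_normB _ _) _; rewrite !normrM lerD//.
  by rewrite ler_piMr// sin_max.
by rewrite ler_piMr// cos_max.
Qed.

Lemma tpre_le r t x : 0 <= t -> `|tpre r t x| <= tpnorm r.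
Proof.
move=> t0; apply: le_trans (ler_norm_sum _ _ _) _; apply: ler_sum => z _.
rewrite normrM ger0_norm ?expR_ge0// -[leRHS]mul1r ler_pM ?expR_ge0//; last exact: trig_comb_le.
by rewrite -expR0 ler_expR mulNr oppr_le0 mulr_ge0 ?freq_ge0.
Qed.

(** A term of frequency 0 contributes the constant [- z.2], which must vanish for any decay. The
    other frequencies are at least 1, and exp (- k t) <= 1 / t for k >= 1. *)
Lemma tpim_decay r t x : (forall z, z \in r -> z.1.1 = 0%N -> z.2 = 0) ->
  0 < t -> `|tpim r t x| <= tpnorm r / t.
Proof.
move=> rz t0; apply: le_trans (ler_norm_sum _ _ _) _.
rewrite big_seq [leRHS]mulr_suml [leRHS]big_seq; apply: ler_sum => z zr.
rewrite normrM ger0_norm ?expR_ge0// mulrC.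
have [k0|k0] := posnP z.1.1.
  by rewrite /freq k0 mul0r mul0r sin0 (rz _ zr)// mulr0 mul0r subrr normr0 mul0r divr_ge0// ?addr_ge0// ltW.
rewrite ler_pM ?expR_ge0//; first exact: trig_comb_le'.
rewrite mulNr expRN lef_pV2 ?posrE ?expR_gt0//.
apply: le_trans (expR_ge1Dx _) => /=.
apply: (@le_trans _ _ (freq z * t)); last by rewrite lerDr.
rewrite ler_peMl ?(ltW t0)//.
have : 1 <= z.1.1%:R :> R by rewrite ler1n.
have := pi_ge2 R; rewrite /freq; nra.
Qed.

Lemma tbound_tpre r : tbound (tpre r).
Proof.
move=> T; exists (\sum_(z <- r) expR (freq z * T) * (`|z.1.2| + `|z.2|)) => t x tT.
apply: le_trans (ler_norm_sum _ _ _) _; apply: ler_sum => z _.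
rewrite normrM ger0_norm ?expR_ge0// ler_pM ?expR_ge0//; last exact: trig_comb_le.
rewrite ler_expR mulNr -mulrN ler_wpM2l ?freq_ge0//.
by apply: le_trans tT; rewrite -normrN ler_norm.
Qed.

Lemma tbound_tpim r : tbound (tpim r).
Proof.
move=> T; exists (\sum_(z <- r) expR (freq z * T) * (`|z.1.2| + `|z.2|)) => t x tT.
apply: le_trans (ler_norm_sum _ _ _) _; apply: ler_sum => z _.
rewrite normrM ger0_norm ?expR_ge0// ler_pM ?expR_ge0//; last exact: trig_comb_le'.
rewrite ler_expR mulNr -mulrN ler_wpM2l ?freq_ge0//.
by apply: le_trans tT; rewrite -normrN ler_norm.
Qed.

End conjugate.
Arguments cont_tpre {R} r t.
Arguments cont_tpim {R} r t.

Section convex_bounded.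
Context {R : realType}.

(** A positive slope at some [x >= 0] would keep the convex function above a line tending to
    infinity, against the bound [B]. *)
Lemma convex_bounded_nonincr (D D1 D2 : R -> R) (B : R) :
  (forall t : R, is_derive t 1 D (D1 t)) -> (forall t : R, is_derive t 1 D1 (D2 t)) ->
  (forall t : R, 0 <= D2 t) -> (forall t : R, 0 <= t -> D t <= B) ->
  forall t : R, 0 <= t -> D t <= D 0.
Proof.
move=> d1 d2 D2_ge0 DB t t0.
have cD x : {for x, continuous D} by exact: der_cont (d1 x).
have cD1 x : {for x, continuous D1} by exact: der_cont (d2 x).
have D1_mono x y : x <= y -> D1 x <= D1 y.
  move=> xy; apply: (@der_nondecr _ x y D1 D2) => //.
  by apply: continuous_subspaceT.
have D1_le0 x : 0 <= x -> D1 x <= 0.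
  move=> x0; rewrite leNgt; apply/negP => D1x.
  have grow y : x <= y -> D x + D1 x * (y - x) <= D y.
    move=> xy; rewrite -lerBrDl.
    rewrite -(@lerD2r _ (- D1 x * (x - x))) subrr mulr0 addr0.
    have : D x - D1 x * x <= D y - D1 x * y; last by lra.
    apply: (@der_nondecr _ x y (fun z => D z - D1 x * z) (fun z => D1 z - D1 x)) => //.
    - move=> z _; apply: (is_derive_eq (isdB (d1 z) (isdZ (D1 x) (isd_id z)))).
      by rewrite mulr1.
    - apply: continuous_subspaceT => z.
      exact: (der_cont (isdB (d1 z) (isdZ (D1 x) (isd_id z)))).
    - by move=> z /andP[xz _]; rewrite subr_ge0 D1_mono// ltW.
  (* At this point the tangent at [x] has climbed by [|B - D x| + 1], hence is above [B]. *)
  pose y := x + (`|B - D x| + 1) / D1 x.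
  have xy : x <= y by rewrite lerDl divr_ge0// ?ltW// addr_ge0.
  have := le_trans (grow y xy) (DB y (le_trans x0 xy)).
  rewrite /y [x + _]addrC addrK mulrC divfK ?gt_eqF//.
  have := ler_norm (B - D x); lra.
rewrite -lerN2; apply: (@der_nondecr _ 0 t (fun z => - D z) (fun z => - D1 z)) => //.
- by apply: continuous_subspaceT => z; exact: (der_cont (isdN (d1 z))).
- by move=> z /andP[z0 _]; rewrite oppr_ge0 D1_le0// ltW.
Qed.

End convex_bounded.

(** * Stein's inequality between a harmonic function and its conjugate *)

Section stein.
Context {R : realType}.
Implicit Types (r : seq (nat * R * R)) (t x : R).

Variables (r : seq (nat * R * R)) (sg e : R).
Hypotheses (rz : forall z, z \in r -> z.1.1 = 0%N -> z.2 = 0)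
  (sg12 : 2^-1 < sg) (sg1 : sg <= 1) (e0 : 0 < e).

Let u := tpre r.
Let v := tpim r.
Let P := tpre (tpD r).
Let Q := tpim (tpD r).
Let P2 := tpre (tpD (tpD r)).
Let Q2 := tpim (tpD (tpD r)).

(** The constant [e] keeps [w1] and [w2] away from 0, so that their powers are smooth even where [u]
    and [v] vanish. *)
Let w1 t x := u t x * u t x + e.
Let w2 t x := u t x * u t x + v t x * v t x + e.
Let w1t t x := - (2 * (u t x * P t x)).
Let w2t t x := - (2 * (u t x * P t x + v t x * Q t x)).
Let w1x t x := - (2 * (u t x * Q t x)).
Let w2x t x := 2 * (v t x * P t x - u t x * Q t x).
Let w1tt t x := 2 * (P t x * P t x + u t x * P2 t x).
Let w2tt t x := 2 * (P t x * P t x + u t x * P2 t x + Q t x * Q t x + v t x * Q2 t x).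
Let w1xx t x := 2 * (Q t x * Q t x - u t x * P2 t x).
Let w2xx t x := 2 * (P t x * P t x - u t x * P2 t x + Q t x * Q t x - v t x * Q2 t x).

Let ut t x := tpre_t r t x.
Let vt t x := tpim_t r t x.
Let Pt t x := tpre_t (tpD r) t x.
Let Qt t x := tpim_t (tpD r) t x.
Let ux t x := tpre_x r t x.
Let vx t x := tpim_x r t x.
Let Px t x := tpre_x (tpD r) t x.
Let Qx t x := tpim_x (tpD r) t x.

Let cu t : continuous (u t). Proof. exact: cont_tpre. Qed.
Let cv t : continuous (v t). Proof. exact: cont_tpim. Qed.
Let cP t : continuous (P t). Proof. exact: cont_tpre. Qed.
Let cQ t : continuous (Q t). Proof. exact: cont_tpim. Qed.
Let cP2 t : continuous (P2 t). Proof. exact: cont_tpre. Qed.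
Let cQ2 t : continuous (Q2 t). Proof. exact: cont_tpim. Qed.

Let bu : tbound u. Proof. exact: tbound_tpre. Qed.
Let bv : tbound v. Proof. exact: tbound_tpim. Qed.
Let bP : tbound P. Proof. exact: tbound_tpre. Qed.
Let bQ : tbound Q. Proof. exact: tbound_tpim. Qed.
Let bP2 : tbound P2. Proof. exact: tbound_tpre. Qed.
Let bQ2 : tbound Q2. Proof. exact: tbound_tpim. Qed.

Let ew1 t x : e <= w1 t x. Proof. by rewrite lerDr -expr2 sqr_ge0. Qed.
Let ew2 t x : e <= w2 t x. Proof. by rewrite lerDr -!expr2 addr_ge0// sqr_ge0. Qed.

Let d1t t x : is_derive t 1 (w1 ^~ x) (w1t t x).
Proof.
apply: (is_derive_eq (isdD (isdM (ut t x) (ut t x)) (isd_cst e t))).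
by rewrite /w1t /u /P; ring.
Qed.

Let d1tt t x : is_derive t 1 (w1t ^~ x) (w1tt t x).
Proof.
apply: (is_derive_eq (isdN (isdZ 2 (isdM (ut t x) (Pt t x))))).
by rewrite /w1tt /u /P /P2; ring.
Qed.

Let d1x t x : is_derive x 1 (w1 t) (w1x t x).
Proof.
apply: (is_derive_eq (isdD (isdM (ux t x) (ux t x)) (isd_cst e x))).
by rewrite /w1x /u /Q; ring.
Qed.

Let d1xx t x : is_derive x 1 (w1x t) (w1xx t x).
Proof.
apply: (is_derive_eq (isdN (isdZ 2 (isdM (ux t x) (Qx t x))))).
by rewrite /w1xx /u /Q /P2; ring.
Qed.

Let d2t t x : is_derive t 1 (w2 ^~ x) (w2t t x).
Proof.
apply: (is_derive_eq (isdD (isdD (isdM (ut t x) (ut t x)) (isdM (vt t x) (vt t x))) (isd_cst e t))).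
by rewrite /w2t /u /v /P /Q; ring.
Qed.

Let d2tt t x : is_derive t 1 (w2t ^~ x) (w2tt t x).
Proof.
apply: (is_derive_eq (isdN (isdZ 2 (isdD (isdM (ut t x) (Pt t x)) (isdM (vt t x) (Qt t x)))))).
by rewrite /w2tt /u /v /P /Q /P2 /Q2; ring.
Qed.

Let d2x t x : is_derive x 1 (w2 t) (w2x t x).
Proof.
apply: (is_derive_eq (isdD (isdD (isdM (ux t x) (ux t x)) (isdM (vx t x) (vx t x))) (isd_cst e x))).
by rewrite /w2x /u /v /P /Q; ring.
Qed.

Let d2xx t x : is_derive x 1 (w2x t) (w2xx t x).
Proof.
apply: (is_derive_eq (isdZ 2 (isdB (isdM (vx t x) (Px t x)) (isdM (ux t x) (Qx t x))))).
by rewrite /w2xx /u /v /P /Q /P2 /Q2; ring.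
Qed.

Let c1t t : continuous (w1t t).
Proof. exact: ((rcontN (rcontM (rcontK 2) (rcontM (cu t) (cP t))))). Qed.
Let c1tt t : continuous (w1tt t).
Proof. exact: ((rcontM (rcontK 2) (rcontD (rcontM (cP t) (cP t)) (rcontM (cu t) (cP2 t))))). Qed.
Let c1xx t : continuous (w1xx t).
Proof. exact: ((rcontM (rcontK 2) (rcontD (rcontM (cQ t) (cQ t)) (rcontN (rcontM (cu t) (cP2 t)))))). Qed.
Let c2t t : continuous (w2t t).
Proof. exact: ((rcontN (rcontM (rcontK 2) (rcontD (rcontM (cu t) (cP t)) (rcontM (cv t) (cQ t)))))). Qed.
Let c2tt t : continuous (w2tt t).
Proof. exact: ((rcontM (rcontK 2) (rcontD (rcontD (rcontD (rcontM (cP t) (cP t)) (rcontM (cu t) (cP2 t))) (rcontM (cQ t) (cQ t))) (rcontM (cv t) (cQ2 t))))). Qed.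
Let c2xx t : continuous (w2xx t).
Proof. exact: ((rcontM (rcontK 2) (rcontD (rcontD (rcontD (rcontM (cP t) (cP t)) (rcontN (rcontM (cu t) (cP2 t)))) (rcontM (cQ t) (cQ t))) (rcontN (rcontM (cv t) (cQ2 t)))))). Qed.

Let b1t : tbound w1t.
Proof. by repeat first [exact: bu|exact: bP|apply: tboundN|apply: tboundM|apply: tbound_cst]. Qed.
Let b1tt : tbound w1tt.
Proof. by repeat first [exact: bu|exact: bP|exact: bP2|apply: tboundM|apply: tboundD|apply: tbound_cst]. Qed.
Let b2t : tbound w2t.
Proof. by repeat first [exact: bu|exact: bP|exact: bv|exact: bQ|apply: tboundN|apply: tboundM|apply: tboundD|apply: tbound_cst]. Qed.
Let b2tt : tbound w2tt.
Proof. by repeat first [exact: bu|exact: bP|exact: bP2|exact: bv|exact: bQ|exact: bQ2|apply: tboundM|apply: tboundD|apply: tbound_cst]. Qed.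

Let p1 t : w1 t 2 = w1 t 0. Proof. by rewrite /w1 /u tpre_period. Qed.
Let p2 t : w2 t 2 = w2 t 0. Proof. by rewrite /w2 /u /v tpre_period tpim_period. Qed.
Let p1x t : w1x t 2 = w1x t 0.
Proof. by rewrite /w1x /u /Q tpre_period tpim_period. Qed.
Let p2x t : w2x t 2 = w2x t 0.
Proof. by rewrite /w2x /u /v /P /Q !tpre_period !tpim_period. Qed.

Let C := 2 / (2 * sg - 1).
Let M1 t := RI 0 2 (fun x => w1 t x `^ sg).
Let M2 t := RI 0 2 (fun x => w2 t x `^ sg).

Let M1' t : is_derive t 1 M1 (RI 0 2 (pm_t sg w1 w1t t)).
Proof. exact: (isd_pm e0 sg1 ew1 d1t d1x b1t). Qed.
Let M2' t : is_derive t 1 M2 (RI 0 2 (pm_t sg w2 w2t t)).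
Proof. exact: (isd_pm e0 sg1 ew2 d2t d2x b2t). Qed.
Let M1'' t : is_derive t 1 (fun t => RI 0 2 (pm_t sg w1 w1t t)) (RI 0 2 (pm_tt sg w1 w1t w1tt t)).
Proof. exact: (isd_pm_t e0 sg1 ew1 d1t d1tt d1x c1t b1t b1tt). Qed.
Let M2'' t : is_derive t 1 (fun t => RI 0 2 (pm_t sg w2 w2t t)) (RI 0 2 (pm_tt sg w2 w2t w2tt t)).
Proof. exact: (isd_pm_t e0 sg1 ew2 d2t d2tt d2x c2t b2t b2tt). Qed.

Let sg2 : 0 < 2 * sg - 1.
Proof. by rewrite subr_gt0 -ltr_pdivrMl// mulr1. Qed.

Let C_ge2 : 2 <= C.
Proof.
rewrite ler_pdivlMr// -[leRHS]mulr1 ler_pM2l// lerBlDr.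
by rewrite -[leRHS]/(2 : R) -[leRHS]mulr1 ler_pM2l.
Qed.

Let sg0 : 0 < sg.
Proof. by apply: lt_trans sg12; rewrite invr_gt0. Qed.

(** With E = P^2 + Q^2, the common squared gradient of [u] and [v], concavity of the power drops a
    nonpositive term: the Laplacian of [w2 ^ sg] is at most 4 sg E w2^(sg-1), hence at most 4 sg E
    w1^(sg-1). Since u^2 <= w1, that of [w1 ^ sg] is at least 2 sg (2 sg - 1) E w1^(sg-1). The ratio
    of the two constants is [C]. *)
Let lap_le t x :
  pm_lap sg w2 w2t w2x w2tt w2xx t x <= C * pm_lap sg w1 w1t w1x w1tt w1xx t x.
Proof.
have w10 : 0 < w1 t x by exact: lt_le_trans (ew1 t x).
have w20 : 0 < w2 t x by exact: lt_le_trans (ew2 t x).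
have w12 : w1 t x <= w2 t x by rewrite /w1 /w2 -addrA lerD2l lerDr -expr2 sqr_ge0.
have Uw : u t x * u t x <= w1 t x by rewrite /w1 lerDl ltW.
have mono : w2 t x `^ (sg - 1) <= w1 t x `^ (sg - 1).
  by apply: powR_ge_npos => //; rewrite subr_le0.
have split1 y : 0 < y -> y `^ (sg - 1) = y * y `^ (sg - 2).
  move=> y0; rewrite -[X in X * _]powRr1 ?ltW// -powRD; last by rewrite (gt_eqF y0) implybT.
  by congr (_ `^ _); ring.
set E := P t x * P t x + Q t x * Q t x.
have E0 : 0 <= E by rewrite addr_ge0// -expr2 sqr_ge0.
have -> : pm_lap sg w2 w2t w2x w2tt w2xx t x =
   sg * ((sg - 1) * w2 t x `^ (sg - 2) * (4 * (u t x * u t x + v t x * v t x) * E) +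
        w2 t x `^ (sg - 1) * (4 * E)).
  by rewrite /pm_lap /w2t /w2x /w2tt /w2xx /E; ring.
have -> : pm_lap sg w1 w1t w1x w1tt w1xx t x =
   sg * ((sg - 1) * w1 t x `^ (sg - 2) * (4 * (u t x * u t x) * E) +
        w1 t x `^ (sg - 1) * (2 * E)).
  by rewrite /pm_lap /w1t /w1x /w1tt /w1xx /E; ring.
apply: (@le_trans _ _ (sg * (w1 t x `^ (sg - 1) * (4 * E)))).
  rewrite ler_pM2l// -[leRHS]add0r lerD//; last by rewrite ler_wpM2r// mulr_ge0.
  rewrite mulr_le0_ge0//.
    by rewrite mulr_le0_ge0 ?powR_ge0// subr_le0.
  by rewrite !mulr_ge0// addr_ge0// -expr2 sqr_ge0.
rewrite [leRHS]mulrCA ler_pM2l// (split1 _ w10).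
have CE : C * (2 * sg - 1) = 2 by rewrite divfK// gt_eqF.
set A := w1 t x `^ (sg - 2).
have A0 : 0 <= A by exact: powR_ge0.
have -> : w1 t x * A * (4 * E) = C * (2 * sg - 1) * (2 * (A * E * w1 t x)).
  by rewrite CE; ring.
rewrite -mulrA ler_pM2l; last by exact: lt_le_trans C_ge2.
rewrite -subr_ge0.
have -> : (sg - 1) * A * (4 * (u t x * u t x) * E) + w1 t x * A * (2 * E) -
    (2 * sg - 1) * (2 * (A * E * w1 t x)) =
  4 * (1 - sg) * (A * E) * (w1 t x - u t x * u t x) by ring.
rewrite mulr_ge0 ?subr_ge0//.
by rewrite !mulr_ge0// subr_ge0.
Qed.

(* P. Stein's argument: up to [e], [D t] is C int |u|^s - int |u + i v|^s. Its second
   derivative is the integral over a period of a Laplacian, nonnegative by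
   [lap_le]; being convex and bounded above, [D] is nonincreasing, and it is
   asymptotically nonnegative because [v] tends to 0. Hence [0 <= D 0]. *)
Let D t := C * M1 t - M2 t.
Let D1 t := C * RI 0 2 (pm_t sg w1 w1t t) - RI 0 2 (pm_t sg w2 w2t t).
Let D2 t := C * RI 0 2 (pm_tt sg w1 w1t w1tt t) - RI 0 2 (pm_tt sg w2 w2t w2tt t).

Let cw1 t : continuous (w1 t).
Proof. by move=> x; exact: der_cont (d1x t x). Qed.
Let cw2 t : continuous (w2 t).
Proof. by move=> x; exact: der_cont (d2x t x). Qed.

Let cpow1 t (a : R) : continuous (fun x => w1 t x `^ a).
Proof.
move=> x; have w0 := lt_le_trans e0 (ew1 t x).
exact: der_cont (isdC (is_derive1_powR a w0) (d1x t x)).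
Qed.
Let cpow2 t (a : R) : continuous (fun x => w2 t x `^ a).
Proof.
move=> x; have w0 := lt_le_trans e0 (ew2 t x).
exact: der_cont (isdC (is_derive1_powR a w0) (d2x t x)).
Qed.

Let D2_ge0 t : 0 <= D2 t.
Proof.
rewrite /D2 (RI_pm_tt sg e0 ew1 d1x d1xx c1t c1tt c1xx p1 p1x).
rewrite (RI_pm_tt sg e0 ew2 d2x d2xx c2t c2tt c2xx p2 p2x).
have cl1 := cont_pm_lap sg e0 ew1 d1x d1xx c1t c1tt c1xx.
have cl2 := cont_pm_lap sg e0 ew2 d2x d2xx c2t c2tt c2xx.
rewrite -RI_Z; last exact: cl1.
rewrite subr_ge0; apply: RI_le; [exact: cl2| |by move=> x _; exact: lap_le].
exact: (rcontM (rcontK C) (cl1 t)).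
Qed.

Let D_bound t : 0 <= t -> D t <= C * ((tpnorm r ^+ 2 + e) `^ sg * 2).
Proof.
move=> t0; rewrite /D; apply: (@le_trans _ _ (C * M1 t)).
  by rewrite gerBl RI_ge0// => x _; exact: powR_ge0.
rewrite ler_pM2l; last by exact: lt_le_trans C_ge2.
have -> : (tpnorm r ^+ 2 + e) `^ sg * 2 = RI 0 2 (fun=> (tpnorm r ^+ 2 + e) `^ sg).
  by rewrite RI_cst// subr0.
apply: RI_le; [exact: cpow1|exact: rcontK|].
move=> x _; rewrite ge0_ler_powR ?nnegrE ?(ltW sg0)//.
- by rewrite ltW// (lt_le_trans e0).
- by rewrite addr_ge0 ?sqr_ge0// ltW.
- rewrite lerD2r -expr2 -real_normK ?num_real// ler_sqr ?nnegrE ?tpnorm_ge0//.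
  exact: tpre_le.
Qed.

(** As [sg <= 1] and [w1 <= w2], w2^sg <= w1^(sg-1) w2, so w2^sg - w1^sg <= e^(sg-1) v^2, and [v] is
    O(1/t) by [tpim_decay]. Lowering [C] to 1 in front of [M1] only decreases [D]. *)
Let D_lower t : 0 < t -> - (e `^ (sg - 1) * (tpnorm r / t) ^+ 2 * 2) <= D t.
Proof.
move=> t0; have -> : e `^ (sg - 1) * (tpnorm r / t) ^+ 2 * 2 =
    RI 0 2 (fun=> e `^ (sg - 1) * (tpnorm r / t) ^+ 2) by rewrite RI_cst// subr0.
rewrite /D lerBrDr addrC lerBlDr.
apply: (@le_trans _ _ (M1 t + RI 0 2 (fun=> e `^ (sg - 1) * (tpnorm r / t) ^+ 2))).
  rewrite /M1 -RI_D//; last exact: rcontK.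
  apply: RI_le => //; first exact: (rcontD (cpow1 t sg) (rcontK _)).
  move=> x _; have w0 := lt_le_trans e0 (ew1 t x).
  have w12 : w1 t x <= w2 t x by rewrite /w1 /w2 -addrA lerD2l lerDr -expr2 sqr_ge0.
  have q1 : 1 <= w2 t x / w1 t x by rewrite ler_pdivlMr// mul1r.
  have -> : w2 t x `^ sg = w1 t x `^ sg * (w2 t x / w1 t x) `^ sg.
    rewrite -powRM ?(ltW w0)//; last exact: le_trans q1.
    by rewrite mulrC divfK// gt_eqF.
  apply: (@le_trans _ _ (w1 t x `^ sg * (w2 t x / w1 t x))).
    by rewrite ler_wpM2l ?powR_ge0// ler1_powR.
  have -> : w1 t x `^ sg = w1 t x * w1 t x `^ (sg - 1) by rewrite mulr_powRB1 ?ltW.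
  rewrite mulrAC [w1 t x * (_ / _)]mulrC divfK ?gt_eqF//.
  rewrite -lerBlDl -mulrBl mulrC ler_pM ?powR_ge0 ?subr_ge0//.
    by apply: powR_ge_npos => //; rewrite subr_le0.
  have -> : w2 t x - w1 t x = v t x * v t x by rewrite /w1 /w2; ring.
  rewrite -expr2 -real_normK ?num_real// ler_sqr ?nnegrE ?divr_ge0 ?tpnorm_ge0 ?(ltW t0)//.
  exact: tpim_decay.
rewrite lerD2r ler_peMl//; last by apply: le_trans C_ge2; rewrite ler1n.
by apply: RI_ge0 => x _; exact: powR_ge0.
Qed.

Let D_ge0 : 0 <= D 0.
Proof.
have mono := @convex_bounded_nonincr R D D1 D2 _
  (fun z => isdB (isdZ C (M1' z)) (M2' z))
  (fun z => isdB (isdZ C (M1'' z)) (M2'' z)) D2_ge0 D_bound.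
set K := e `^ (sg - 1) * tpnorm r ^+ 2 * 2.
have K0 : 0 <= K by rewrite mulr_ge0// mulr_ge0 ?powR_ge0 ?sqr_ge0.
rewrite leNgt; apply/negP => D0.
(* For this [t], K / t^2 < - D 0, which contradicts [D_lower] combined with [D t <= D 0]. *)
pose t := 1 + K / - D 0.
have nD0 : 0 < - D 0 by rewrite oppr_gt0.
have t1 : 1 <= t by rewrite lerDl divr_ge0// ltW.
have t0 : 0 < t by exact: lt_le_trans t1.
have := le_trans (D_lower t t0) (mono t (ltW t0)); apply/negP; rewrite -ltNge.
rewrite ltrNr.
have -> : e `^ (sg - 1) * (tpnorm r / t) ^+ 2 * 2 = K / t / t.
  by rewrite /K; field; rewrite gt_eqF.
have Kt : K < - D 0 * t by rewrite /t mulrDr mulr1 mulrC [K / _ * _]divfK ?gt_eqF// ltrDr.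
rewrite ltr_pdivrMr// ltr_pdivrMr//; apply: lt_le_trans Kt _.
by rewrite -mulrA ler_pM2l// ler_peMl// ltW.
Qed.

Lemma stein_eps : RI 0 2 (fun x => (tpre r 0 x ^+ 2 + tpim r 0 x ^+ 2 + e) `^ sg) <=
  2 / (2 * sg - 1) * RI 0 2 (fun x => (tpre r 0 x ^+ 2 + e) `^ sg).
Proof. by have := D_ge0; rewrite subr_ge0. Qed.

End stein.

Section riesz_conjugate.
Context {R : realType}.
Implicit Types (x y a b s : R).

Lemma powR_subadd a b s : 0 <= a -> 0 <= b -> 0 < s -> s <= 1 -> (a + b) `^ s <= a `^ s + b `^ s.
Proof.
move=> a0 b0 s0 s1; have [ab|ab] := eqVneq (a + b) 0.
  by rewrite ab powR0 ?gt_eqF// addr_ge0 ?powR_ge0.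
have S : 0 < a + b by rewrite lt0r ab addr_ge0.
have H c : 0 <= c -> c <= a + b -> c / (a + b) * (a + b) `^ s <= c `^ s.
  move=> c0 cS; have [->|cn] := eqVneq c 0; first by rewrite !mul0r powR_ge0.
  have c1 : 0 < c by rewrite lt0r cn.
  rewrite -[X in _ <= X `^ _](divfK (lt0r_neq0 S)) [X in _ <= X]powRM ?divr_ge0 ?(ltW S)//.
  rewrite ler_wpM2r ?powR_ge0// ger1_powR// divr_gt0//=.
  by rewrite ler_pdivrMr// mul1r.
apply: le_trans (lerD (H a a0 _) (H b b0 _)); rewrite ?lerDl ?lerDr//.
by rewrite -mulrDl -mulrDl divff// mul1r.
Qed.

Lemma cont_powR_abs (f : R -> R) s (s0 : 0 < s) (cf : continuous f) :
  continuous (fun x => `|f x| `^ s).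
Proof.
move=> x.
have [fx|fx] := eqVneq (f x) 0; last first.
  apply: (@continuous_comp _ _ _ (fun x => `|f x|) (fun y => y `^ s)).
    by apply: cvg_norm; exact: cf.
  have nf : 0 < `|f x| by rewrite normr_gt0.
  exact: (der_cont (is_derive1_powR s nf)).
rewrite /continuous_at fx normr0 powR0 ?gt_eqF//.
apply/cvgrPdist_lt => e e0.
have := cf x; rewrite /continuous_at fx => /cvgrPdist_lt/(_ (e `^ s^-1)).
rewrite powR_gt0// => /(_ isT); apply: filterS => y.
rewrite !sub0r !normrN => h; rewrite ger0_norm ?powR_ge0//.
rewrite -[ltRHS](powRr1 (ltW e0)) -[X in _ < e `^ X](mulVf (lt0r_neq0 s0)) powRrM.
by rewrite gt0_ltr_powR// nnegrE ?powR_ge0.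
Qed.

Arguments cont_powR_abs {f s} s0 cf.

(** [stein_eps] with [sg = s / 2] turns squares into [s]-th powers and makes the constant 2 / (s -
    1). The regularisation is removed through subadditivity of the power [sg]. *)
Lemma riesz_conjugate (r : seq (nat * R * R)) s :
  (forall z, z \in r -> z.1.1 = 0%N -> z.2 = 0) -> 1 < s -> s <= 2 ->
  RI 0 2 (fun x => `|tpim r 0 x| `^ s) <= 2 / (s - 1) * RI 0 2 (fun x => `|tpre r 0 x| `^ s).
Proof.
move=> rz s1 s2; pose sg := s / 2.
have sE : s = 2 * sg by rewrite /sg mulrC divfK.
have sg12 : 2^-1 < sg by rewrite /sg -[ltLHS]mul1r ltr_pM2r// invr_gt0.
have sg1 : sg <= 1 by rewrite /sg ler_pdivrMr// mul1r.
have sg0 : 0 < sg by apply: lt_trans sg12; rewrite invr_gt0.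
have s0 : 0 < s by exact: lt_trans s1.
have C0 : 0 <= 2 / (s - 1) by rewrite divr_ge0// subr_ge0 ltW.
have cu := cont_tpre r 0; have cv := cont_tpim r 0.
have sqE (y : R) : (y ^+ 2) `^ sg = `|y| `^ s.
  by rewrite -real_normK ?num_real// -powR_mulrn// -powRrM sE.
have main e : 0 < e -> RI 0 2 (fun x => `|tpim r 0 x| `^ s) <=
    2 / (s - 1) * (RI 0 2 (fun x => `|tpre r 0 x| `^ s) + e * 2).
  (* Regularising by [d], whose [sg]-th power is [e], costs at most [e] pointwise, hence [e * 2]
     over the period. *)
  move=> e0; pose d := e `^ sg^-1.
  have d0 : 0 < d by rewrite powR_gt0.
  have dE : d `^ sg = e by rewrite /d -powRrM mulVf ?gt_eqF// powRr1// ltW.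
  have cpos (f : R -> R) : continuous f -> (forall x, 0 < f x) -> continuous (fun x => f x `^ sg).
    move=> cf f0 x; apply: (@continuous_comp _ _ _ f (fun y => y `^ sg)); first exact: cf.
    exact: (der_cont (is_derive1_powR sg (f0 x))).
  have c1 : continuous (fun x => (tpre r 0 x ^+ 2 + d) `^ sg).
    apply: cpos => [|x]; last by rewrite ltr_wpDl// sqr_ge0.
    by rewrite (_ : (fun x => _) = (fun x => tpre r 0 x * tpre r 0 x + d)) //; exact: (rcontD (rcontM cu cu) (rcontK d)).
  have c2 : continuous (fun x => (tpre r 0 x ^+ 2 + tpim r 0 x ^+ 2 + d) `^ sg).
    apply: cpos => [|x]; last by rewrite ltr_wpDl// addr_ge0// sqr_ge0.
    exact: (rcontD (rcontD (rcontM cu cu) (rcontM cv cv)) (rcontK d)).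
  apply: (@le_trans _ _ (RI 0 2 (fun x => (tpre r 0 x ^+ 2 + tpim r 0 x ^+ 2 + d) `^ sg))).
    apply: RI_le => //; first exact: cont_powR_abs.
    move=> x _; rewrite -sqE ge0_ler_powR ?nnegrE ?sqr_ge0 ?(ltW sg0)//.
      by rewrite !addr_ge0 ?sqr_ge0 ?ltW.
    by rewrite addrAC lerDr addr_ge0 ?sqr_ge0 ?ltW.
  have H := @stein_eps R r sg d rz sg12 sg1 d0; apply: (le_trans H).
  rewrite -sE ler_wpM2l//.
  rewrite -[X in _ + _ * X]subr0 -RI_cst// -RI_D; [|exact: cont_powR_abs|exact: rcontK].
  apply: RI_le => //; first exact: (rcontD (cont_powR_abs s0 cu) (rcontK e)).
  move=> x _; rewrite -sqE -dE; apply: powR_subadd => //; first exact: sqr_ge0.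
  exact: ltW.
apply/ler_addgt0Pl => e e0.
pose k := 2 / (s - 1) * 2 + 1.
have k0 : 0 < k by rewrite ltr_wpDl// mulr_ge0.
apply: le_trans (main (e / k) (divr_gt0 e0 k0)) _.
rewrite mulrDr addrC lerD2r [_ / k * 2]mulrAC mulrA ler_pdivrMr//.
by rewrite [e * 2]mulrC mulrA mulrC ler_pM2l// lerDl.
Qed.

End riesz_conjugate.
Arguments cont_powR_abs {R f s} s0 cf.

(** * The norm of L_s(0, 1) *)

Section integral_restr.
Local Open Scope ereal_scope.
Context d (T : measurableType d) (R : realType).
Variables (mu : {measure set T -> \bar R}) (D : set T) (mD : measurable D).
Import HBNNSimple.

Let integral_mrestr_indic (E : set T) : measurable E ->
  \int[mrestr mu mD]_x (\1_E x)%:E = \int[mu]_(x in D) (\1_E x)%:E.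
Proof. by move=> mE; rewrite !integral_indic// setIT. Qed.

Let integral_mrestr_nnsfun (h : {nnsfun T >-> R}) :
  \int[mrestr mu mD]_x (h x)%:E = \int[mu]_(x in D) (h x)%:E.
Proof.
under [LHS]eq_integral do rewrite fimfunE -fsumEFin//.
rewrite [LHS]ge0_integral_fsum//; last 2 first.
  - by move=> r; exact/measurable_EFinP/measurableT_comp.
  - by move=> n x _; rewrite EFinM nnfun_muleindic_ge0.
under [RHS]eq_integral do rewrite fimfunE -fsumEFin//.
rewrite [RHS]ge0_integral_fsum//; last 2 first.
  - by move=> r; apply/measurable_EFinP/measurableT_comp => //; exact: measurable_funTS.
  - by move=> n x _; rewrite EFinM nnfun_muleindic_ge0.
apply: eq_fsbigr => r _.
by rewrite !integralZl_indic_nnsfun//= integral_mrestr_indic.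
Qed.

(** From indicators to simple functions to monotone limits. It translates integrals against
    [lebesgue01] into Lebesgue integrals over the interval. *)
Lemma ge0_integral_mrestr (f : T -> \bar R) : measurable_fun setT f ->
  (forall x, 0 <= f x) -> \int[mrestr mu mD]_x f x = \int[mu]_(x in D) f x.
Proof.
move=> mf f0; pose f_ := nnsfun_approx measurableT mf.
transitivity (limn (fun n => \int[mrestr mu mD]_x (f_ n x)%:E)).
  rewrite -monotone_convergence//=; last 3 first.
  - by move=> n; exact/measurable_EFinP.
  - by move=> n x _; rewrite lee_fin.
  - by move=> x _ a b ab; rewrite lee_fin; exact/lefP/nd_nnsfun_approx.
  apply: eq_integral => x _; apply/esym/cvg_lim => //.
  by apply: cvg_nnsfun_approx => //= y _; exact: f0.
transitivity (limn (fun n => \int[mu]_(x in D) (f_ n x)%:E)).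
  by congr (limn _); apply/funext => n; exact: integral_mrestr_nnsfun.
rewrite -monotone_convergence//=; last 3 first.
- by move=> n; exact/measurable_EFinP/measurable_funTS.
- by move=> n x _; rewrite lee_fin.
- by move=> x _ a b ab; rewrite lee_fin; exact/lefP/nd_nnsfun_approx.
apply: eq_integral => x _; apply/cvg_lim => //.
by apply: cvg_nnsfun_approx => //= y _; exact: f0.
Qed.

End integral_restr.

Section Ls_norm.
Context {R : realType}.
Implicit Types (f g : R -> R) (s k : R).
Local Notation mu01 := (lebesgue01 R).

(** [fine] sends an infinite norm to 0, so the value is the norm only together with [inLs s f]. *)
Definition ns s f : R := fine (Lnorm mu01 s%:E (EFin \o f)).
Definition inLs s f : Prop := f \in Lfun mu01 s%:E.

Lemma inLsP s f : inLs s f <->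
  measurable_fun setT (f : measurableTypeR R -> R) /\ (Lnorm mu01 s%:E (EFin \o f) < +oo)%E.
Proof.
rewrite /inLs; split; first by rewrite inE => /andP[/[!inE]/= mf lf].
by move=> [mf lf]; rewrite inE; apply/andP; split; rewrite inE.
Qed.

Lemma ns_fineE s f : inLs s f -> (ns s f)%:E = Lnorm mu01 s%:E (EFin \o f).
Proof.
move=> /inLsP[mf lf]; rewrite fineK// fin_numElt lf andbT.
by rewrite (lt_le_trans ltNy0)// Lnorm_ge0.
Qed.
Arguments ns_fineE {s f} _.

Lemma ns_ge0 s f : 0 <= ns s f.
Proof. by rewrite fine_ge0// Lnorm_ge0. Qed.

Lemma eq_ns s f g : f =1 g -> ns s f = ns s g.
Proof. by move=> fg; rewrite (_ : f = g)//; exact/funext. Qed.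

Section s_ge1.
Variable s : R.
Hypothesis s1 : 1 <= s.
Let s1E : (1 <= s%:E)%E. Proof. by rewrite lee_fin. Qed.

Lemma inLsD f g : inLs s f -> inLs s g -> inLs s (fun x => f x + g x).
Proof. by move=> lf lg; exact: (Lfun_addr_closed mu01 s1E).2. Qed.
Arguments inLsD {f g} _ _.

Lemma inLsZ k f : inLs s f -> inLs s (fun x => k * f x).
Proof.
move=> lf; rewrite /inLs.
rewrite (_ : (fun x => k * f x) = k \o* f); first exact: Lfun_scale.
by apply/funext => x /=; rewrite mulrC.
Qed.
Arguments inLsZ k {f} _.

Lemma ns_triangle f g : inLs s f -> inLs s g -> ns s (fun x => f x + g x) <= ns s f + ns s g.
Proof.
move=> lf lg; have [/inLsP[mf _] /inLsP[mg _]] := (lf, lg).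
rewrite -lee_fin EFinD !ns_fineE//; last exact: inLsD.
exact: eminkowski.
Qed.
Arguments ns_triangle {f g} _ _.

Lemma nsZ k f : inLs s f -> ns s (fun x => k * f x) = `|k| * ns s f.
Proof.
move=> lf; apply: EFin_inj; rewrite EFinM !ns_fineE//; last exact: inLsZ.
exact: (LnormZ (Lfun_Sub s1E lf) k).
Qed.
Arguments nsZ k {f} _.

Lemma nsN f : inLs s f -> ns s (fun x => - f x) = ns s f.
Proof.
move=> lf; rewrite (@eq_ns _ _ (fun x => (-1) * f x)); last by move=> x; rewrite mulN1r.
by rewrite nsZ// normrN normr1 mul1r.
Qed.
Arguments nsN {f} _.

Lemma inLsB f g : inLs s f -> inLs s g -> inLs s (fun x => f x - g x).
Proof.
move=> lf lg; rewrite (_ : (fun x => _) = (fun x => f x + (-1) * g x)).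
  by apply: inLsD => //; exact: inLsZ.
by apply/funext => x; rewrite mulN1r.
Qed.
Arguments inLsB {f g} _ _.

Lemma ns_triangleB f g : inLs s f -> inLs s g -> ns s (fun x => f x - g x) <= ns s f + ns s g.
Proof.
move=> lf lg; rewrite -(nsN lg); apply: ns_triangle => //.
rewrite (_ : (fun x => _) = (fun x => (-1) * g x)); first exact: inLsZ.
by apply/funext => x; rewrite mulN1r.
Qed.
Arguments ns_triangleB {f g} _ _.

Lemma inLs_sum (I : Type) (r : seq I) (f : I -> R -> R) :
  (forall i, inLs s (f i)) -> inLs s (fun x => \sum_(i <- r) f i x).
Proof.
move=> lf; elim: r => [|i r IH].
  rewrite (_ : (fun x => _) = cst 0); first exact: (Lfun_addr_closed mu01 s1E).1.
  by apply/funext => x; rewrite big_nil.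
rewrite (_ : (fun x => _) = (fun x => f i x + \sum_(i <- r) f i x)); first exact: inLsD.
by apply/funext => x; rewrite big_cons.
Qed.
Arguments inLs_sum {I} r {f} _.

Let s0 : 0 < s. Proof. exact: lt_le_trans s1. Qed.
Let sN0 : s != 0. Proof. by rewrite gt_eqF. Qed.

Lemma LnormE f : measurable_fun setT (f : measurableTypeR R -> R) ->
  Lnorm mu01 s%:E (EFin \o f) =
  ((\int[lebesgue_measure]_(x in `[0%R, 1%R]) (`|f x| `^ s)%:E) `^ s^-1)%E.
Proof.
move=> mf; rewrite unlock.
have mfs : measurable_fun setT (fun x : measurableTypeR R => (`|f x| `^ s)%:E).
  apply/measurable_EFinP; apply: (measurableT_comp (measurable_powR s)).
  exact: measurableT_comp.
under eq_integral do rewrite /=.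
rewrite ge0_integral_mrestr//.
by rewrite -(@integral_itv_bndoo _ 0 1 _ true false)//; exact: measurable_funTS.
Qed.
Arguments LnormE {f} _.

Lemma cont_measurable f : continuous f -> measurable_fun setT (f : measurableTypeR R -> R).
Proof. by move=> cf; exact: continuous_measurable_fun. Qed.
Arguments cont_measurable {f} _.

Lemma cont_Lnorm f : continuous f ->
  Lnorm mu01 s%:E (EFin \o f) = ((RI 0 1 (fun x => `|f x| `^ s)) `^ s^-1)%:E.
Proof.
move=> cf; rewrite (LnormE (cont_measurable cf)).
rewrite -poweR_EFin; congr (_ `^ _)%E.
rewrite /RI /Rintegral fineK//; apply: integrable_fin_num => //.
exact: (cont_int _ _ (cont_powR_abs s0 cf)).
Qed.
Arguments cont_Lnorm {f} _.

Lemma cont_inLs f : continuous f -> inLs s f.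
Proof.
move=> cf; apply/inLsP; split; first exact: cont_measurable.
by rewrite (cont_Lnorm cf) ltry.
Qed.
Arguments cont_inLs {f} _.

Lemma ns_cont f : continuous f -> ns s f = RI 0 1 (fun x => `|f x| `^ s) `^ s^-1.
Proof. by move=> cf; rewrite /ns (cont_Lnorm cf). Qed.
Arguments ns_cont {f} _.

Lemma ns_contX f : continuous f -> ns s f `^ s = RI 0 1 (fun x => `|f x| `^ s).
Proof.
move=> cf; rewrite (ns_cont cf) -powRrM mulVf// powRr1//.
by apply: RI_ge0 => x _; exact: powR_ge0.
Qed.
Arguments ns_contX {f} _.

Lemma ns_le_cont f g : continuous f -> continuous g ->
  RI 0 1 (fun x => `|f x| `^ s) <= RI 0 1 (fun x => `|g x| `^ s) -> ns s f <= ns s g.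
Proof.
move=> cf cg fg; have I0 (h : R -> R) : RI 0 1 (fun x => `|h x| `^ s) \in Num.nneg.
  by rewrite nnegrE; apply: RI_ge0 => x _; exact: powR_ge0.
rewrite (ns_cont cf) (ns_cont cg); apply: ge0_ler_powR; [|exact: I0|exact: I0|exact: fg].
by rewrite invr_ge0 ltW.
Qed.
Arguments ns_le_cont {f g} _ _ _.

Lemma ns_le f g : continuous f -> continuous g ->
  (forall x, 0 <= x <= 1 -> `|f x| <= `|g x|) -> ns s f <= ns s g.
Proof.
move=> cf cg fg; apply: (ns_le_cont cf cg); apply: (RI_le (cont_powR_abs s0 cf) (cont_powR_abs s0 cg)).
by move=> x /fg fgx; rewrite ge0_ler_powR ?nnegrE// ltW.
Qed.
Arguments ns_le {f g} _ _ _.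

Lemma ns_cst k : 0 <= k -> ns s (cst k) = k.
Proof.
move=> k0; rewrite (ns_cont (rcontK k)).
by rewrite /= RI_cst// subr0 mulr1 ger0_norm// -powRrM mulfV// powRr1.
Qed.

Lemma ns_le_sup f k : continuous f -> 0 <= k -> (forall x, 0 <= x <= 1 -> `|f x| <= k) ->
  ns s f <= k.
Proof.
move=> cf k0 fk; rewrite -[leRHS]ns_cst//; apply: (ns_le cf (rcontK k)).
by move=> x /fk; rewrite /= (ger0_norm k0).
Qed.
Arguments ns_le_sup {f k} _ _ _.

End s_ge1.
Arguments cont_measurable {f} _.
Arguments ns_le_sup {s} _ {f k} _ _ _.
Arguments ns_le {s} _ {f g} _ _ _.
Arguments ns_le_cont {s} _ {f g} _ _ _.
Arguments ns_contX {s} _ {f} _.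
Arguments ns_cont {s} _ {f} _.
Arguments cont_inLs {s} _ {f} _.
Arguments inLs_sum {s} _ {I} r {f} _.
Arguments ns_triangleB {s} _ {f g} _ _.
Arguments ns_triangle {s} _ {f g} _ _.
Arguments inLsB {s} _ {f g} _ _.
Arguments nsZ {s} _ k {f} _.
Arguments inLsD {s} _ {f g} _ _.
Arguments inLsZ {s} _ k {f} _.
Arguments nsN {s} _ {f} _.

Lemma ns_hoelder s s' f g : 1 < s -> 1 < s' -> s^-1 + s'^-1 = 1 ->
  continuous f -> continuous g -> `|RI 0 1 (fun x => f x * g x)| <= ns s f * ns s' g.
Proof.
move=> s1 s'1 ss' cf cg.
have cfg := rcontM cf cg.
apply: le_trans (RI_abs _ _ cfg) _.
have := hoelder mu01 (cont_measurable cf) (cont_measurable cg)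
  (lt_trans ltr01 s1) (lt_trans ltr01 s'1) ss'.
rewrite -[X in (X <= _)%E -> _](ns_fineE (cont_inLs (lexx 1) cfg)).
rewrite -(ns_fineE (cont_inLs (ltW s1) cf)) -(ns_fineE (cont_inLs (ltW s'1) cg)).
rewrite -EFinM lee_fin (ns_cont (lexx 1) cfg) invr1 powRr1; last by apply: RI_ge0 => x _; exact: powR_ge0.
by rewrite (@eq_RI _ _ _ _ (fun x => `|f x * g x|))// => x _; rewrite powRr1.
Qed.

End Ls_norm.
Arguments inLsP {R} s f.
Arguments ns_fineE {R s f} _.
Arguments inLsD {R s} _ {f g} _ _.
Arguments inLsZ {R s} _ k {f} _.
Arguments inLsB {R s} _ {f g} _ _.
Arguments inLs_sum {R s} _ {I} r {f} _.
Arguments ns_triangle {R s} _ {f g} _ _.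
Arguments ns_triangleB {R s} _ {f g} _ _.
Arguments nsZ {R s} _ k {f} _.
Arguments nsN {R s} _ {f} _.
Arguments cont_measurable {R f} _.
Arguments cont_inLs {R s} _ {f} _.
Arguments ns_cont {R s} _ {f} _.
Arguments ns_contX {R s} _ {f} _.
Arguments ns_le_cont {R s} _ {f g} _ _ _.
Arguments ns_le {R s} _ {f g} _ _ _.
Arguments ns_le_sup {R s} _ {f k} _ _ _.
Arguments ns_hoelder {R s s' f g} _ _ _ _ _.

(** * Orthogonality of the cosines on (0, 1) *)

Section cos_orthogonality.
Context {R : realType}.
Implicit Types (a b : nat -> R).

Lemma cosnpi (n : nat) : sin (n%:R * pi) = 0 :> R.
Proof.
by rewrite mulr_natl -[_ *+ _]add0r (alternatingn (@sinDpi R)) sin0 mulr0.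
Qed.

Lemma RI_cosn (n : nat) : (0 < n)%N -> RI 0 1 (cosn n) = 0 :> R.
Proof.
move=> n0; have k0 : n%:R * pi != 0 :> R by rewrite mulf_neq0 ?pnatr_eq0 ?gt_eqF// ?pi_gt0// -lt0n.
transitivity ((n%:R * pi)^-1 * sin (n%:R * pi * 1) - (n%:R * pi)^-1 * sin (n%:R * pi * 0) : R); last first.
  by rewrite mulr1 cosnpi !mulr0 sin0 mulr0 subrr.
apply: (RI_FTC (F := fun x => (n%:R * pi)^-1 * sin (n%:R * pi * x)) ler01 (cont_cosn n)) => x _.
apply: (is_derive_eq (isdZ _ (isd_sinZ (n%:R * pi) x))).
by rewrite mulKf.
Qed.

(** The squared L_2 norm of [cosn n] on (0, 1). *)
Definition wn (n : nat) : R := if n is 0%N then 1 else 2^-1.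

Lemma cosnM (m n : nat) (x : R) : (m <= n)%N ->
  cosn m x * cosn n x = 2^-1 * cosn (n - m) x + 2^-1 * cosn (n + m) x.
Proof.
move=> mn; rewrite /cosn natrB// natrD.
have -> : (n%:R - m%:R) * pi * x = n%:R * pi * x - m%:R * pi * x by ring.
have -> : (n%:R + m%:R) * pi * x = n%:R * pi * x + m%:R * pi * x by ring.
by rewrite cosB cosD; field.
Qed.

Lemma RI_cosnM (m n : nat) : RI 0 1 (fun x => cosn m x * cosn n x) = (m == n)%:R * wn n :> R.
Proof.
wlog mn : m n / (m <= n)%N.
  move=> H; have [|/ltnW nm] := leqP m n; first exact: H.
  rewrite (@eq_RI _ _ _ _ (fun x => cosn n x * cosn m x)); last by move=> x _; rewrite mulrC.
  by rewrite H// eq_sym; case: eqP => [->|_]; rewrite ?mul0r.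
rewrite (@eq_RI _ _ _ _ (fun x => 2^-1 * cosn (n - m) x + 2^-1 * cosn (n + m) x)); last first.
  by move=> x _; exact: cosnM.
rewrite (RI_D _ _ (rcontM (rcontK _) (cont_cosn (n - m))) (rcontM (rcontK _) (cont_cosn (n + m)))).
rewrite (RI_Z _ _ _ (cont_cosn (n - m))) (RI_Z _ _ _ (cont_cosn (n + m))).
have c0 : RI 0 1 (cosn 0) = 1 :> R.
  rewrite (@eq_RI _ _ _ _ (fun=> 1)); last by move=> x _; rewrite cosn0.
  by rewrite RI_cst// mul1r subr0.
have [->|mn'] := eqVneq m n.
  rewrite subnn c0 mul1r mulr1; case: n {mn} => [|n].
    by rewrite -[wn 0]/(1 : R) addn0 c0 mulr1 [RHS]splitr mul1r.
  by rewrite -[wn _]/(2^-1 : R) RI_cosn// mulr0 addr0.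
rewrite mul0r RI_cosn ?subn_gt0 ?ltn_neqAle ?mn'// RI_cosn ?mulr0 ?addr0//.
by rewrite addn_gt0; case: n mn mn' => //; rewrite leqn0 => /eqP->.
Qed.

Lemma RI_cpoly_cosn a N n :
  RI 0 1 (fun x => cpoly a N x * cosn n x) = trunc_seq a N n * wn n.
Proof.
rewrite (@eq_RI _ _ _ _ (fun x => \sum_(0 <= m < N) a m * (cosn m x * cosn n x))); last first.
  by move=> x _; rewrite mulr_suml; apply: eq_bigr => m _; rewrite mulrA.
rewrite RI_sum; last by move=> m; exact: (rcontM (rcontK _) (rcontM (cont_cosn m) (cont_cosn n))).
rewrite (eq_bigr (fun m => a m * ((m == n)%:R * wn n))); last first.
  by move=> m _; rewrite (RI_Z _ _ _ (rcontM (cont_cosn m) (cont_cosn n))) RI_cosnM.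
rewrite /trunc_seq; case: ltnP => nN.
  rewrite (big_cat_nat (n := n) _ (ltnW nN))//= (big_ltn nN) eqxx mul1r.
  rewrite !big1_seq ?addr0 ?add0r// => i; rewrite mem_index_iota => /andP[_ /andP[h1 h2]].
    by rewrite gtn_eqF// mul0r mulr0.
  by rewrite ltn_eqF// mul0r mulr0.
rewrite mul0r big1_seq// => i; rewrite mem_index_iota => /andP[_ /andP[_ iN]].
by rewrite ltn_eqF ?mul0r ?mulr0//; exact: leq_trans nN.
Qed.

Lemma RI_cpolyM a N b M :
  RI 0 1 (fun x => cpoly a N x * cpoly b M x) = \sum_(0 <= n < M) b n * (trunc_seq a N n * wn n).
Proof.
rewrite (@eq_RI _ _ _ _ (fun x => \sum_(0 <= n < M) b n * (cpoly a N x * cosn n x))); last first.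
  by move=> x _; rewrite [in RHS]/cpoly mulr_sumr; apply: eq_bigr => m _; rewrite mulrCA.
rewrite RI_sum; last by move=> m; exact: (rcontM (rcontK _) (rcontM (cont_cpoly a N) (cont_cosn m))).
by apply: eq_bigr => m _; rewrite (RI_Z _ _ _ (rcontM (cont_cpoly a N) (cont_cosn m))) RI_cpoly_cosn.
Qed.

(** Taking partial sums is self-adjoint: by orthogonality only the frequencies below [M] survive on
    either side. This is what the duality argument rests on. *)
Lemma RI_partial_adjoint a b M N L : (M <= N)%N -> (M <= L)%N ->
  RI 0 1 (fun x => cpoly a M x * cpoly b L x) = RI 0 1 (fun x => cpoly a N x * cpoly b M x).
Proof.
move=> MN ML; rewrite !RI_cpolyM (big_cat_nat (n := M))//= [X in _ + X]big1_seq ?addr0.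
  apply: eq_big_nat => n /andP[_ nM]; rewrite /trunc_seq nM.
  by rewrite (leq_trans nM MN).
move=> n; rewrite mem_index_iota => /andP[_ /andP[Mn _]].
by rewrite /trunc_seq ltnNge Mn mul0r mulr0.
Qed.

Lemma cpoly_refl a N x : cpoly a N (2 - x) = cpoly a N x.
Proof.
apply: eq_bigr => n _; congr (_ * _); rewrite /cosn.
rewrite -(cosN (n%:R * pi * x)) [2 - x]addrC cos_period2.
by congr cos; ring.
Qed.

Lemma RI02_cpoly a N s : 0 < s ->
  RI 0 2 (fun x => `|cpoly a N x| `^ s) = 2 * RI 0 1 (fun x => `|cpoly a N x| `^ s).
Proof.
move=> s0; have cf := cont_powR_abs s0 (cont_cpoly a N).
rewrite (@RI_cat _ 0 1 2 _ _ _ cf)//; last by rewrite ler1n.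
rewrite (_ : RI 1 2 _ = RI 0 1 (fun x => `|cpoly a N x| `^ s)); first by ring.
have := @RI_refl _ 2 0 1 _ ler01 cf.
rewrite subr0 (_ : 2 - 1 = 1); last by ring.
by move=> <-; apply: eq_RI => x _; rewrite cpoly_refl.
Qed.

End cos_orthogonality.
Arguments RI02_cpoly {R} a N {s} _.
Arguments RI_cpoly_cosn {R} a N n.

(** * Partial sums and Schauder bases *)

Section partial_sums.
Context {R : realType}.
Implicit Types (a b : nat -> R) (x s : R) (M N n : nat).

(** [sgnd] and [ndist] are the sign and the absolute value of M - n, which keep frequencies in the
    natural numbers. *)
Definition sgnd M n : R := if (n < M)%N then 1 else if n == M then 0 else -1.
Definition ndist M n : nat := (M - n) + (n - M).

(* With f the cosine polynomial of coefficients a and H the conjugation, the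
   partial sum of f of order M is
   sin_M H(cos_M f) - cos_M H(sin_M f) - (a_M / 2) cos_M;
   [cosmod] and [sinmod] encode cos_M f and sin_M f. *)
Definition cosmod a N M : seq (nat * R * R) :=
  [seq ((M + n)%N, a n / 2, 0) | n <- index_iota 0 N] ++
  [seq (ndist M n, a n / 2, 0) | n <- index_iota 0 N].
Definition sinmod a N M : seq (nat * R * R) :=
  [seq ((M + n)%N, 0, a n / 2) | n <- index_iota 0 N] ++
  [seq (ndist M n, 0, sgnd M n * (a n / 2)) | n <- index_iota 0 N].

Definition sinn n x : R := sin (n%:R * pi * x).

Lemma tpre_cat (r1 r2 : seq (nat * R * R)) t x :
  tpre (r1 ++ r2) t x = tpre r1 t x + tpre r2 t x.
Proof. exact: big_cat. Qed.

Lemma tpim_cat (r1 r2 : seq (nat * R * R)) t x :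
  tpim (r1 ++ r2) t x = tpim r1 t x + tpim r2 t x.
Proof. exact: big_cat. Qed.

Lemma sgndP M n x :
  [/\ cosn (ndist M n) x = cosn M x * cosn n x + sinn M x * sinn n x,
      sgnd M n * sinn (ndist M n) x = sinn M x * cosn n x - cosn M x * sinn n x &
      sinn M x * sinn (ndist M n) x + sgnd M n * cosn M x * cosn (ndist M n) x =
        sgnd M n * cosn n x].
Proof.
rewrite /cosn /sinn /ndist /sgnd; have [nM|Mn|->] := ltngtP n M.
- rewrite (eqP (ltnW nM)) addn0 natrB ?(ltnW nM)//.
  have -> : (M%:R - n%:R) * pi * x = M%:R * pi * x - n%:R * pi * x by ring.
  rewrite cosB sinB; split; [by []|by rewrite mul1r|].
  have := cos2Dsin2 (M%:R * pi * x); set c := cos _; set d := sin _ => h.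
  by apply/eqP; rewrite -subr_eq0; apply/eqP; transitivity ((c ^+ 2 + d ^+ 2 - 1) * cos (n%:R * pi * x)); [ring|rewrite h subrr mul0r].
- rewrite (eqP (ltnW Mn)) add0n natrB ?(ltnW Mn)//.
  have -> : (n%:R - M%:R) * pi * x = n%:R * pi * x - M%:R * pi * x by ring.
  rewrite cosB sinB; split; [by ring|by ring|].
  have := cos2Dsin2 (M%:R * pi * x); set c := cos _; set d := sin _ => h.
  by apply/eqP; rewrite -subr_eq0; apply/eqP; transitivity ((1 - (c ^+ 2 + d ^+ 2)) * cos (n%:R * pi * x)); [ring|rewrite h subrr mul0r].
- rewrite subnn addn0 !mul0r cos0 sin0; split; [|by ring|by ring].
  by rewrite -!expr2 cos2Dsin2.
Qed.

Lemma cosnD M n x : cosn (M + n) x = cosn M x * cosn n x - sinn M x * sinn n x.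
Proof. by rewrite /cosn /sinn natrD -cosD; congr cos; ring. Qed.

Lemma sinnD M n x : sinn (M + n) x = sinn M x * cosn n x + cosn M x * sinn n x.
Proof. by rewrite /cosn /sinn natrD -sinD; congr sin; ring. Qed.

Lemma expR_N0 (k : R) : expR (- k * 0) = 1. Proof. by rewrite mulr0 expR0. Qed.

Lemma tpre_cosmod a N M x : tpre (cosmod a N M) 0 x = cosn M x * cpoly a N x.
Proof.
rewrite tpre_cat /tpre !big_map -big_split mulr_sumr; apply: eq_bigr => n _.
rewrite /tre /freq /= !expR_N0 -/(cosn (M + n) x) -/(cosn (ndist M n) x) cosnD.
by have [-> _ _] := sgndP M n x; field.
Qed.

Lemma tpre_sinmod a N M x : tpre (sinmod a N M) 0 x = sinn M x * cpoly a N x.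
Proof.
rewrite tpre_cat /tpre !big_map -big_split mulr_sumr; apply: eq_bigr => n _.
rewrite /tre /freq /= !expR_N0 -/(sinn (M + n) x) -/(sinn (ndist M n) x) sinnD.
have [_ h _] := sgndP M n x.
transitivity (a n / 2 * (sinn M x * cosn n x + cosn M x * sinn n x) +
  a n / 2 * (sgnd M n * sinn (ndist M n) x)); first by ring.
by rewrite h; field.
Qed.

(** Shifting the spectrum by M in both directions, conjugating and shifting back multiplies the n-th
    coefficient by (1 + sgn (M - n)) / 2: 1 below M, 1/2 at M, 0 above. Hence the correction by half
    of the M-th term in [tpim_modE']. *)
Lemma tpim_modE a N M x : sinn M x * tpim (cosmod a N M) 0 x - cosn M x * tpim (sinmod a N M) 0 x =
  \sum_(0 <= n < N) a n * (2^-1 * (1 + sgnd M n)) * cosn n x.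
Proof.
rewrite !tpim_cat /tpim !big_map -!big_split !mulr_sumr -sumrB; apply: eq_bigr => n _.
rewrite /tim /freq /= !expR_N0 -/(sinn (M + n) x) -/(sinn (ndist M n) x).
rewrite -/(cosn (M + n) x) -/(cosn (ndist M n) x) sinnD cosnD.
have [_ _ h] := sgndP M n x; have h2 := cos2Dsin2 (M%:R * pi * x).
rewrite -/(cosn M x) -/(sinn M x) in h2.
transitivity (a n / 2 * ((cosn M x ^+ 2 + sinn M x ^+ 2) * cosn n x +
  (sinn M x * sinn (ndist M n) x + sgnd M n * cosn M x * cosn (ndist M n) x))).
  by field.
by rewrite h h2; field.
Qed.

(** With M > 0 the frequency 0 arises only from n = M in the second list, where the sine coefficient
    carries the factor [sgnd M M = 0]. *)
Lemma sinmod_ok a N M : (0 < M)%N -> forall z, z \in sinmod a N M -> z.1.1 = 0%N -> z.2 = 0.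
Proof.
move=> M0 z; rewrite mem_cat => /orP[] /mapP[n _ ->] /=.
  by move/eqP; rewrite addn_eq0 => /andP[/eqP M00 _]; rewrite M00 in M0.
rewrite /ndist => /eqP; rewrite addn_eq0 !subn_eq0 => /andP[h1 h2].
have -> : n = M by apply/eqP; rewrite eqn_leq h1 h2.
by rewrite /sgnd ltnn eqxx mul0r.
Qed.

Lemma cosmod_ok a N M : forall z, z \in cosmod a N M -> z.1.1 = 0%N -> z.2 = 0.
Proof. by move=> z; rewrite mem_cat => /orP[] /mapP[n _ ->]. Qed.

Lemma tpim_modE' a N M x : (M < N)%N ->
  cpoly a M x = sinn M x * tpim (cosmod a N M) 0 x - cosn M x * tpim (sinmod a N M) 0 x -
    (2^-1 * a M) * cosn M x.
Proof.
move=> MN; rewrite tpim_modE (big_cat_nat (n := M) _ (ltnW MN))//= (big_ltn MN).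
rewrite [X in _ + (_ + X)]big1_seq ?addr0; last first.
  move=> n; rewrite mem_index_iota => /andP[_ /andP[Mn _]].
  by rewrite /sgnd ltnNge ltnW//= gtn_eqF// subrr mulr0 mulr0 mul0r.
rewrite [X in (_ + X) - _](_ : _ = 2^-1 * a M * cosn M x); last first.
  by rewrite /sgnd ltnn eqxx addr0 mulr1 [a M * _]mulrC.
rewrite addrK; apply: eq_big_nat => n /andP[_ nM].
by rewrite /sgnd nM -[1 + 1]/(2 : R) mulVf ?mulr1// pnatr_eq0.
Qed.

(** The conjugation inequality is over a period of length 2. Restricting to [0, 1] decreases the
    left integral, while the integral of the polynomial, symmetric about 1, is twice that over
    [0, 1]: this is the extra factor 2. *)
Lemma conj_bound (r : seq (nat * R * R)) a N s :
  (forall z, z \in r -> z.1.1 = 0%N -> z.2 = 0) -> 1 < s -> s <= 2 ->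
  (forall x, `|tpre r 0 x| <= `|cpoly a N x|) ->
  ns s (tpim r 0) <= (2 * (2 / (s - 1))) `^ s^-1 * ns s (cpoly a N).
Proof.
move=> rz s1 s2 le; have s0 : 0 < s by exact: lt_trans s1.
have C0 : 0 <= 2 / (s - 1) by rewrite divr_ge0// subr_ge0 ltW.
have s1' := ltW s1.
rewrite (ns_cont s1' (cont_tpim r 0)) (ns_cont s1' (cont_cpoly a N)).
have cu := cont_powR_abs s0 (cont_tpre r 0); have cv := cont_powR_abs s0 (cont_tpim r 0).
have cf := cont_powR_abs s0 (cont_cpoly a N).
have I0 (c d : R) (h : R -> R) : 0 <= RI c d (fun x => `|h x| `^ s).
  by apply: RI_ge0 => x _; exact: powR_ge0.
rewrite -powRM; [|by rewrite mulr_ge0|exact: I0].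
apply: ge0_ler_powR; rewrite ?invr_ge0 ?(ltW s0)// ?nnegrE; [exact: I0| |].
  by apply: mulr_ge0; [rewrite mulr_ge0|exact: I0].
apply: (@le_trans _ _ (RI 0 2 (fun x => `|tpim r 0 x| `^ s))).
  by rewrite (@RI_cat _ 0 1 2 _ _ _ cv) ?ler1n// lerDl; exact: I0.
apply: le_trans (@riesz_conjugate R r s rz s1 s2) _.
rewrite [2 * (2 / _)]mulrC -[leRHS]mulrA -(RI02_cpoly a N s0).
apply: (ler_wpM2l C0).
apply: (RI_le cu cf) => x _.
by apply: ge0_ler_powR; rewrite ?nnegrE ?(ltW s0).
Qed.

Lemma cont_sinn n : continuous (sinn n).
Proof.
move=> x; exact: (der_cont (isd_sinZ (n%:R * pi) x)).
Qed.

Lemma cosn_le1 n x : `|cosn n x| <= 1. Proof. exact: cos_max. Qed.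
Lemma sinn_le1 n x : `|sinn n x| <= 1. Proof. exact: sin_max. Qed.

(** Hoelder's inequality against [cosn n], whose norm is at most 1; the 2 inverts the smallest value
    of [wn]. *)
Lemma coef_bound a N n s : 1 < s -> (n < N)%N -> `|a n| <= 2 * ns s (cpoly a N).
Proof.
move=> s1 nN; have s0 : 0 < s by exact: lt_trans s1.
pose s' := (1 - s^-1)^-1.
have i1 : 0 < 1 - s^-1 by rewrite subr_gt0 invf_lt1.
have s'1 : 1 < s' by rewrite /s' invf_gt1// gtrBl invr_gt0.
have ss' : s^-1 + s'^-1 = 1 by rewrite /s' invrK subrKC.
have := ns_hoelder s1 s'1 ss' (cont_cpoly a N) (cont_cosn n).
rewrite RI_cpoly_cosn /trunc_seq nN normrM => h.
have w2 : 2^-1 <= `|wn n : R|.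
  case: n {nN h} => [|n]; rewrite /wn ger0_norm ?invr_ge0//.
  by rewrite invf_le1// ler1n.
have n1 : ns s' (cosn n) <= 1 :> R.
  by apply: (ns_le_sup (ltW s'1) (cont_cosn n) ler01) => x _; exact: cosn_le1.
rewrite -ler_pdivrMl//.
apply: (@le_trans _ _ (`|a n| * `|wn n|)).
  by rewrite mulrC ler_wpM2l.
by apply: le_trans h _; rewrite ler_piMr// ns_ge0.
Qed.

Lemma cpoly0 a x : cpoly a 0 x = 0.
Proof. by rewrite /cpoly big_geq. Qed.

Lemma partial_sum_le2 s : 1 < s -> s <= 2 ->
  exists2 K, 1 <= K & forall a M N, (M <= N)%N -> ns s (cpoly a M) <= K * ns s (cpoly a N).
Proof.
move=> s1 s2; have s1' := ltW s1; set c := (2 * (2 / (s - 1))) `^ s^-1.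
have c0 : 0 <= c by exact: powR_ge0.
exists (c + c + 1); first by rewrite lerDr addr_ge0.
move=> a M N; rewrite leq_eqVlt => /predU1P[->|MN].
  by rewrite ler_peMl ?ns_ge0// lerDr addr_ge0.
(* The empty partial sum is set apart because [sinmod_ok] asks for M > 0. *)
have [M0|M0] := posnP M.
  rewrite M0 (@eq_ns _ _ _ (cst 0)); last by move=> x; rewrite cpoly0.
  by rewrite ns_cst// mulr_ge0 ?ns_ge0// !addr_ge0.
set v1 := tpim (cosmod a N M) 0; set v2 := tpim (sinmod a N M) 0.
have cv1 : continuous v1 := cont_tpim _ _.
have cv2 : continuous v2 := cont_tpim _ _.
have c1 := rcontM (cont_sinn M) cv1.
have c2 := rcontM (cont_cosn M) cv2.
have c3 := rcontM (rcontK (2^-1 * a M)) (cont_cosn M).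
rewrite (@eq_ns _ _ _ (fun x => (sinn M x * v1 x - cosn M x * v2 x) - (2^-1 * a M) * cosn M x)); last first.
  by move=> x; exact: tpim_modE'.
apply: le_trans (ns_triangleB s1' (inLsB s1' (cont_inLs s1' c1) (cont_inLs s1' c2)) (cont_inLs s1' c3)) _.
rewrite !mulrDl; apply: lerD.
  apply: le_trans (ns_triangleB s1' (cont_inLs s1' c1) (cont_inLs s1' c2)) _.
  apply: lerD.
    apply: (@le_trans _ _ (ns s v1)).
      by apply: (ns_le s1' c1 cv1) => x _; rewrite normrM ler_piMl// sinn_le1.
    apply: (@conj_bound (cosmod a N M) a N s (@cosmod_ok a N M) s1 s2) => x.
    by rewrite tpre_cosmod normrM ler_piMl// cosn_le1.
  apply: (@le_trans _ _ (ns s v2)).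
    by apply: (ns_le s1' c2 cv2) => x _; rewrite normrM ler_piMl// cosn_le1.
  apply: (@conj_bound (sinmod a N M) a N s (@sinmod_ok a N M M0) s1 s2) => x.
  by rewrite tpre_sinmod normrM ler_piMl// sinn_le1.
rewrite (nsZ s1' _ (cont_inLs s1' (cont_cosn M))) mul1r normrM.
have n1 : ns s (cosn M) <= 1 :> R.
  by apply: (ns_le_sup s1' (cont_cosn M) ler01) => x _; exact: cosn_le1.
apply: (@le_trans _ _ (`|2^-1| * `|a M|)); first by rewrite ler_piMr// mulr_ge0.
rewrite ger0_norm ?invr_ge0// ler_pdivrMl//.
exact: coef_bound.
Qed.

End partial_sums.
Arguments partial_sum_le2 {R s} _ _.
Arguments coef_bound {R} a {N n s} _ _.

Arguments RI_partial_adjoint {R} a b {M N L} _ _.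
Arguments weierstrass_cos {R g e} _ _.

Section duality.
Context {R : realType}.
Implicit Types (a b : nat -> R) (s : R) (M N : nat).

(* By duality: the norm of a partial sum S is computed by pairing it with |S|^(s-2) S, which is
   replaced by a uniformly close cosine polynomial. *)
Lemma partial_sum_ge2 s : 2 < s ->
  exists2 K, 1 <= K & forall a M N, (M <= N)%N -> ns s (cpoly a M) <= K * ns s (cpoly a N).
Proof.
move=> s2; have s1 : 1 < s by apply: lt_trans s2; rewrite ltr1n.
have s0 : 0 < s by exact: lt_trans s1.
have s1' := ltW s1.
(* The conjugate exponent lies in (1, 2], where the bound is already available. *)
pose s' := s / (s - 1).
have sm : 0 < s - 1 by rewrite subr_gt0.
have s'1 : 1 < s' by rewrite ltr_pdivlMr// mul1r gtrBl.
have s'2 : s' <= 2.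
  rewrite ler_pdivrMr// mulrBr mulr1 lerBrDr [2 * s]mulrC mulr_natr mulr2n lerD2l.
  exact: ltW.
have s'1' := ltW s'1.
have s'0 : 0 < s' by exact: lt_trans s'1.
have ss' : s^-1 + s'^-1 = 1 by rewrite /s' invf_div; field; rewrite gt_eqF.
have sE : (s - 1) * s' = s by rewrite /s' mulrC divfK// gt_eqF.
have [K K1 HK] := partial_sum_le2 s'1 s'2.
have K0 : 0 <= K by exact: le_trans K1.
exists K => // a M N MN.
set S := cpoly a M; set G := cpoly a N.
have cS : continuous S := cont_cpoly a M.
have cG : continuous G := cont_cpoly a N.
pose g x := `|S x| `^ (s - 2) * S x.
have s20 : 0 < s - 2 by rewrite subr_gt0.
have cg : continuous g := rcontM (cont_powR_abs s20 cS) cS.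
have gn x : `|g x| = `|S x| `^ (s - 1).
  rewrite /g normrM (ger0_norm (powR_ge0 _ _)) mulrC.
  rewrite (_ : s - 2 = (s - 1) - 1); last by ring.
  by rewrite mulr_powRB1.
have Sg x : S x * g x = `|S x| `^ s.
  rewrite /g mulrCA -expr2 -real_normK ?num_real// -powR_mulrn// -powRD ?subrK//.
  by rewrite gt_eqF.
set A := ns s S.
have A0 : 0 <= A by exact: ns_ge0.
have AE : A `^ s = RI 0 1 (fun x => S x * g x).
  by rewrite (ns_contX s1' cS); apply: eq_RI => x _.
have gE : ns s' g = A `^ (s - 1).
  rewrite (ns_cont s'1' cg) (@eq_RI _ _ _ _ (fun x => `|S x| `^ s)); last first.
    by move=> x _; rewrite gn -powRrM sE.
  rewrite -(ns_contX s1' cS) -powRrM; congr (_ `^ _).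
  by rewrite /s' invf_div mulrC divfK// gt_eqF.
(* The polynomial [h] is within [e] of [g]. In the integral of S h, self-adjointness moves the
   truncation from S to [h], whose partial sum is bounded in the dual norm. *)
have main e : 0 < e -> A `^ s <= K * ns s G * (A `^ (s - 1) + e) + A * e.
  move=> e0; have [b [L bL]] := weierstrass_cos cg e0.
  pose L' := maxn L M; pose b' := trunc_seq b L.
  have hE := @cpoly_pad _ b L L' (leq_maxl _ _).
  have ML' : (M <= L')%N by exact: leq_maxr.
  set h := cpoly b' L'.
  have ch : continuous h := cont_cpoly _ _.
  have gh x : 0 <= x <= 1 -> `|g x - h x| <= e by move=> x01; rewrite /h hE; exact: bL.
  have cgh : continuous (fun x => g x - h x) := rcontD cg (rcontN ch).
  have ngh : ns s' (fun x => g x - h x) <= e := ns_le_sup s'1' cgh (ltW e0) gh.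
  have nh : ns s' h <= A `^ (s - 1) + e.
    rewrite (@eq_ns _ _ _ (fun x => g x - (g x - h x))); last by move=> x; rewrite subKr.
    apply: le_trans (ns_triangleB s'1' (cont_inLs s'1' cg) (cont_inLs s'1' cgh)) _.
    by rewrite gE lerD2l.
  rewrite AE (@eq_RI _ _ _ _ (fun x => S x * h x + S x * (g x - h x))); last first.
    by move=> x _; ring.
  rewrite (RI_D _ _ (rcontM cS ch) (rcontM cS cgh)); apply: lerD.
    rewrite (RI_partial_adjoint a b' MN ML').
    apply: le_trans (ler_norm _) _.
    apply: le_trans (ns_hoelder s1 s'1 ss' cG (cont_cpoly b' M)) _.
    rewrite [K * _]mulrC -mulrA ler_wpM2l ?ns_ge0//.
    apply: le_trans (HK b' M L' ML') _.
    by rewrite ler_wpM2l.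
  apply: le_trans (ler_norm _) _.
  apply: le_trans (ns_hoelder s1 s'1 ss' cS cgh) _.
  by rewrite ler_wpM2l// ns_ge0.
have [Az|Az] := eqVneq A 0.
  by rewrite -/A Az mulr_ge0// ns_ge0.
have Ap : 0 < A by rewrite lt0r Az.
have limit : A `^ s <= K * ns s G * A `^ (s - 1).
  apply/ler_addgt0Pl => e e0.
  pose k := K * ns s G + A.
  have k0 : 0 < k by rewrite ltr_wpDl// mulr_ge0// ns_ge0.
  apply: le_trans (main _ (divr_gt0 e0 k0)) _.
  rewrite mulrDr -addrA addrC -mulrDl -/k lerD2r mulrC divfK// gt_eqF//.
move: limit; rewrite -(mulr_powRB1 A0 s0).
by rewrite ler_pM2r// powR_gt0.
Qed.

Theorem partial_sum_bound s : 1 < s ->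
  exists2 K, 1 <= K & forall a M N, (M <= N)%N -> ns s (cpoly a M) <= K * ns s (cpoly a N).
Proof.
by move=> s1; have [s2|s2] := leP s 2; [exact: partial_sum_le2|exact: partial_sum_ge2].
Qed.

End duality.

(** * From bounded partial sums and density to a Schauder basis *)

Section schauder_criterion.
Context {R : realType}.

(** The hypothesis places every [x k - c / k.+1] below every [x l + c / l.+1], so the supremum of
    the former meets all the bounds at once. *)
Lemma limit_with_rate (x : nat -> R) (c : R) :
  (forall k l, `|x k - x l| <= c / k.+1%:R + c / l.+1%:R) ->
  exists a, forall k, `|x k - a| <= c / k.+1%:R.
Proof.
move=> H; pose S := [set x k - c / k.+1%:R | k in [set: nat]].
have ub l : ubound S (x l + c / l.+1%:R).
  by move=> _ [k _ <-]; have := H k l; rewrite ler_norml => /andP[_]; rewrite lerBlDl [X in _ <= _ + X]addrC addrA lerBlDr.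
have S0 : S !=set0 by exists (x 0%N - c / 1%:R), 0%N.
exists (sup S) => k; rewrite ler_norml lerBrDl lerBlDl; apply/andP; split.
  by rewrite addrC; apply: ge_sup => //; exact: ub.
rewrite lerBlDl -lerBlDr; apply: ub_le_sup; last by exists k.
by exists (x 0%N + c / 1%:R); exact: ub.
Qed.

Variables (s : R) (s1 : 1 <= s) (e : nat -> R -> R) (K : R).
Hypotheses (K0 : 0 <= K) (eL : forall n, inLs s (e n)) (e0 : forall n, 0 < ns s (e n)).

Definition esum (a : nat -> R) N x : R := \sum_(0 <= n < N) a n * e n x.

Hypothesis proj : forall a M N, (M <= N)%N -> ns s (esum a M) <= K * ns s (esum a N).
Hypothesis dense : forall f, inLs s f -> forall d : R, 0 < d ->
  exists a N, ns s (fun x => f x - esum a N x) < d.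

Let esumL a N : inLs s (esum a N).
Proof. by apply: inLs_sum => // n; exact: inLsZ. Qed.

Let esumB a b N x : esum (fun n => a n - b n) N x = esum a N x - esum b N x.
Proof. by rewrite -sumrB; apply: eq_bigr => n _; rewrite mulrBl. Qed.

Lemma esum_pad a N L : (N <= L)%N -> esum (trunc_seq a N) L =1 esum a N.
Proof.
move=> NL x; rewrite /esum (big_cat_nat (n := N))//= [X in _ + X]big1_seq ?addr0.
  by apply: eq_big_nat => n /andP[_ nN]; rewrite /trunc_seq nN.
by move=> n /=; rewrite mem_index_iota /trunc_seq => /andP[Nn _]; rewrite ltnNge Nn mul0r.
Qed.

(** The n-th term is the difference of two successive partial sums, each controlled by [proj].
    Coefficients thus depend continuously on the sum. *)
Let coef_le a n N : (n < N)%N -> `|a n| * ns s (e n) <= 2 * K * ns s (esum a N).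
Proof.
move=> nN; rewrite -(nsZ s1 _ (eL n)).
rewrite (@eq_ns _ _ _ (fun x => esum a n.+1 x - esum a n x)); last first.
  by move=> x; rewrite /esum big_nat_recr//= addrAC subrr add0r.
apply: le_trans (ns_triangleB s1 (esumL a n.+1) (esumL a n)) _.
rewrite -mulrA [2 * _]mulrC mulr_natr mulr2n.
by apply: lerD; apply: proj => //; exact: ltnW.
Qed.

Let ns_esum_le a N c : (forall n, `|a n| * ns s (e n) <= c) -> ns s (esum a N) <= c * N%:R.
Proof.
move=> H; elim: N => [|N IH].
  rewrite (@eq_ns _ _ _ (cst 0)); last by move=> x; rewrite /esum big_geq.
  by rewrite ns_cst// mulr0.
rewrite (@eq_ns _ _ _ (fun x => esum a N x + a N * e N x)); last first.
  by move=> x; rewrite /esum big_nat_recr.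
apply: le_trans (ns_triangle s1 (esumL a N) (inLsZ s1 (a N) (eL N))) _.
by rewrite -natr1 mulrDr mulr1 lerD// nsZ.
Qed.

(** Density gives approximants with errors below 1 / (k + 1). By [coef_le] their n-th coefficients
    are Cauchy in k; the limits are the coefficients sought, and [proj] makes the error bound
    uniform in N. *)
Let expansion f : inLs s f -> exists a, forall k, exists N0, forall N, (N0 <= N)%N ->
  ns s (fun x => f x - esum a N x) <= (1 + K) / k.+1%:R.
Proof.
move=> lf.
have /choice[aN aNP] : forall k : nat, exists p : (nat -> R) * nat,
    ns s (fun x => f x - esum p.1 p.2 x) < k.+1%:R^-1.
  move=> k; have hk : 0 < k.+1%:R^-1 :> R by rewrite invr_gt0 ltr0n.
  by have [a [N h]] := dense f lf _ hk; exists (a, N).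
pose al k := trunc_seq (aN k).1 (aN k).2.
have alP k L : ((aN k).2 <= L)%N -> ns s (fun x => f x - esum (al k) L x) <= k.+1%:R^-1.
  move=> kL; apply/ltW; rewrite (@eq_ns _ _ _ (fun x => f x - esum (aN k).1 (aN k).2 x))//.
  by move=> x; rewrite /al esum_pad.
have diff k l M : ns s (esum (fun n => al k n - al l n) M) <= K * (k.+1%:R^-1 + l.+1%:R^-1).
  set L := maxn M (maxn (aN k).2 (aN l).2).
  have kL : ((aN k).2 <= L)%N by rewrite !leq_max leqnn orbT.
  have lL : ((aN l).2 <= L)%N by rewrite !leq_max leqnn !orbT.
  apply: le_trans (proj _ _ _ (leq_maxl _ _ : M <= L)%N) _.
  rewrite ler_wpM2l//.
  rewrite (@eq_ns _ _ _ (fun x => (f x - esum (al l) L x) - (f x - esum (al k) L x))); last first.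
    by move=> x; rewrite esumB; ring.
  apply: le_trans (ns_triangleB s1 (inLsB s1 lf (esumL _ _)) (inLsB s1 lf (esumL _ _))) _.
  by rewrite addrC lerD ?alP.
have /choice[a aP] : forall n, exists y, forall k, `|al k n - y| <= (2 * K * K / ns s (e n)) / k.+1%:R.
  move=> n; apply: limit_with_rate => k l.
  rewrite -mulrDr mulrAC ler_pdivlMr//.
  apply: le_trans (coef_le (fun n => al k n - al l n) n n.+1 (ltnSn n)) _.
  by rewrite -[leRHS]mulrA ler_wpM2l// ?mulr_ge0.
(* Here N is fixed and l is chosen after it: the N differences between [al l] and the limit add up
   to less than any d, leaving only the bound that [diff] gives in k. *)
have tail k N : ns s (esum (fun n => al k n - a n) N) <= K / k.+1%:R.
  apply/ler_addgt0Pl => d d0.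
  pose c := K + 2 * K * K * N%:R.
  have c0 : 0 <= c by rewrite addr_ge0// !mulr_ge0.
  have [l lP] : exists l : nat, c / l.+1%:R <= d.
    exists (Num.bound (c / d)); rewrite ler_pdivrMr// mulrC -ler_pdivrMr//.
    apply: le_trans (ltW (archi_boundP _)) _; first by rewrite divr_ge0// ltW.
    by rewrite ler_nat.
  rewrite (@eq_ns _ _ _ (fun x => esum (fun n => al k n - al l n) N x + esum (fun n => al l n - a n) N x)); last first.
    by move=> x; rewrite !esumB; ring.
  apply: le_trans (ns_triangle s1 (esumL _ _) (esumL _ _)) _.
  apply: (@le_trans _ _ (K * (k.+1%:R^-1 + l.+1%:R^-1) + 2 * K * K / l.+1%:R * N%:R)).
    apply: lerD; first exact: diff.
    apply: ns_esum_le => n; have := aP n l.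
    by rewrite mulrAC ler_pdivlMr.
  rewrite mulrDr -addrA addrC lerD2r; apply: le_trans lP.
  by rewrite le_eqVlt; apply/orP; left; apply/eqP; rewrite /c; ring.
exists a => k; exists (aN k).2 => N kN.
rewrite (@eq_ns _ _ _ (fun x => (f x - esum (al k) N x) + esum (fun n => al k n - a n) N x)); last first.
  by move=> x; rewrite esumB; ring.
apply: le_trans (ns_triangle s1 (inLsB s1 lf (esumL _ _)) (esumL _ _)) _.
by rewrite mulrDl mul1r lerD ?alP.
Qed.

(* Completeness of L_s is not needed: the coefficients of a function are the
   limits of those of its approximants in the span of [e]. *)
Theorem schauder_of_projections : schauder_basis (lebesgue01 R) s%:E e.
Proof.
split; first exact: eL.
move=> f lf; have diffL a N : inLs s (fun x => f x - esum a N x) := inLsB s1 lf (esumL a N).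
have cvgE a : ((fun N => Lnorm (lebesgue01 R) s%:E (fun x => (f x - \sum_(0 <= n < N) a n * e n x)%:E))
    @ \oo --> 0%E) <-> (fun N => ns s (fun x => f x - esum a N x)) @ \oo --> (0 : R).
  have -> : (fun N => Lnorm (lebesgue01 R) s%:E (fun x => (f x - \sum_(0 <= n < N) a n * e n x)%:E)) =
      (fun N => (ns s (fun x => f x - esum a N x))%:E).
    by apply/funext => N; rewrite (ns_fineE (diffL a N)).
  split; first by move/fine_cvgP => [].
  by move=> H; apply/fine_cvgP; split => //; exact: nearW.
have [a aP] := expansion f lf.
exists a; split.
  apply/cvgE/cvgrPdist_le => d d0.
  have [k kP] : exists k : nat, (1 + K) / k.+1%:R <= d.
    exists (Num.bound ((1 + K) / d)); rewrite ler_pdivrMr// mulrC -ler_pdivrMr//.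
    apply: le_trans (ltW (archi_boundP _)) _; first by rewrite divr_ge0 ?addr_ge0// ltW.
    by rewrite ler_nat.
  have [N0 N0P] := aP k; exists N0 => // N /= N0N.
  by rewrite sub0r normrN ger0_norm ?ns_ge0// (le_trans (N0P _ N0N)).
move=> b /cvgE bP.
have {}aP : (fun N => ns s (fun x => f x - esum a N x)) @ \oo --> (0 : R).
  apply/cvgrPdist_le => d d0.
  have [k kP] : exists k : nat, (1 + K) / k.+1%:R <= d.
    exists (Num.bound ((1 + K) / d)); rewrite ler_pdivrMr// mulrC -ler_pdivrMr//.
    apply: le_trans (ltW (archi_boundP _)) _; first by rewrite divr_ge0 ?addr_ge0// ltW.
    by rewrite ler_nat.
  have [N0 N0P] := aP k; exists N0 => // N /= N0N.
  by rewrite sub0r normrN ger0_norm ?ns_ge0// (le_trans (N0P _ N0N)).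
(* Uniqueness: [coef_le] bounds each coefficient of a - b by the norm of a long partial sum of the
   difference, which tends to 0. *)
apply/funext => n; apply/eqP; rewrite -subr_eq0 -normr_eq0 eq_le normr_ge0 andbT.
rewrite -(@pmulr_lle0 _ (ns s (e n)))//.
apply/ler_addgt0Pl => d d0; rewrite addr0.
pose c := 2 * K * 2 + 1.
have c0 : 0 < c by rewrite ltr_wpDl// !mulr_ge0.
move/cvgrPdist_le : aP => /(_ _ (divr_gt0 d0 c0))[N1 _ N1P].
move/cvgrPdist_le : bP => /(_ _ (divr_gt0 d0 c0))[N2 _ N2P].
pose N := maxn n.+1 (maxn N1 N2).
have h1 : ns s (fun x => f x - esum a N x) <= d / c.
  by have := N1P N; rewrite /= !leq_max leqnn orbT => /(_ isT); rewrite sub0r normrN ger0_norm ?ns_ge0.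
have h2 : ns s (fun x => f x - esum b N x) <= d / c.
  by have := N2P N; rewrite /= !leq_max leqnn !orbT => /(_ isT); rewrite sub0r normrN ger0_norm ?ns_ge0.
apply: le_trans (coef_le (fun n => a n - b n) n N (leq_maxl _ _)) _.
apply: (@le_trans _ _ (2 * K * (d / c + d / c))).
  rewrite ler_wpM2l ?mulr_ge0//.
  rewrite (@eq_ns _ _ _ (fun x => (f x - esum b N x) - (f x - esum a N x))); last first.
    by move=> x; rewrite esumB; ring.
  by apply: le_trans (ns_triangleB s1 (diffL b N) (diffL a N)) _; rewrite addrC lerD.
have -> : 2 * K * (d / c + d / c) = d * (2 * K * 2 / c) by ring.
rewrite ler_piMr ?(ltW d0)// ler_pdivrMr// mul1r /c lerDl//.
Qed.

End schauder_criterion.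
Arguments partial_sum_bound {R s} _.

Arguments weierstrass_cos {R g e} _ _.

(** * Density of cosine polynomials in L_s *)

Section density.
Context {R : realType}.
Implicit Types (f g : R -> R) (x k M d : R).
Local Notation mu01 := (lebesgue01 R).

Definition clip M x : R := Num.max (- M) (Num.min M x).

Lemma clip_le M x : 0 <= M -> `|clip M x| <= M.
Proof.
move=> M0; rewrite /clip ler_norml le_max lexx/= ge_max ge_min lexx andbT.
by rewrite ge0_cp.
Qed.

Lemma clip_id M x : `|x| <= M -> clip M x = x.
Proof. by rewrite /clip ler_norml => /andP[h1 h2]; rewrite (min_idPr h2) (max_idPr h1). Qed.

Lemma clip_lip M x y : `|clip M x - clip M y| <= `|x - y|.
Proof.
have maxl (a u v : R) : `|Num.max a u - Num.max a v| <= `|u - v|.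
  have := ler_norm (u - v); have := ler_norm (v - u); rewrite (distrC v u).
  move: `|u - v| => n h1 h2.
  by case: (leP a u) => ?; case: (leP a v) => ?; rewrite ler_norml; apply/andP; split; lra.
have minl (a u v : R) : `|Num.min a u - Num.min a v| <= `|u - v|.
  have := ler_norm (u - v); have := ler_norm (v - u); rewrite (distrC v u).
  move: `|u - v| => n h1 h2.
  by case: (leP a u) => ?; case: (leP a v) => ?; rewrite ler_norml; apply/andP; split; lra.
exact: le_trans (maxl _ _ _) (minl _ _ _).
Qed.

Lemma clip_dist M x : 0 <= M -> `|x - clip M x| <= `|x|.
Proof.
move=> M0; rewrite /clip; have := ler_norm x; have := ler_norm (- x); rewrite normrN.
move: `|x| => n h1 h2.
by case: (leP M x) => ?; case: (leP (- M)) => ?; rewrite ler_norml; apply/andP; split; lra.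
Qed.

Lemma cont_clip M f : continuous f -> continuous (fun x => clip M (f x)).
Proof.
move=> cf x; apply/cvgrPdist_lt => e e0.
move/cvgrPdist_lt : (cf x) => /(_ e e0); apply: filterS => y; apply: le_lt_trans.
exact: clip_lip.
Qed.

Lemma measurable_clip M f : measurable_fun setT (f : measurableTypeR R -> R) ->
  measurable_fun setT (fun x : measurableTypeR R => clip M (f x)).
Proof.
move=> mf; apply: measurable_maxr => //.
by apply: measurable_minr.
Qed.

Variables (s : R) (s1 : 1 < s).
Let s0 : 0 < s. Proof. exact: lt_trans s1. Qed.
Let s1' : 1 <= s. Proof. exact: ltW. Qed.

Lemma ns_lt f d : measurable_fun setT (f : measurableTypeR R -> R) -> 0 < d ->
  (\int[mu01]_x (`|f x| `^ s)%:E < (d `^ s)%:E)%E -> inLs s f /\ ns s f < d.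
Proof.
move=> mf d0 h.
have LE : (Lnorm mu01 s%:E (EFin \o f) `^ s = \int[mu01]_x (`|f x| `^ s)%:E)%E.
  by rewrite poweR_Lnorm ?gt_eqF//.
have lf : inLs s f.
  apply/inLsP; split => //.
  apply: (@lty_poweRy _ _ s); first by rewrite gt_eqF.
  by rewrite LE (lt_trans h)// ltry.
split => //; rewrite ltNge; apply/negP => dn.
move: h; apply/negP; rewrite -leNgt -LE -(ns_fineE lf) poweR_EFin lee_fin.
by apply: ge0_ler_powR; rewrite ?nnegrE ?ns_ge0 ?(ltW s0) ?(ltW d0).
Qed.

(** Dominated convergence with dominating function |f|^s: at each point the truncation error is
    eventually 0. *)
Lemma clip_approx f d : inLs s f -> 0 < d ->
  exists2 M, 0 <= M & inLs s (fun x => f x - clip M (f x)) /\ ns s (fun x => f x - clip M (f x)) < d.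
Proof.
move=> lf d0; have [/inLsP[mf _] _] := (lf, tt).
pose h (n : nat) x := (`|f x - clip n%:R (f x)| `^ s)%:E.
have mh n : measurable_fun setT (h n : measurableTypeR R -> \bar R).
  apply/measurable_EFinP; apply: (measurableT_comp (measurable_powR s)).
  apply: measurableT_comp => //.
  by apply: measurable_funB => //; exact: measurable_clip.
have int := Lfun_integrable s1' lf.
have h0 x : h n x @[n --> \oo] --> 0%E.
  have -> : 0%E = h (Num.bound `|f x|) x.
    by rewrite /h clip_id ?(ltW (archi_boundP _))// subrr normr0 powR0// gt_eqF.
  apply: cvg_near_cst; exists (Num.bound `|f x|) => // n /= nb.
  rewrite /h clip_id; last by apply: le_trans (ltW (archi_boundP _)) _ => //; rewrite ler_nat.
  by rewrite clip_id// ltW// archi_boundP.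
have hb n x : (`|h n x| <= (`|f x| `^ s)%:E)%E.
  rewrite /h abse_EFin ger0_norm ?powR_ge0// lee_fin; apply: ge0_ler_powR; rewrite ?nnegrE ?(ltW s0)//.
  exact: clip_dist.
have ae0 : {ae mu01, forall x, setT x -> h ^~ x @ \oo --> (cst 0%E : measurableTypeR R -> \bar R) x}.
  by apply: aeW => x _; exact: h0.
have aeb : {ae mu01, forall x (n : nat), setT x -> (`|h n x| <= (`|f x| `^ s)%:E)%E}.
  by apply: aeW => x n _; exact: hb.
have [_ _] := @dominated_convergence _ _ _ mu01 setT measurableT h (cst 0%E)
  (fun x => (`|f x| `^ s)%:E) mh (measurable_cst _) ae0 int aeb.
rewrite integral0 => /fine_cvgP[[N1 _ fin1] /cvgrPdist_lt /(_ (d `^ s))].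
rewrite powR_gt0// => /(_ isT)[N2 _ lt2].
pose N := maxn N1 N2; exists N%:R => //.
have ltN : (\int[mu01]_x h N x < (d `^ s)%:E)%E.
  have fN : (\int[mu01]_x h N x)%E \is a fin_num := fin1 N (leq_maxl _ _).
  rewrite -(fineK fN) lte_fin.
  have := lt2 N (leq_maxr _ _); rewrite /= sub0r normrN; exact/le_lt_trans/ler_norm.
apply: ns_lt => //.
by apply: measurable_funB => //; exact: measurable_clip.
Qed.

(** An L_1 approximation by continuous functions is upgraded to L_s: after clipping, f - g is
    bounded, so |f - g|^s is at most a constant times |f - g|. *)
Lemma cont_approx f M d : measurable_fun setT (f : measurableTypeR R -> R) ->
  0 <= M -> (forall x, `|f x| <= M) -> 0 < d ->
  exists g, continuous g /\ ns s (fun x => f x - g x) < d.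
Proof.
move=> mf M0 fM d0.
have mI : measurable (`]0, 1[%classic : set (measurableTypeR R)) by exact: measurable_itv.
have muI : (lebesgue_measure (`]0%R, 1%R[%classic : set (measurableTypeR R)) < +oo)%E.
  by rewrite /= lebesgue_measure_itv/= lte_fin ltr01 sube0 ltry.
have intf : (@lebesgue_measure R).-integrable `]0, 1[ (EFin \o f).
  apply: measurable_bounded_integrable => //; first exact: measurable_funTS.
  exists M; split; first exact: num_real.
  by move=> x Mx y _ /=; rewrite (le_trans (fM y))// ltW.
have [g_ [cg ig gf]] := approximation_continuous_integrable mI muI intf.
(* Bounds |f - g|^(s-1), since |f - g| <= 2 M; the added 1 keeps [k] positive when M = 0. *)
pose k := (2 * M + 1) `^ (s - 1).
have k0 : 0 < k by rewrite powR_gt0// ltr_wpDl// mulr_ge0.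
have e0 : 0 < d `^ s / k by rewrite divr_gt0// powR_gt0.
move/fine_cvgP : gf => [[N1 _ fin1] /cvgrPdist_lt /(_ _ e0)[N2 _ lt2]].
pose N := maxn N1 N2; pose g x := clip M (g_ N x).
have cgN : continuous g by apply: cont_clip; exact: cg.
have mg := cont_measurable cgN.
exists g; split => //.
have mfg : measurable_fun setT ((fun x => f x - g x) : measurableTypeR R -> R) by exact: measurable_funB.
apply: (@ns_lt _ d _ d0 _).2 => //.
rewrite ge0_integral_mrestr//; last first.
  apply/measurable_EFinP; apply: (measurableT_comp (measurable_powR s)).
  exact: measurableT_comp.
have mfgN : measurable_fun (`]0, 1[%classic : set (measurableTypeR R)) (fun x : measurableTypeR R => `|f x - g_ N x|).
  apply: measurable_funTS; apply: measurableT_comp => //; apply: measurable_funB => //.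
  exact: cont_measurable (cg N).
apply: (@le_lt_trans _ _ (\int[lebesgue_measure]_(x in `]0%R, 1%R[) (k * `|f x - g_ N x|)%:E)%E).
  apply: ge0_le_integral => //.
  - by apply/measurable_EFinP/measurable_funTS; apply: (measurableT_comp (measurable_powR s)); exact: measurableT_comp.
  - by apply/measurable_EFinP; exact: measurable_funM.
  move=> x _; rewrite lee_fin -(mulr_powRB1 (normr_ge0 _) s0) mulrC.
  apply: ler_pM; rewrite ?powR_ge0//.
    apply: ge0_ler_powR; rewrite ?nnegrE ?subr_ge0 ?addr_ge0 ?mulr_ge0//.
    apply: le_trans (ler_normB _ _) _.
    by have := fM x; have := @clip_le M (g_ N x) M0; rewrite /g; lra.
  by rewrite -{1}(@clip_id M _ (fM x)); exact: clip_lip.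
under eq_integral do rewrite EFinM.
rewrite ge0_integralZl//; last 2 first.
- exact/measurable_EFinP.
- by rewrite lee_fin ltW.
have fN : (\int[lebesgue_measure]_(x in `]0%R, 1%R[) `|(f x - g_ N x)%:E|)%E \is a fin_num :=
  fin1 N (leq_maxl _ _).
have h : (\int[lebesgue_measure]_(x in `]0%R, 1%R[) `|(f x - g_ N x)%:E| < (d `^ s / k)%:E)%E.
  rewrite -(fineK fN) lte_fin.
  have := lt2 N (leq_maxr _ _); rewrite /= sub0r normrN; exact/le_lt_trans/ler_norm.
rewrite -(fineK fN) lte_fin in h.
rewrite -[X in (_ * X)%E](fineK fN) -EFinM lte_fin.
by rewrite mulrC -ltr_pdivlMr.
Qed.

Theorem cpoly_dense f (lf : inLs s f) d (d0 : 0 < d) :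
  exists a N, ns s (fun x => f x - cpoly a N x) < d.
Proof.
have d30 : 0 < d / 3 by rewrite divr_gt0.
have [M M0 [l1 n1]] := @clip_approx f _ lf d30.
have [/inLsP[mf _] _] := (lf, tt).
have [g [cg n2]] := @cont_approx _ _ _ (@measurable_clip M f mf) M0 (fun x => @clip_le M (f x) M0) d30.
have [a [N aN]] := weierstrass_cos cg d30.
exists a, N.
have lg := cont_inLs s1' cg.
have lclip : inLs s (fun x => clip M (f x)).
  rewrite (_ : (fun x => _) = (fun x => f x - (f x - clip M (f x)))); first exact: inLsB.
  by apply/funext => x; rewrite subKr.
have cgp := rcontD cg (rcontN (cont_cpoly a N)).
rewrite (@eq_ns _ _ _ (fun x => (f x - clip M (f x)) + ((clip M (f x) - g x) + (g x - cpoly a N x)))); last first.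
  by move=> x; ring.
apply: le_lt_trans (ns_triangle s1' l1 (inLsD s1' (inLsB s1' lclip lg) (cont_inLs s1' cgp))) _.
apply: (@lt_le_trans _ _ (d / 3 + (d / 3 + d / 3))); last by lra.
apply: ltrD => //.
apply: le_lt_trans (ns_triangle s1' (inLsB s1' lclip lg) (cont_inLs s1' cgp)) _.
apply: ltr_leD => //.
exact: (ns_le_sup s1' cgp (ltW d30) aN).
Qed.

End density.
Arguments cpoly_dense {R s} _ {f} _ {d} _.

Set Implicit Arguments.

(** * Generalized trigonometric functions *)

Section Fp_theory.
Context {R : realType}.
Implicit Types (p q t x y w : R).

Definition fp p t : R := (1 - t `^ p) `^ (- p^-1).

Lemma measurable_fp p : measurable_fun setT (fp p : measurableTypeR R -> R).
Proof.
apply: (measurableT_comp (measurable_powR (- p^-1))).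
by apply: measurable_funB => //; exact: measurable_powR.
Qed.

Lemma fp_ge0 p t : 0 <= fp p t. Proof. exact: powR_ge0. Qed.

Section p_gt1.
Variable p : R.
Hypothesis p1 : 1 < p.
Let p0 : 0 < p. Proof. exact: lt_trans p1. Qed.
Let q := p^-1.
Let q0 : 0 < q. Proof. by rewrite invr_gt0. Qed.
Let q1 : q < 1. Proof. by rewrite invf_lt1. Qed.

Lemma powR_lt1 t (r : R) : 0 < r -> 0 <= t -> t < 1 -> t `^ r < 1.
Proof.
move=> r0 t0 t1; have <- : 1 `^ r = 1 by rewrite powR1.
by apply: gt0_ltr_powR; rewrite ?nnegrE.
Qed.

Lemma powR_le1 t (r : R) : 0 <= r -> 0 <= t -> t <= 1 -> t `^ r <= 1.
Proof.
move=> r0 t0 t1; have <- : 1 `^ r = 1 by rewrite powR1.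
by apply: ge0_ler_powR; rewrite ?nnegrE.
Qed.

Lemma fp_le t : 0 <= t -> t < 1 -> fp p t <= (1 - t) `^ (- q).
Proof.
move=> t0 t1; have t1' : 0 < 1 - t by rewrite subr_gt0.
apply: powR_ge_npos => //; last by rewrite oppr_le0 ltW.
rewrite lerB//; have [->|tn] := eqVneq t 0; first by rewrite powR0// gt_eqF.
by apply: ge1r_powR; rewrite ?lt0r ?tn ?t0 ?ltW.
Qed.

Lemma fp_ge1 t : 0 <= t -> t < 1 -> 1 <= fp p t.
Proof.
move=> t0 t1; have h : 0 < 1 - t `^ p by rewrite subr_gt0 powR_lt1.
rewrite /fp powRN -[leLHS]invr1 lef_pV2 ?posrE ?powR_gt0//.
by apply: powR_le1; rewrite ?(ltW h) ?(ltW q0)// gerBl powR_ge0.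
Qed.

Lemma fp_gt0 t : 0 <= t -> t < 1 -> 0 < fp p t.
Proof. by move=> t0 t1; apply: (lt_le_trans ltr01); exact: fp_ge1. Qed.

(** Comparison with (1 - t)^(-1/p), integrable up to 1 because 1/p < 1. The bound is independent of
    [b], so it survives the limit b -> 1. *)
Lemma int_fp_trunc (b : R) : 0 <= b -> b < 1 ->
  (\int[lebesgue_measure]_(t in `[0%R, b]) (fp p t)%:E <= ((1 - q)^-1)%:E)%E.
Proof.
move=> b0 b1; have mfp := measurable_fp p.
have c0 : 0 < 1 - q by rewrite subr_gt0.
pose g t := `|1 - t| `^ (1 - q).
have cg : continuous g.
  apply: (cont_powR_abs c0 (f := fun t => 1 - t)).
  by move=> t; apply: cvgB; [exact: cvg_cst|exact: cvg_id].
(* The maximum leaves the majorant unchanged on [0, b] and makes it continuous on the whole line. *)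
pose G t := Num.max (1 - t) (1 - b) `^ (- q).
have cG : continuous G.
  have b1' : 0 < 1 - b by rewrite subr_gt0.
  move=> t; have m0 : 0 < Num.max (1 - t) (1 - b) by rewrite lt_max b1' orbT.
  apply: (@continuous_comp _ _ _ (fun t => Num.max (1 - t) (1 - b)) (fun y => y `^ (- q))).
    apply/cvgrPdist_lt => e e0; exists e => //= z; apply: le_lt_trans.
    have := ler_norm (t - z); have := ler_norm (z - t); rewrite (distrC z t).
    move: `|t - z| => n h1 h2.
    case: (leP (1 - t) (1 - b)) => ?; case: (leP (1 - z) (1 - b)) => ?;
      by rewrite ler_norml; apply/andP; split; lra.
  exact: (der_cont (is_derive1_powR (- q) m0)).
have GE t : 0 <= t <= b -> G t = (1 - t) `^ (- q).
  by move=> /andP[_ tb]; rewrite /G max_l// lerD2l lerN2.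
apply: (@le_trans _ _ (\int[lebesgue_measure]_(t in `[0%R, b]) (G t)%:E)%E).
  apply: ge0_le_integral => //.
  - by move=> t _; rewrite lee_fin fp_ge0.
  - by apply/measurable_EFinP; exact: measurable_funTS.
  - apply/measurable_EFinP; apply: measurable_funTS; exact: cont_measurable.
  - move=> t /=; rewrite in_itv/= => /andP[t0 tb]; rewrite lee_fin GE ?t0//.
    by apply: fp_le => //; exact: le_lt_trans b1.
have fin : (\int[lebesgue_measure]_(t in `[0%R, b]) (G t)%:E)%E \is a fin_num.
  by apply: integrable_fin_num => //; exact: (cont_int 0 b cG).
rewrite -(fineK fin) lee_fin.
have -> : fine (\int[lebesgue_measure]_(t in `[0%R, b]) (G t)%:E)%E = RI 0 b G by [].
have dF t : 0 <= t <= b -> is_derive t 1 (fun t => - (1 - q)^-1 * (-1 * t + 1) `^ (1 - q)) (G t).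
  move=> tb; have t1 : 0 < -1 * t + 1 by move: tb => /andP[_ tb]; lra.
  have := isdZ (- (1 - q)^-1) (isdC (g := fun t => -1 * t + 1) (is_derive1_powR (1 - q) t1) (isd_affine (-1) 1 t)).
  move=> /is_derive_eq; apply.
  rewrite (GE t tb) (_ : 1 - q - 1 = - q); last by ring.
  rewrite (_ : -1 * t + 1 = 1 - t); last by ring.
  by field; rewrite gt_eqF.
rewrite (RI_FTC b0 cG dF); have -> : -1 * 0 + 1 = 1 :> R by ring.
rewrite powR1 mulr1 opprK gerDr.
by rewrite mulr_le0_ge0 ?powR_ge0// oppr_le0 invr_ge0 ltW.
Qed.

Lemma int_fp_lty : (\int[lebesgue_measure]_(t in `[0%R, 1%R]) (fp p t)%:E < +oo)%E.
Proof.
have mfp := measurable_fp p.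
rewrite -(@integral_itv_bndo_bndc _ (BLeft 0) 1); last exact/measurable_EFinP/measurable_funTS.
pose F (n : nat) : set (measurableTypeR R) := `[0, 1 - n.+1%:R^-1]%classic.
have b1 (n : nat) : 1 - n.+1%:R^-1 < 1 :> R by rewrite gtrBl invr_gt0 ltr0n.
have b0 (n : nat) : 0 <= 1 - n.+1%:R^-1 :> R by rewrite subr_ge0 invf_le1 ?ltr0n// ler1n.
have FU : `[0%R, 1%R[%classic = \bigcup_n F n.
  apply/seteqP; split => x /=.
    rewrite in_itv/= => /andP[x0 x1].
    have x1' : 0 < 1 - x by rewrite subr_gt0.
    exists (Num.bound (1 - x)^-1) => //=; rewrite /F /= in_itv/= x0/= lerBrDr -lerBrDl.
    rewrite -[leRHS]invrK lef_pV2 ?posrE ?invr_gt0 ?ltr0n//.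
    apply: le_trans (ltW (archi_boundP _)) _; first by rewrite invr_ge0 ltW.
    by rewrite ler_nat.
  move=> [n _]; rewrite /F /= !in_itv/= => /andP[-> xn] /=.
  exact: le_lt_trans (b1 n).
rewrite FU.
have cv := @ge0_nondecreasing_set_cvg_integral _ (measurableTypeR R) R F
  (fun t => (fp p t)%:E) lebesgue_measure.
have {}cv : (\int[lebesgue_measure]_(x in F i) (fp p x)%:E)%E @[i --> \oo] -->
   (\int[lebesgue_measure]_(x in \bigcup_i F i) (fp p x)%:E)%E.
  apply: cv.
  - move=> m n mn; apply/subsetPset => x; rewrite /F /= !in_itv/= => /andP[-> xm]/=.
    apply: le_trans xm _; rewrite lerD2l lerN2 lef_pV2 ?posrE ?ltr0n// ler_nat ltnS//.
  - by move=> i; exact: measurable_itv.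
  - by move=> i; apply/measurable_EFinP; exact: measurable_funTS.
  - by move=> i x _; rewrite lee_fin fp_ge0.
apply: (@le_lt_trans _ _ ((1 - q)^-1)%:E); last exact: ltry.
rewrite -(cvg_lim _ cv)//.
apply: lime_le; first by apply/cvg_ex; eexists; exact: cv.
by apply: nearW => n; exact: int_fp_trunc.
Qed.

Lemma int_fp : (@lebesgue_measure R).-integrable `[0, 1] (EFin \o fp p).
Proof.
apply/integrableP; split.
  by apply/measurable_EFinP/measurable_funTS; exact: measurable_fp.
under eq_integral do rewrite /= ger0_norm ?fp_ge0//.
exact: int_fp_lty.
Qed.

Lemma Fp0 : Fp p 0 = 0.
Proof. by rewrite /Fp set_itv1 Rintegral_set1. Qed.

Lemma isd_Fp y : 0 < y -> y < 1 -> is_derive y 1 (Fp p) (fp p y).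
Proof.
move=> y0 y1.
have h : 0 < 1 - y `^ p by rewrite subr_gt0 powR_lt1// ltW.
have cf : {for y, continuous (fp p)}.
  have := isdC (f := fun u => u `^ (- p^-1)) (g := fun t => 1 - t `^ p)
    (is_derive1_powR (- p^-1) h) (isdB (isd_cst 1 y) (is_derive1_powR p y0)).
  exact: der_cont.
have [d1 d2] := @continuous_FTC1_closed R (fp p) 0 y 1 y1 int_fp y0 cf.
by apply: (DeriveDef d1); rewrite -derive1E; exact: d2.
Qed.

Lemma within_Fp : {within `[0, 1], continuous (Fp p)}.
Proof. exact: (parameterized_integral_continuous ler01 int_fp). Qed.

Lemma Fp_incr x y : 0 <= x -> x < y -> y <= 1 -> Fp p x < Fp p y.
Proof.
move=> x0 xy y1; apply: (@der_incr _ 0 1 (Fp p) (fp p)) => //.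
- by move=> z /andP[z0 z1]; exact: isd_Fp.
- exact: within_Fp.
- by move=> z /andP[z0 z1]; apply: fp_gt0 => //; exact: ltW.
Qed.

Lemma Fp_mono : {in `[0, 1] &, {mono Fp p : x y / x <= y}}.
Proof.
move=> x y; rewrite !in_itv/= => /andP[x0 x1] /andP[y0 y1].
have [xy|yx|->] := ltgtP x y; last by rewrite lexx.
  by rewrite ltW// Fp_incr.
by apply/negbTE; rewrite -ltNge Fp_incr.
Qed.

(* [fp p >= 1], so the inverse of [Fp p] is 1-Lipschitz. *)
Lemma Fp_ge_id x y : 0 <= x -> x <= y -> y <= 1 -> y - x <= Fp p y - Fp p x.
Proof.
move=> x0 xy y1; rewrite -subr_ge0.
have : Fp p x - x <= Fp p y - y; last by lra.
apply: (@der_nondecr _ 0 1 (fun z => Fp p z - z) (fun z => fp p z - 1)) => //.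
- by move=> z /andP[z0 z1]; exact: isdB (isd_Fp z0 z1) (isd_id z).
- move=> z; apply: cvgB; first exact: within_Fp.
  by apply: continuous_subspaceT => u; exact: cvg_id.
- by move=> z /andP[z0 z1]; rewrite subr_ge0 fp_ge1// ltW.
Qed.

Lemma pip_gt0 : 0 < pip p.
Proof. by rewrite /pip mulr_gt0// -Fp0 Fp_incr. Qed.

Lemma Fp_surj x : 0 <= x -> x <= pip p / 2 -> exists2 y, 0 <= y <= 1 & Fp p y = x.
Proof.
move=> x0; rewrite /pip mulrC mulKf// => x1.
have [|y] := @IVT _ (Fp p) 0 1 x ler01 within_Fp.
  by rewrite Fp0 ge_min x0/= le_max x1 orbT.
by rewrite in_itv/= => yI <-; exists y.
Qed.

End p_gt1.
End Fp_theory.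

(** * Inversion, continuity and differentiability of [sinp] *)

Section sinp_theory.
Context {R : realType}.
Variable p : R.
Hypothesis p1 : 1 < p.
Let p0 : 0 < p. Proof. exact: lt_trans p1. Qed.
Implicit Types (x y d : R).
Let P := pip p / 2.
Let pip0 : 0 < pip p. Proof. exact: pip_gt0. Qed.
Let P0 : 0 < P. Proof. by rewrite divr_gt0. Qed.
Let sN x : sinp p (- x) = - sinp p x. Proof. exact: sinpN x pip0. Qed.
Let sS x (n : int) : sinp p (x + n%:~R * pip p) = (-1) ^ n * sinp p x.
Proof. by apply: sinp_shift; rewrite (gt_eqF pip0). Qed.

Local Opaque sinp Fp.

Lemma sinp_Fp y : 0 <= y <= 1 -> sinp p (Fp p y) = y.
Proof. by move=> yI; apply: sinpK; [exact: Fp_mono|rewrite in_itv]. Qed.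

Lemma Fp_sinp x : 0 <= x <= P -> Fp p (sinp p x) = x.
Proof. by move=> /andP[x0 xP]; have [y yI <-] := Fp_surj p1 x0 xP; rewrite sinp_Fp. Qed.

Lemma sinp_itv x : 0 <= x <= P -> 0 <= sinp p x <= 1.
Proof. by move=> /andP[x0 xP]; have [y yI <-] := Fp_surj p1 x0 xP; rewrite sinp_Fp. Qed.

Lemma sinp0 : sinp p 0 = 0.
Proof. by rewrite -{1}(Fp0 p) sinp_Fp// lexx ler01. Qed.

Lemma sinp_half : sinp p P = 1.
Proof.
have <- : Fp p 1 = P by rewrite /P /pip; lra.
by rewrite sinp_Fp// lexx ler01.
Qed.

Lemma sinp_le x y : 0 <= x -> x <= y -> y <= P -> sinp p x <= sinp p y.
Proof.
move=> x0 xy yP.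
have xI : 0 <= x <= P by rewrite x0 (le_trans xy).
have yI : 0 <= y <= P by rewrite yP (le_trans x0).
by rewrite -(Fp_mono p1) ?in_itv/= ?sinp_itv// !Fp_sinp.
Qed.

Lemma sinp_lt x y : 0 <= x -> x < y -> y <= P -> sinp p x < sinp p y.
Proof.
move=> x0 xy yP.
have xI : 0 <= x <= P by rewrite x0 (le_trans (ltW xy)).
have yI : 0 <= y <= P by rewrite yP (le_trans x0 (ltW xy)).
by rewrite -(leW_mono_in (Fp_mono p1)) ?in_itv/= ?sinp_itv// !Fp_sinp.
Qed.

Lemma sinp_lip x y : 0 <= x -> x <= y -> y <= P -> sinp p y - sinp p x <= y - x.
Proof.
move=> x0 xy yP.
have xI : 0 <= x <= P by rewrite x0 (le_trans xy).
have yI : 0 <= y <= P by rewrite yP (le_trans x0).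
have /andP[sx0 _] := sinp_itv xI; have /andP[_ sy1] := sinp_itv yI.
have := Fp_ge_id p1 sx0 (sinp_le x0 xy yP) sy1.
by rewrite !Fp_sinp.
Qed.

(* [kp] is [cosp] on [[- pip / 2, pip / 2]]; outside of that interval it is [`|cosp|]. *)
Let kp x := `|1 - `|sinp p x| `^ p| `^ (p^-1).

Let kp_cont x : {for x, continuous (sinp p)} -> {for x, continuous kp}.
Proof.
move=> sc.
have cabs : continuous (fun w : R => 1 - `|w| `^ p).
  apply: rcontD; first exact: rcontK.
  apply: rcontN; apply: (cont_powR_abs p0 (f := fun w : R => w)) => w; exact: cvg_id.
have q0 : 0 < p^-1 by rewrite invr_gt0.
exact: (continuous_comp sc (cont_powR_abs q0 cabs _)).
Qed.

Let kpN x : kp (- x) = kp x.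
Proof. by rewrite /kp sN normrN. Qed.

Let sinpR x : sinp p (P + P - x) = sinp p x.
Proof.
have -> : P + P - x = pip p / 2 + (P - x) by rewrite /P; lra.
by rewrite -(sinp_refl _ pip0) -/P; congr sinp; lra.
Qed.

Let isd_pos x : 0 < x < P -> is_derive x (1 : R) (sinp p) (kp x).
Proof.
move=> /andP[x0 xP].
have xI : 0 <= x <= P by rewrite !ltW.
have s0 : 0 < sinp p x by rewrite -[ltLHS]sinp0 sinp_lt// ltW.
have s1 : sinp p x < 1 by rewrite -[ltRHS]sinp_half sinp_lt// ltW.
have fs0 : fp p (sinp p x) != 0 by rewrite gt_eqF// fp_gt0// ltW.
have h : 0 <= 1 - sinp p x `^ p by rewrite subr_ge0 powR_le1// ltW.
have -> : kp x = (fp p (sinp p x))^-1.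
  by rewrite /kp /fp powRN invrK (gtr0_norm s0) (ger0_norm h).
rewrite -{1}(Fp_sinp xI).
have nb : \forall z \near sinp p x, 0 < z < 1.
  by near=> z; apply/andP; split; near: z; [exact: lt_nbhsr|exact: lt_nbhsl].
apply: (@is_derive_inverse _ (Fp p)) => //; last exact: isd_Fp.
- near=> z; apply: sinp_Fp.
  have /andP[z0 z1] : 0 < z < 1 by near: z.
  by rewrite !ltW.
- near=> z.
  have /andP[z0 z1] : 0 < z < 1 by near: z.
  exact: der_cont (isd_Fp p1 z0 z1).
Unshelve. all: by end_near. Qed.

Let isd_neg x : - P < x < 0 -> is_derive x (1 : R) (sinp p) (kp x).
Proof.
move=> /andP[x0 xP].
have H : 0 < - 1 * x + 0 < P by apply/andP; split; lra.
have := isdN (isdC (g := fun t => - 1 * t + 0) (isd_pos H) (isd_affine (-1) 0 x)).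
rewrite mulrN1 opprK addr0 mulN1r kpN.
by under eq_fun do rewrite addr0 mulN1r sN opprK.
Qed.

Let isd_big x : P < x < P + P -> is_derive x (1 : R) (sinp p) (- kp x).
Proof.
move=> /andP[x0 xP].
have H : 0 < - 1 * x + (P + P) < P by apply/andP; split; lra.
have := isdC (g := fun t => - 1 * t + (P + P)) (isd_pos H) (isd_affine (-1) (P + P) x).
rewrite mulrN1 /kp mulN1r (addrC (- x)) sinpR.
by under eq_fun do rewrite mulN1r addrC sinpR.
Qed.

Let cont0 : {for 0, continuous (sinp p)}.
Proof.
apply/cvgrPdist_le => e e0; exists (Num.min e P) => /=; first by rewrite lt_min e0.
move=> y /=; rewrite sub0r normrN lt_min sinp0 sub0r normrN => /andP[ye yP].
have L z : 0 <= z -> z <= P -> `|sinp p z| <= z.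
  move=> z0 zP; have /andP[s0 _] : 0 <= sinp p z <= 1 by rewrite sinp_itv// z0.
  by have := sinp_lip (lexx 0) z0 zP; rewrite sinp0 !subr0 ger0_norm.
have [y0|y0] := leP 0 y.
  rewrite ger0_norm// in ye yP; apply: le_trans (L y y0 (ltW yP)) (ltW ye).
rewrite ltr0_norm// in ye yP.
rewrite -normrN -sN; apply: le_trans (L (- y) _ (ltW yP)) (ltW ye).
by rewrite oppr_ge0 ltW.
Qed.

Let contP : {for P, continuous (sinp p)}.
Proof.
apply/cvgrPdist_le => e e0; exists (Num.min e P) => /=; first by rewrite lt_min e0.
move=> y /=; rewrite lt_min => /andP[ye yP].
have L z : 0 <= z -> z <= P -> `|sinp p P - sinp p z| <= P - z.
  move=> z0 zP; rewrite ger0_norm ?subr_ge0 ?sinp_le//; exact: sinp_lip.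
have [yp|yp] := leP y P.
  rewrite ger0_norm ?subr_ge0// in ye yP; apply: le_trans (L y _ yp) (ltW ye).
  by lra.
rewrite ltr0_norm ?subr_lt0// in ye yP.
by rewrite -(sinpR y); apply: le_trans (L _ _ _) _; lra.
Qed.

Let kp_P : kp P = 0.
Proof.
by rewrite /kp sinp_half normr1 powR1 subrr normr0 powR0// invr_eq0 gt_eqF.
Qed.

Let isd_sym x : - P < x < P -> is_derive x (1 : R) (sinp p) (kp x).
Proof.
move=> /andP[x1 x2].
have [x0|x0|->] := ltgtP x 0; first by apply: isd_neg; rewrite x1.
  by apply: isd_pos; rewrite x0.
apply: (isd_puncture P0 _ cont0 (kp_cont cont0)) => y y0; rewrite subr0 => yP.
have [yn|yp|yE] := ltgtP y 0; last by rewrite yE eqxx in y0.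
  by apply: isd_neg; rewrite yn andbT; move: yP; rewrite ltr0_norm//; lra.
by apply: isd_pos; rewrite yp/=; move: yP; rewrite gtr0_norm//; lra.
Qed.

(** The derivative of [sinp p] around P: beyond P the sine decreases and the sign flips. Continuity
    at P holds because [kp P = 0]. *)
Let kP x := Num.sg (P - x) * kp x.

Let kP_cont : {for P, continuous kP}.
Proof.
have := kp_cont contP; move=> /cvgrPdist_le k0.
apply/cvgrPdist_le => e e0; have := k0 e e0; apply: filterS => x.
rewrite kp_P /kP kp_P mulr0 !sub0r !normrN normrM => H.
apply: le_trans H; rewrite -[leRHS]mul1r ler_wpM2r//.
by rewrite normr_sg; case: (_ == _); rewrite ?lexx ?ler01.
Qed.

Let isd_near_P x : `|x - P| < P -> is_derive x (1 : R) (sinp p) (kP x).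
Proof.
have A y : y != P -> `|y - P| < P -> is_derive y (1 : R) (sinp p) (kP y).
  move=> yN yP; rewrite /kP; have [yl|yg|yE] := ltgtP y P; last by rewrite yE eqxx in yN.
    rewrite gtr0_sg ?subr_gt0// mul1r; apply: isd_sym.
    by move: yP; rewrite ltr0_norm ?subr_lt0// => ?; apply/andP; split; lra.
  rewrite ltr0_sg ?subr_lt0// mulN1r; apply: isd_big.
  by move: yP; rewrite gtr0_norm ?subr_gt0// => ?; apply/andP; split; lra.
have [->|xP] := eqVneq x P; last exact: A.
by move=> _; exact: (isd_puncture P0 A contP kP_cont).
Qed.

Let isd_local x : exists (k : R -> R) (d : R), [/\ 0 < d, {for x, continuous k} &
  forall y, `|y - x| < d -> is_derive y (1 : R) (sinp p) (k y)].
Proof.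
have [n [r [xE r1 r2]]] : exists (n : int) (r : R),
    [/\ x = r + n%:~R * pip p, - P < r & r <= P].
  (* Taking the floor at - x makes r range over (- P, P], closed on the right: the interior falls
     under [isd_sym] and the end P under [isd_near_P]. *)
  set n := Num.floor (- x / pip p + 2^-1).
  exists (- n), (x + n%:~R * pip p); split; first by rewrite mulrNz mulNr addrK.
    have /andP[_] := floor_itv (- x / pip p + 2^-1); rewrite -/n intrD.
    by rewrite -ltrBrDr ltr_pdivrMr// /P => *; lra.
  have /andP[] := floor_itv (- x / pip p + 2^-1); rewrite -/n intrD.
  by rewrite -lerBlDr ler_pdivlMr// /P => *; lra.
have [k [d [d0 ck dk]]] : exists (k : R -> R) (d : R), [/\ 0 < d, {for r, continuous k} &
    forall y, `|y - r| < d -> is_derive y (1 : R) (sinp p) (k y)].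
  move: r2; rewrite le_eqVlt => /predU1P[->|r2]; first by exists kP, P; split.
  have D y : `|y - r| < Num.min (r + P) (P - r) -> is_derive y (1 : R) (sinp p) (kp y).
    rewrite lt_min !ltr_norml => /andP[/andP[h1 h2] /andP[h3 h4]]; apply: isd_sym.
    by apply/andP; split; lra.
  have m0 : 0 < Num.min (r + P) (P - r) by rewrite lt_min; apply/andP; split; lra.
  exists kp, (Num.min (r + P) (P - r)); split => //.
  apply: kp_cont; apply: (@der_cont _ _ _ (kp r)); apply: D.
  by rewrite subrr normr0.
pose h : R := - (n%:~R * pip p).
have rE : r = 1 * x + h by rewrite xE /h; lra.
exists (fun y => (-1) ^ n * k (1 * y + h)), d; split => //.
  apply: cvgM; first exact: cvg_cst.
  have ca : {for x, continuous (fun y : R => 1 * y + h)} := der_cont (isd_affine 1 h x).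
  by rewrite rE in ck; exact: (continuous_comp ca ck).
move=> y yd.
have yd' : `|1 * y + h - r| < d by rewrite rE (_ : _ - _ = y - x)//; lra.
have := isdZ ((-1) ^ n) (isdC (g := fun t => 1 * t + h) (dk _ yd') (isd_affine 1 h y)).
rewrite mulr1; congr (is_derive _ _ _ _); apply/funext => z.
rewrite -sS; congr sinp; rewrite /h; lra.
Qed.

Lemma isd_sinp x : is_derive x (1 : R) (sinp p) (cosp p x).
Proof.
have [k [d [d0 _ /(_ x)]]] := isd_local x; rewrite subrr normr0 => /(_ d0) H.
by rewrite /cosp derive1E (@derive_val _ _ _ _ _ _ _ H).
Qed.

Lemma cosp_eq x d : is_derive x (1 : R) (sinp p) d -> cosp p x = d.
Proof. by move=> H; rewrite /cosp derive1E (@derive_val _ _ _ _ _ _ _ H). Qed.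

Lemma cont_cosp : continuous (cosp p).
Proof.
move=> x; have [k [d [d0 ck H]]] := isd_local x.
apply/cvgrPdist_lt => e e0; move/cvgrPdist_lt : ck => /(_ e e0) [r /= r0 kr].
exists (Num.min r d) => /=; first by rewrite lt_min r0.
move=> y /=; rewrite lt_min => /andP[yr yd].
rewrite (cosp_eq (H x _)) ?subrr ?normr0// (cosp_eq (H y _)); last by rewrite distrC.
exact: kr.
Qed.

Lemma cont_sinp : continuous (sinp p).
Proof. by move=> x; exact: der_cont (isd_sinp x). Qed.

Let sgn_sgn (n : int) x : (-1) ^ n * ((-1) ^ n * x) = x.
Proof. by rewrite mulrA -expfzMl mulrNN mulr1 exp1rz mul1r. Qed.

Lemma cosp_shift x (n : int) : cosp p (x + n%:~R * pip p) = (-1) ^ n * cosp p x.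
Proof.
pose h : R := n%:~R * pip p.
have := isdZ ((-1) ^ n) (isdC (g := fun t => 1 * t + h) (isd_sinp (1 * x + h)) (isd_affine 1 h x)).
have -> : (fun y => (-1) ^ n * sinp p (1 * y + h)) = sinp p.
  apply/funext => y; by rewrite mul1r /h sS sgn_sgn.
by rewrite mulr1 => /cosp_eq ->; rewrite mul1r sgn_sgn.
Qed.

Lemma cospN x : cosp p (- x) = cosp p x.
Proof.
have := isdN (isdC (g := fun t => - 1 * t + 0) (isd_sinp (- 1 * x + 0)) (isd_affine (-1) 0 x)).
rewrite mulrN1 opprK addr0 mulN1r.
by under eq_fun do rewrite addr0 mulN1r sN opprK; move=> /cosp_eq.
Qed.

Lemma cospE x : 0 <= x <= P -> cosp p x = (1 - sinp p x `^ p) `^ (p^-1).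
Proof.
move=> xI; have /andP[s0 s1] := sinp_itv xI.
have -> : (1 - sinp p x `^ p) `^ (p^-1) = kp x.
  by rewrite /kp !ger0_norm// subr_ge0 powR_le1// ltW.
move: xI => /andP[x0]; rewrite le_eqVlt => /predU1P[->|xP].
  have /isd_near_P /cosp_eq -> : `|P - P| < P by rewrite subrr normr0.
  by rewrite /kP kp_P mulr0.
by apply: cosp_eq; apply: isd_sym; rewrite xP andbT; lra.
Qed.

End sinp_theory.

Section cosp_deriv.
Context {R : realType}.
Implicit Types (x y d : R).
Local Opaque sinp Fp.

Lemma powRDp (x r t : R) : 0 < x -> x `^ (r + t) = x `^ r * x `^ t.
Proof. by move=> x0; rewrite powRD// (gt_eqF x0) implybT. Qed.

Section p_gt1.
Variable p : R.
Hypothesis p1 : 1 < p.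
Let p0 : 0 < p. Proof. exact: lt_trans p1. Qed.
Let P := pip p / 2.
Let pip0 : 0 < pip p. Proof. exact: pip_gt0. Qed.
Let P0 : 0 < P. Proof. by rewrite divr_gt0. Qed.

Lemma sinp_itvoo x : 0 < x < P -> 0 < sinp p x < 1.
Proof.
move=> /andP[x0 xP]; apply/andP; split.
  by rewrite -[ltLHS](sinp0 p1) (sinp_lt p1)// ltW.
by rewrite -[ltRHS](sinp_half p1) (sinp_lt p1)// ltW.
Qed.

Lemma cosp_gt0 x : 0 < x < P -> 0 < cosp p x.
Proof.
move=> xI; have /andP[s0 s1] := sinp_itvoo xI; move: xI => /andP[x0 xP].
have h : 0 < 1 - sinp p x `^ p by rewrite subr_gt0 powR_lt1// ltW.
by rewrite (cospE p1) ?powR_gt0// !ltW.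
Qed.

Lemma cosp_powR x : 0 <= x <= P -> cosp p x `^ p = 1 - sinp p x `^ p.
Proof.
move=> xI; have /andP[s0 s1] := sinp_itv p1 xI.
have h : 0 <= 1 - sinp p x `^ p by rewrite subr_ge0 powR_le1// ltW.
by rewrite (cospE p1 xI) -powRrM mulVf ?(gt_eqF p0)// powRr1.
Qed.

Lemma cosp_half : cosp p P = 0.
Proof.
have PI : 0 <= P <= P by rewrite lexx (ltW P0).
by rewrite (cospE p1 PI) (sinp_half p1) powR1 subrr powR0// invr_eq0 (gt_eqF p0).
Qed.

Lemma cosp0 : cosp p 0 = 1.
Proof.
have PI : 0 <= (0 : R) <= P by rewrite lexx (ltW P0).
by rewrite (cospE p1 PI) (sinp0 p1) (powR0 (lt0r_neq0 p0)) subr0 powR1.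
Qed.

Lemma isd_cosp x : 0 < x < P ->
  is_derive x (1 : R) (cosp p) (- (sinp p x `^ (p - 1) * cosp p x `^ (2 - p))).
Proof.
move=> xI; have /andP[s0 s1] := sinp_itvoo xI.
have W0 : 0 < 1 - sinp p x `^ p by rewrite subr_gt0 powR_lt1// ltW.
have /andP[x0 xP] := xI.
apply: (@near_eq_is_derive _ _ _ (fun y => (1 - sinp p y `^ p) `^ (p^-1))).
  near=> y; rewrite (cospE p1)//; apply/andP; split; apply: ltW; near: y.
    exact: lt_nbhsr.
  exact: lt_nbhsl.
have dS := isdC (f := fun u => u `^ p) (g := sinp p) (is_derive1_powR p s0) (isd_sinp p1 x).
have := isdC (f := fun u => u `^ (p^-1)) (g := fun t => 1 - sinp p t `^ p)
    (is_derive1_powR (p^-1) W0) (isdB (isd_cst 1 x) dS).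
move=> /is_derive_eq; apply.
have xI' : 0 <= x <= P by rewrite !ltW.
rewrite (cospE p1 xI') -powRrM; set W := 1 - _.
rewrite (_ : p^-1 * (2 - p) = (p^-1 - 1) + p^-1); last by field; rewrite (gt_eqF p0).
rewrite (powRDp (p^-1 - 1) p^-1 W0) -/W.
by move: (W `^ _) (W `^ _) (_ `^ (p - 1)) => a b c; field; rewrite (gt_eqF p0).
Unshelve. all: by end_near. Qed.

End p_gt1.

Let two1 : 1 < 2 :> R. Proof. by rewrite ltr1n. Qed.
Let P2 := pip 2 / 2 : R.
Let P20 : 0 < P2. Proof. by rewrite divr_gt0// (pip_gt0 two1). Qed.

(** For p = 2 the pair (cosp, sinp) solves the same linear system as (cos, sin). Rotated back by the
    angle x it has derivative 0, hence keeps its value at 0. *)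
Let rot1 x : 0 <= x <= P2 ->
  sinp 2 x * cos x - cosp 2 x * sin x = 0 /\ sinp 2 x * sin x + cosp 2 x * cos x = 1.
Proof.
move=> /andP[x0 xP].
have dC y : 0 < y < P2 -> is_derive y (1 : R) (cosp 2) (- sinp 2 y).
  move=> yI; have := isd_cosp two1 yI.
  rewrite subrr powRr0 mulr1 (_ : 2 - 1 = 1 :> R); last by ring.
  by have /andP[s0 _] := sinp_itvoo two1 yI; rewrite powRr1// ltW.
pose u y := sinp 2 y * cos y - cosp 2 y * sin y.
pose v y := sinp 2 y * sin y + cosp 2 y * cos y.
have du y : 0 < y < P2 -> is_derive y (1 : R) u 0.
  move=> yI; have := isdB (isdM (isd_sinp two1 y) (is_derive_cos y)) (isdM (dC y yI) (is_derive_sin y)).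
  by move=> /is_derive_eq; apply; ring.
have dv y : 0 < y < P2 -> is_derive y (1 : R) v 0.
  move=> yI; have := isdD (isdM (isd_sinp two1 y) (is_derive_sin y)) (isdM (dC y yI) (is_derive_cos y)).
  by move=> /is_derive_eq; apply; ring.
have cs : continuous (sinp 2 : R -> R) := cont_sinp two1.
have cc : continuous (cosp 2 : R -> R) := cont_cosp two1.
have cu : {within `[0, P2], continuous u}.
  apply: continuous_subspaceT; apply: rcontD; first exact: (rcontM cs (@continuous_cos R)).
  by apply: rcontN; exact: (rcontM cc (@continuous_sin R)).
have cv : {within `[0, P2], continuous v}.
  apply: continuous_subspaceT; apply: rcontD; first exact: (rcontM cs (@continuous_sin R)).
  exact: (rcontM cc (@continuous_cos R)).
have u0 : u 0 = 0 by rewrite /u (sinp0 two1) sin0 mul0r mulr0 subrr.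
have v0 : v 0 = 1 by rewrite /v (cosp0 two1) sin0 cos0 mulr0 add0r mulr1.
have cst (w : R -> R) : (forall y, 0 < y < P2 -> is_derive y (1 : R) w 0) -> {within `[0, P2], continuous w} -> w x = w 0.
  move=> dw cw.
  have A : w 0 <= w x by apply: (@der_nondecr _ 0 P2 w (fun=> 0)).
  have B : - w 0 <= - w x.
    apply: (@der_nondecr _ 0 P2 (fun y => - w y) (fun=> 0)) => //.
      by move=> y yI; have := isdN (dw y yI); rewrite oppr0.
    by move=> y; apply: cvgN; exact: cw.
  by apply/eqP; rewrite eq_le A andbT -lerN2.
by rewrite -[LHS]/(u x) -[X in _ /\ X = _]/(v x) (cst u du cu) (cst v dv cv).
Qed.

Let sinp2_small x : 0 <= x <= P2 -> sinp 2 x = sin x /\ cosp 2 x = cos x.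
Proof.
move=> /rot1[e1 e2]; have := cos2Dsin2 x.
move: e1 e2; move: (sinp 2 x) (cosp 2 x) (cos x) (sin x) => S C c s e1 e2 e3.
split.
  rewrite -[LHS]mulr1 -e3 -[RHS]mulr1 -e2.
  have : c * (S * c - C * s) = 0 by rewrite e1 mulr0.
  by rewrite !expr2 => h; lra.
rewrite -[LHS]mulr1 -e3 -[RHS]mulr1 -e2.
have : s * (S * c - C * s) = 0 by rewrite e1 mulr0.
by rewrite !expr2 => h; lra.
Qed.

(** On [0, pip 2 / 2] cos agrees with [cosp 2], which is positive inside and zero at the right end.
    That end is therefore the first positive zero of cos. *)
Lemma pip2 : pip 2 = pi :> R.
Proof.
suff : P2 = pi / 2 by rewrite /P2 => h; lra.
have c0 : cos P2 = 0.
  have := @sinp2_small P2; rewrite lexx (ltW P20) => /(_ isT)[_ <-].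
  exact: (cosp_half two1).
apply/eqP; rewrite eq_le; apply/andP; split; rewrite leNgt; apply/negP => h.
  have hI : (0 : R) < pi / 2 < P2 by apply/andP; split=> //; have := pi_gt0 R; lra.
  have hJ : (0 : R) <= pi / 2 <= P2 by move: hI => /andP[h1 h2]; rewrite (ltW h1) (ltW h2).
  have := cosp_gt0 two1 hI; have [_ ->] := sinp2_small hJ.
  by rewrite cos_pihalf ltxx.
suff : 0 < cos P2 by rewrite c0 ltxx.
apply: cos_gt0_pihalf; rewrite h andbT; apply: lt_trans P20.
by have := pi_gt0 R; lra.
Qed.

Lemma sinp2E x : 0 <= x <= pi / 2 -> sinp 2 x = sin x.
Proof. by rewrite -pip2 => /sinp2_small[]. Qed.

Lemma cosp2E x : cosp 2 x = cos x.
Proof.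
have [n [r [xE r1 r2]]] : exists (n : int) (r : R),
    [/\ x = r + n%:~R * pi, - (pi / 2) <= r & r <= pi / 2].
  have pi0 : 0 < pi :> R := pi_gt0 R.
  set n := Num.floor (x / pi + 2^-1).
  exists n, (x - n%:~R * pi); split; first by rewrite subrK.
    have /andP[+ _] := floor_itv (x / pi + 2^-1); rewrite -/n.
    by rewrite -lerBlDr ler_pdivlMr//; lra.
  have /andP[_] := floor_itv (x / pi + 2^-1); rewrite -/n intrD.
  by rewrite -ltrBrDr ltr_pdivrMr//; lra.
rewrite {1}xE -{1}pip2 (cosp_shift two1).
have -> : cosp 2 r = cos r.
  have [r0|r0] := leP 0 r.
    have hr : 0 <= r <= P2 by rewrite /P2 pip2 r0.
    by have [_] := sinp2_small hr.
  rewrite -(cospN two1) -cosN.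
  have hr : 0 <= - r <= P2 by rewrite /P2 pip2; apply/andP; split; lra.
  by have [_] := sinp2_small hr.
have shift m : cos (r + m%:R * pi) = (-1) ^+ m * cos r.
  elim: m => [|m IH]; first by rewrite mul0r addr0 mul1r.
  by rewrite mulrSr mulrDl mul1r addrA cosDpi IH exprS mulN1r mulNr.
have shift' m : cos (r - m%:R * pi) = (-1) ^+ m * cos r.
  elim: m => [|m IH]; first by rewrite mul0r subr0 mul1r.
  rewrite -[LHS]opprK -cosDpi (_ : r - m.+1%:R * pi + pi = r - m%:R * pi); last first.
    by rewrite mulrSr; ring.
  by rewrite IH exprS mulN1r mulNr.
rewrite xE; case: n xE => m _; first by rewrite shift.
by rewrite NegzE mulrNz mulNr shift' -exprz_inv invrN1.
Qed.

End cosp_deriv.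

(** * Comparison of [sinp] with sin, and log-convexity of [pip] *)

Section comparison.
Context {R : realType}.
Implicit Types (x y z t w k p : R).
Local Opaque sinp Fp.

Let two1 : 1 < 2 :> R. Proof. by rewrite ltr1n. Qed.

Section p_lt2.
Variable p : R.
Hypotheses (p1 : 1 < p) (p2 : p < 2).
Let p0 : 0 < p. Proof. exact: lt_trans p1. Qed.

(* [r] is [fp p / fp 2] on [0, 1). *)
Let r t := (1 - t `^ 2) `^ (2^-1) * (1 - t `^ p) `^ (- p^-1).

(** The derivative of [r] is a product of positive powers with w^(p-1) - w, which is positive on (0,
    1) since p - 1 < 1. *)
Let r_incr y t : 0 < y -> y < t -> t < 1 -> r y < r t.
Proof.
move=> y0 yt t1.
pose dr w := 2^-1 * (1 - w `^ 2) `^ (2^-1 - 1) * (0 - 2 * w `^ (2 - 1) * 1) * (1 - w `^ p) `^ (- p^-1) +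
  (1 - w `^ 2) `^ (2^-1) * (- p^-1 * (1 - w `^ p) `^ (- p^-1 - 1) * (0 - p * w `^ (p - 1) * 1)).
have H w : 0 < w -> w < 1 -> is_derive w (1 : R) r (dr w) /\ 0 < dr w.
  move=> w0 w1.
  have a0 : 0 < 1 - w `^ 2 by rewrite subr_gt0 powR_lt1// ltW.
  have b0 : 0 < 1 - w `^ p by rewrite subr_gt0 powR_lt1// ltW.
  have da (v u : R) : 0 < u -> is_derive u (1 : R) (fun y => 1 - y `^ v) (0 - v * u `^ (v - 1) * 1).
    move=> u0; rewrite mulr1; exact: isdB (isd_cst 1 u) (is_derive1_powR v u0).
  split.
    have := isdM (isdC (f := fun u => u `^ (2^-1)) (g := fun t => 1 - t `^ 2) (is_derive1_powR (2^-1) a0) (da 2 w w0))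
     (isdC (f := fun u => u `^ (- p^-1)) (g := fun t => 1 - t `^ p) (is_derive1_powR (- p^-1) b0) (da p w w0)).
    by [].
  have -> : dr w = (1 - w `^ 2) `^ (2^-1 - 1) * (1 - w `^ p) `^ (- p^-1 - 1) * (w `^ (p - 1) - w).
    rewrite /dr.
    have -> : (1 - w `^ 2) `^ (2^-1) = (1 - w `^ 2) `^ (2^-1 - 1) * (1 - w * w).
      have := powRDp (2^-1 - 1) 1 a0; rewrite subrK (powRr1 (ltW a0)) => {1}->.
      by rewrite (powR_mulrn 2 (ltW w0)) expr2.
    have -> : (1 - w `^ p) `^ (- p^-1) = (1 - w `^ p) `^ (- p^-1 - 1) * (1 - w `^ (p - 1) * w).
      have := powRDp (- p^-1 - 1) 1 b0; rewrite subrK (powRr1 (ltW b0)) => {1}->.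
      by have := powRDp (p - 1) 1 w0; rewrite subrK (powRr1 (ltW w0)) => <-.
    have -> : w `^ (2 - 1) = w by rewrite (_ : 2 - 1 = 1 :> R); [rewrite powRr1// ltW|ring].
    move: (_ `^ _) (_ `^ _) (_ `^ _) => A B C.
    by field; rewrite (gt_eqF p0).
  rewrite !mulr_gt0 ?powR_gt0// subr_gt0.
  have {1}-> : w = w `^ (p - 1) * w `^ (2 - p).
    by rewrite -(powRDp _ _ w0) (_ : p - 1 + (2 - p) = 1); [rewrite powRr1// ltW|ring].
  by rewrite gtr_pMr ?powR_gt0// powR_lt1// ?ltW// subr_gt0.
have cr : {within `[y, t], continuous r}.
  apply: continuous_in_subspaceT => w /set_mem/=; rewrite in_itv/= => /andP[w1 w2].
  by apply: der_cont; apply: (H w _ _).1; [exact: lt_le_trans w1|exact: le_lt_trans t1].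
apply: (@der_incr _ y t r dr) => //.
- by move=> w /andP[w1 w2]; apply: (H w _ _).1; lra.
- by move=> w /andP[w1 w2]; apply: (H w _ _).2; lra.
Qed.

(** Monotone form of l'Hopital's rule: as the quotient [r] of the integrands increases, the quotient
    of the integrals is smaller on [0, y] than on [0, 1]. *)
Lemma Fp_ratio y : 0 < y < 1 -> Fp p y * Fp 2 1 < Fp 2 y * Fp p 1.
Proof.
move=> /andP[y0 y1].
have fE t : 0 < t -> t < 1 -> fp p t = r t * fp 2 t.
  move=> t0 t1; rewrite /r /fp (powRN _ (2^-1)) mulrAC mulfV ?mul1r//.
  by rewrite gt_eqF// powR_gt0// subr_gt0 powR_lt1// ltW.
(* [D] increases up to y and decreases afterwards. Thus the constant [r y] separates the quotients
   of the increments over [0, y] and over [y, 1]. *)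
pose D t := r y * Fp 2 t - Fp p t.
have dD t : 0 < t < 1 -> is_derive t (1 : R) D (fp 2 t * (r y - r t)).
  move=> /andP[t0 t1]; have := isdB (isdZ (r y) (isd_Fp two1 t0 t1)) (isd_Fp p1 t0 t1).
  by move=> /is_derive_eq; apply; rewrite (fE t t0 t1) (mulrC (fp 2 t)) mulrBl.
have cD : {within `[0, 1], continuous D}.
  move=> t; apply: cvgB; last exact: (within_Fp p1).
  by apply: cvgM; [exact: cvg_cst|exact: (within_Fp two1)].
have sub (a b : R) : 0 <= a -> b <= 1 -> {within `[a, b], continuous D}.
  move=> a0 b1; apply: continuous_subspaceW cD => t /=; rewrite !in_itv/= => /andP[*].
  by apply/andP; split; lra.
have D0 : D 0 < D y.
  apply: (@der_incr _ 0 y D (fun t => fp 2 t * (r y - r t))); [| | |exact: lexx|exact: y0|exact: lexx].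
  - by move=> t /andP[*]; apply: dD; apply/andP; split; lra.
  - by apply: sub => //; exact: ltW.
  - move=> t /andP[t0 ty]; apply: mulr_gt0; first by apply: (fp_gt0 two1); lra.
    by rewrite subr_gt0; exact: r_incr.
have D1 : - D y < - D 1.
  apply: (@der_incr _ y 1 (fun t => - D t) (fun t => - (fp 2 t * (r y - r t)))); [| | |exact: lexx|exact: y1|exact: lexx].
  - by move=> t /andP[*]; apply: isdN; apply: dD; apply/andP; split; lra.
  - move=> t; apply: cvgN; apply: sub => //; exact: ltW.
  - move=> t /andP[t0 ty]; rewrite -mulrN; apply: mulr_gt0; first by apply: (fp_gt0 two1); lra.
    by rewrite opprB subr_gt0; exact: r_incr.
have F2y : 0 < Fp 2 y by rewrite -(Fp0 2) (Fp_incr two1)// ltW.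
have F21 : Fp 2 y < Fp 2 1 by rewrite (Fp_incr two1)// ltW.
move: D0 D1; rewrite /D !Fp0 mulr0 subrr subr_gt0.
move: (Fp 2 y) (Fp 2 1) (Fp p y) (Fp p 1) (r y) F2y F21 => a b c d e a0 ab ca db.
have h1 : 0 < a * (d - c - e * (b - a)) by rewrite mulr_gt0//; lra.
have h2 : 0 < (e * a - c) * (b - a) by rewrite mulr_gt0//; lra.
rewrite -subr_gt0 (_ : _ - _ = a * (d - c - e * (b - a)) + (e * a - c) * (b - a)); last by ring.
exact: addr_gt0.
Qed.

(** This is [Fp_ratio] at y = sin (pi x), read through the inverse of [Fp p]. *)
Lemma sin_lt_sinp x : 0 < x < 2^-1 -> sin (pi * x) < sinp p (pip p * x).
Proof.
move=> /andP[x0 x1].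
have pi0 := pi_gt0 R; have pip0 := pip_gt0 p1.
have sI : 0 < sin (pi * x) < 1.
  have := @sinp_itvoo _ 2 two1 (pi * x); rewrite pip2 sinp2E; first by apply; apply/andP; split; nra.
  by apply/andP; split; nra.
have := Fp_ratio sI.
have -> : Fp 2 (sin (pi * x)) = pi * x.
  by rewrite -sinp2E; [apply: (Fp_sinp two1); rewrite pip2|]; apply/andP; split; nra.
have -> : Fp 2 1 = pi / 2 :> R by rewrite -pip2 /pip; lra.
have -> : Fp p 1 = pip p / 2 by rewrite /pip; lra.
move=> h.
have {}h : Fp p (sin (pi * x)) < pip p * x.
  by rewrite -(ltr_pM2r (_ : 0 < pi / 2)) ?divr_gt0//; lra.
have xI : 0 <= pip p * x <= pip p / 2 by apply/andP; split; nra.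
rewrite -(leW_mono_in (Fp_mono p1)) ?(Fp_sinp p1 xI)// in_itv/=.
  by move: sI => /andP[a b]; rewrite (ltW a) (ltW b).
exact: (sinp_itv p1 xI).
Qed.

End p_lt2.

Lemma weighted_am_gm (a b l : R) : 0 < a -> 0 < b -> 0 <= l <= 1 ->
  a `^ (1 - l) * b `^ l <= (1 - l) * a + l * b.
Proof.
move=> a0 b0 /andP[]; rewrite le_eqVlt => /predU1P[<-|l0].
  by rewrite subr0 powRr0 (powRr1 (ltW a0)) mulr1 mul1r mul0r addr0.
rewrite le_eqVlt => /predU1P[->|l1].
  by rewrite subrr powRr0 (powRr1 (ltW b0)) !mul1r mul0r add0r.
have l1' : 0 < 1 - l by rewrite subr_gt0.
have := @conjugate_powR _ (a `^ (1 - l)) (b `^ l) (1 - l)^-1 l^-1.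
rewrite !powR_ge0 !invr_gt0 l0 l1' !invrK subrK => /(_ isT isT isT isT erefl).
rewrite -!powRrM !mulfV ?gt_eqF// (powRr1 (ltW a0)) (powRr1 (ltW b0)).
by rewrite (mulrC a) (mulrC b).
Qed.

(** Composing with the retraction onto [0, 1] makes [Fp p] continuous on the whole line. *)
Let clip (z : R) : R := Num.min 1 (Num.max 0 z).

Let clipI z : 0 <= clip z <= 1.
Proof.
by rewrite /clip le_min ler01 le_max lexx ge_min lexx.
Qed.

Let clipE z : 0 <= z <= 1 -> clip z = z.
Proof. by move=> /andP[z0 z1]; rewrite /clip max_r// min_r. Qed.

Let clipP z : [\/ (z <= 0) && (clip z == 0), (0 <= z <= 1) && (clip z == z) |
  (1 <= z) && (clip z == 1)].
Proof.
have [z0|z0] := leP z 0.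
  by constructor 1; rewrite /clip (max_l z0) (min_r ler01) eqxx.
have [z1|z1] := leP z 1; first by constructor 2; rewrite (ltW z0) clipE ?eqxx// (ltW z0).
by constructor 3; rewrite (ltW z1) /clip (max_r (ltW z0)) (min_l (ltW z1)) eqxx.
Qed.

Let clip_lip y z : `|clip y - clip z| <= `|y - z|.
Proof.
have := ler_norm (y - z); have := ler_norm (z - y); rewrite (distrC z y).
move: `|y - z| => n h1 h2; rewrite ler_norml.
by have [] := clipP y => /andP[? /eqP->]; have [] := clipP z => /andP[? /eqP->];
  apply/andP; split; lra.
Qed.

Section Phi.
Variable p : R.
Hypothesis p1 : 1 < p.
Let p0 : 0 < p. Proof. exact: lt_trans p1. Qed.

Let cont_Fp_clip : continuous (fun z => Fp p (clip z)).
Proof.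
move=> z; have /subspace_continuousP/(_ (clip z)) := within_Fp p1.
rewrite /= in_itv/= clipI => /(_ isT) /cvgrPdist_lt W; apply/cvgrPdist_lt => e e0.
have := W e e0; rewrite near_withinE => -[d /= d0 dP]; exists d => //= y yd.
apply: dP; last by rewrite /= in_itv/= clipI.
by apply: le_lt_trans yd; exact: clip_lip.
Qed.

(* Substituting [t = w^(1/p)] in [Fp p] and integrating by parts: [Phi p] has
   derivative [(w / (1 - w))^(1/p)], which is log-convex in [1/p]. *)
Definition Phi w := Fp p (clip (`|w| `^ (p^-1))) - `|w| `^ (p^-1) * `|1 - w| `^ (1 - p^-1).

Lemma cont_Phi : continuous Phi.
Proof.
have q0 : 0 < p^-1 by rewrite invr_gt0.
have q1 : 0 < 1 - p^-1 by rewrite subr_gt0 invf_lt1.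
have cw : continuous (fun w : R => `|w| `^ (p^-1)).
  by apply: (cont_powR_abs q0 (f := fun w : R => w)) => w; exact: cvg_id.
have cw1 : continuous (fun w : R => `|1 - w| `^ (1 - p^-1)).
  apply: (cont_powR_abs q1 (f := fun w : R => 1 - w)).
  by apply: rcontD; [exact: rcontK|apply: rcontN => w; exact: cvg_id].
apply: rcontD; last exact: (rcontN (rcontM cw cw1)).
by move=> w; exact: (@continuous_comp _ _ _ (fun w : R => `|w| `^ (p^-1)) (fun z => Fp p (clip z)) w (cw w) (@cont_Fp_clip _)).
Qed.

Lemma Phi0 : Phi 0 = 0.
Proof.
rewrite /Phi normr0 powR0 ?gt_eqF ?invr_gt0// mul0r subr0.
by rewrite clipE ?lexx ?ler01// Fp0.
Qed.

Lemma Phi1 : Phi 1 = Fp p 1.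
Proof.
have q1 : 0 < 1 - p^-1 by rewrite subr_gt0 invf_lt1.
rewrite /Phi normr1 powR1 subrr normr0 (powR0 (lt0r_neq0 q1)) mulr0 subr0.
by rewrite clipE// lexx ler01.
Qed.

Lemma isd_Phi w : 0 < w < 1 -> is_derive w (1 : R) Phi ((w / (1 - w)) `^ (p^-1)).
Proof.
move=> /andP[w0 w1].
have q0 : 0 < p^-1 by rewrite invr_gt0.
have q1 : 0 < 1 - p^-1 by rewrite subr_gt0 invf_lt1.
have b0 : 0 < 1 - w by rewrite subr_gt0.
have y0 : 0 < w `^ (p^-1) by rewrite powR_gt0.
have y1 : w `^ (p^-1) < 1 by rewrite powR_lt1// ltW.
apply: (@near_eq_is_derive _ _ _ (fun w => Fp p (w `^ (p^-1)) - w `^ (p^-1) * (1 - w) `^ (1 - p^-1))).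
  near=> z.
  have z0 : 0 < z by near: z; exact: lt_nbhsr.
  have z1 : z < 1 by near: z; exact: lt_nbhsl.
  rewrite /Phi (gtr0_norm z0) gtr0_norm ?subr_gt0// clipE//.
  by rewrite powR_ge0 powR_le1 ?ltW.
have dF := isdC (f := Fp p) (g := fun w => w `^ (p^-1)) (isd_Fp p1 y0 y1) (is_derive1_powR (p^-1) w0).
have d1 := isdC (f := fun u => u `^ (1 - p^-1)) (g := fun w => 1 - w) (is_derive1_powR (1 - p^-1) b0)
  (isdB (isd_cst 1 w) (isd_id w)).
have := isdB dF (isdM (is_derive1_powR (p^-1) w0) d1).
move=> /is_derive_eq; apply.
rewrite /fp -powRrM mulVf ?(gt_eqF p0)// (powRr1 (ltW w0)).
rewrite powRM ?invr_ge0 ?ltW// -(powR_inv1 (ltW b0)) -powRrM mulN1r.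
rewrite (_ : 1 - p^-1 - 1 = - p^-1); last by ring.
have -> : (1 - w) `^ (1 - p^-1) = (1 - w) `^ (- p^-1) * (1 - w).
  by have := powRDp (- p^-1) 1 b0; rewrite (powRr1 (ltW b0)) (addrC (- p^-1)).
have := powRDp (p^-1 - 1) 1 w0; rewrite subrK (powRr1 (ltW w0)) => ->.
by move: (_ `^ _) (_ `^ _) => A B; ring.
Unshelve. all: by end_near. Qed.

End Phi.

(** Hoelder's inequality for g^(1/p) = (g^(1/2))^(1-l) (g^(1/p0))^l with g = w / (1 - w). It is
    carried out as weighted AM-GM on integrands normalised to integral 1, and integrated through the
    monotonicity of [W]. *)
Lemma pip_logconvex p0 p l : 1 < p0 -> 1 < p -> 0 <= l <= 1 ->
  p^-1 = (1 - l) * 2^-1 + l * p0^-1 -> pip p <= pi `^ (1 - l) * pip p0 `^ l.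
Proof.
move=> p01 p1 l01 pE.
have F0 q : 1 < q -> 0 < Fp q 1 by move=> q1; rewrite -(Fp0 q) (Fp_incr q1).
have [A AE A0] : exists2 A : R, Fp 2 1 = A & 0 < A by exists (Fp 2 1); [|exact: F0].
have [B BE B0] : exists2 B : R, Fp p0 1 = B & 0 < B by exists (Fp p0 1); [|exact: F0].
pose M := A `^ (1 - l) * B `^ l.
have M0 : 0 < M by rewrite mulr_gt0 ?powR_gt0.
suff : Fp p 1 <= M.
  move=> h; have -> : pi = 2 * A by rewrite -pip2 /pip AE.
  rewrite /pip BE.
  have t0 : 0 < 2 :> R by [].
  rewrite (powRM (1 - l) (ltW t0) (ltW A0)) (powRM l (ltW t0) (ltW B0)).
  rewrite mulrACA -(powRDp (1 - l) l t0) subrK (powRr1 (ltW t0)).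
  by rewrite (ler_pM2l t0).
pose W w := ((1 - l) / A * Phi 2 w + l / B * Phi p0 w) - M^-1 * Phi p w.
have : W 0 <= W 1.
  apply: (@der_nondecr _ 0 1 W (fun w => ((1 - l) / A * (w / (1 - w)) `^ (2^-1) +
     l / B * (w / (1 - w)) `^ (p0^-1)) - M^-1 * (w / (1 - w)) `^ (p^-1)));
     [| | |exact: lexx|exact: ler01|exact: lexx].
  - move=> w wI; exact: isdB (isdD (isdZ _ (isd_Phi two1 wI)) (isdZ _ (isd_Phi p01 wI))) (isdZ _ (isd_Phi p1 wI)).
  - apply: continuous_subspaceT; apply: rcontD.
      by apply: rcontD; (apply: rcontM; [exact: rcontK|exact: cont_Phi]).
    by apply: rcontN; apply: rcontM; [exact: rcontK|exact: cont_Phi].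
  - move=> w /andP[w0 w1]; set g := w / (1 - w).
    have g0 : 0 < g by rewrite divr_gt0// subr_gt0.
    have := @weighted_am_gm (g `^ (2^-1) / A) (g `^ (p0^-1) / B) l.
    rewrite !divr_gt0 ?powR_gt0// => /(_ isT isT l01).
    have iA : 0 <= A^-1 by rewrite invr_ge0 ltW.
    have iB : 0 <= B^-1 by rewrite invr_ge0 ltW.
    rewrite (powRM (1 - l) (powR_ge0 g 2^-1) iA) (powRM l (powR_ge0 g p0^-1) iB) -!powRrM.
    rewrite mulrACA -powRDp// (mulrC _ (1 - l)) (mulrC _ l) -pE.
    have <- : M^-1 = A^-1 `^ (1 - l) * B^-1 `^ l.
      by rewrite /M invfM -(powR_inv1 (ltW A0)) -(powR_inv1 (ltW B0)) -!powRrM !mulN1r !powRN.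
    move=> h; rewrite subr_ge0 (mulrC M^-1); apply: (le_trans h).
    by rewrite (mulrA (1 - l)) (mulrAC (1 - l)) (mulrA l) (mulrAC l).
rewrite /W (Phi0 two1) (Phi0 p01) (Phi0 p1) !mulr0 addr0 subr0.
rewrite (Phi1 two1) (Phi1 p01) (Phi1 p1) AE BE.
rewrite (divfK (lt0r_neq0 A0)) (divfK (lt0r_neq0 B0)).
by rewrite subrK subr_ge0 mulrC ler_pdivrMr// mul1r.
Qed.

End comparison.

(** * Bounds for the slope of [cosp] and oscillatory integrals *)

Section slope.
Context {R : realType}.
Implicit Types (x y z t w k p : R).
Local Opaque sinp Fp.

Let two1 : 1 < 2 :> R. Proof. by rewrite ltr1n. Qed.

(** The weights p - 1 and 2 - p sum to 1; AM-GM for w / (p - 1) and (1 - w) / (2 - p) gives the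
    maximum, attained at w = p - 1. *)
Lemma le_cp p w : 1 < p -> p < 2 -> 0 < w < 1 ->
  w `^ ((p - 1) / p) * (1 - w) `^ ((2 - p) / p) <= cp p.
Proof.
move=> p1 p2 /andP[w0 w1].
have p0 : 0 < p by exact: lt_trans p1.
have a0 : 0 < p - 1 by rewrite subr_gt0.
have b0 : 0 < 2 - p by rewrite subr_gt0.
have w1' : 0 < 1 - w by rewrite subr_gt0.
have lI : 0 <= 2 - p <= 1 by apply/andP; split; lra.
have := weighted_am_gm (divr_gt0 w0 a0) (divr_gt0 w1' b0) lI.
have -> : 1 - (2 - p) = p - 1 by ring.
have -> : (p - 1) * (w / (p - 1)) + (2 - p) * ((1 - w) / (2 - p)) = 1.
  by field; rewrite !gt_eqF.
set X := w / (p - 1); set Y := (1 - w) / (2 - p) => h.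
have X0 : 0 < X by exact: divr_gt0.
have Y0 : 0 < Y by exact: divr_gt0.
have -> : w = (p - 1) * X by rewrite /X mulrC divfK// gt_eqF.
have -> : 1 - (p - 1) * X = (2 - p) * Y by rewrite /X /Y; field; rewrite !gt_eqF.
rewrite (powRM _ (ltW a0) (ltW X0)) (powRM _ (ltW b0) (ltW Y0)) mulrACA.
rewrite -[leRHS]mulr1 /cp ler_wpM2l ?mulr_ge0 ?powR_ge0//.
rewrite (powRrM X) (powRrM Y) -powRM ?powR_ge0//.
by rewrite powR_le1 ?invr_ge0 ?mulr_ge0 ?powR_ge0// ltW.
Qed.

Lemma cp_gt0 p : 1 < p -> p < 2 -> 0 < cp p.
Proof. by move=> p1 p2; rewrite /cp mulr_gt0 ?powR_gt0 ?subr_gt0. Qed.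

(** At fixed w = S^p the left side is bounded by a weighted geometric mean of its endpoint values in
    1/p. The end p0 is bounded by K through [le_cp], the end 2 by pi^2 <= K since the slope is then
    w^(1/2) <= 1. *)
Lemma slope_bound p0 p K S : 1 < p0 -> p0 < 2 -> p0 <= p -> p < 2 ->
  pip p0 ^+ 2 * cp p0 = K -> pi ^+ 2 <= K -> 0 < S < 1 ->
  pip p ^+ 2 * (S `^ (p - 1) * (1 - S `^ p) `^ ((2 - p) / p)) <= K.
Proof.
move=> p01 p02 p0p p2 KE piK /andP[S0 S1].
have p1 : 1 < p by exact: lt_le_trans p0p.
have p0_gt0 : 0 < p0 by lra.
have p_gt0 : 0 < p by lra.
have K0 : 0 < K by rewrite -KE mulr_gt0 ?exprn_gt0 ?pip_gt0 ?cp_gt0.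
(* [l] is the position of 1/p between 1/2 and 1/p0. *)
pose d := p0^-1 - 2^-1; pose l := (p^-1 - 2^-1) / d.
have d0 : 0 < d by rewrite subr_gt0 ltf_pV2 ?posrE.
have l01 : 0 <= l <= 1.
  rewrite divr_ge0 ?(ltW d0) ?subr_ge0 ?lef_pV2 ?posrE ?(ltW p2)//=.
  by rewrite ler_pdivrMr// mul1r lerD2r lef_pV2 ?posrE.
have pE : p^-1 = (1 - l) * 2^-1 + l * p0^-1.
  have : l * d = p^-1 - 2^-1 by rewrite /l divfK// gt_eqF.
  by rewrite /d; lra.
have /andP[l0 l1] := l01.
have [w wE] : exists w, S `^ p = w by exists (S `^ p).
have w0 : 0 < w by rewrite -wE powR_gt0.
have w1 : w < 1 by rewrite -wE powR_lt1// ltW.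
have w1' : 0 < 1 - w by rewrite subr_gt0.
have SE : S `^ (p - 1) = w `^ ((p - 1) / p).
  by rewrite -wE -powRrM; congr powR; field; rewrite gt_eqF.
have hE : w `^ ((p - 1) / p) * (1 - w) `^ ((2 - p) / p) =
    w `^ (2^-1 * (1 - l)) * (w `^ ((p0 - 1) / p0) * (1 - w) `^ ((2 - p0) / p0)) `^ l.
  have e1 : (p - 1) / p = 2^-1 * (1 - l) + (p0 - 1) / p0 * l.
    rewrite !mulrBl !mulfV ?gt_eqF// !mul1r.
    by move: pE; clear; move: l (p^-1) (p0^-1) => *; lra.
  have e2 : (2 - p) / p = (2 - p0) / p0 * l.
    rewrite !mulrBl !mulfV ?gt_eqF//.
    by move: pE; clear; move: l (p^-1) (p0^-1) => *; lra.
  rewrite (powRM l (powR_ge0 _ _) (powR_ge0 _ _)) -!powRrM e1 e2.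
  by rewrite (powRDp _ _ w0) mulrA.
have wI : 0 < w < 1 by rewrite w0.
have h1 : w `^ ((p - 1) / p) * (1 - w) `^ ((2 - p) / p) <= cp p0 `^ l.
  have u1 : w `^ (2^-1 * (1 - l)) <= 1.
    by apply: (powR_le1 _ (ltW w0) (ltW w1)); rewrite mulr_ge0// subr_ge0.
  have u2 : (w `^ ((p0 - 1) / p0) * (1 - w) `^ ((2 - p0) / p0)) `^ l <= cp p0 `^ l.
    apply: (ge0_ler_powR l0); last exact: le_cp.
      by rewrite nnegrE mulr_ge0// powR_ge0.
    by rewrite nnegrE ltW// cp_gt0.
  by rewrite hE -[leRHS]mul1r; exact: (ler_pM (powR_ge0 _ _) (powR_ge0 _ _) u1 u2).
rewrite SE wE.
have P0 : 0 < pip p by exact: pip_gt0.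
have P00 : 0 < pip p0 by exact: pip_gt0.
have pi0 : 0 < pi :> R := pi_gt0 R.
have c0 := cp_gt0 p01 p02.
have h2 := pip_logconvex p01 p1 l01 pE.
move: P0 P00 pi0 piK h2 KE; clear - K0 h1 l0 l1 c0.
move: (pip p) (pip p0) (@pi R) (cp p0) c0 h1 => x y z c c0 h1 x0 y0 z0 zK h2 KE.
have h3 : x ^+ 2 <= (z ^+ 2) `^ (1 - l) * (y ^+ 2) `^ l.
  rewrite !expr2 (powRM _ (ltW z0) (ltW z0)) (powRM _ (ltW y0) (ltW y0)) mulrACA.
  exact: (ler_pM (ltW x0) (ltW x0) h2 h2).
have c20 : 0 <= y ^+ 2 by rewrite exprn_ge0// ltW.
have KlE : K `^ l = (y ^+ 2) `^ l * c `^ l by rewrite -KE; exact: (powRM l c20 (ltW c0)).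
have step : x ^+ 2 * (w `^ ((p - 1) / p) * (1 - w) `^ ((2 - p) / p)) <=
    (z ^+ 2) `^ (1 - l) * (y ^+ 2) `^ l * c `^ l.
  apply: (ler_pM _ _ h3 h1); first by rewrite exprn_ge0// ltW.
  by rewrite mulr_ge0// powR_ge0.
apply: (le_trans step); rewrite -mulrA -KlE.
apply: (@le_trans _ _ (K `^ (1 - l) * K `^ l)).
  apply: ler_wpM2r; first exact: powR_ge0.
  apply: ge0_ler_powR; [by rewrite subr_ge0| | |exact: zK].
    by rewrite nnegrE exprn_ge0// ltW.
  by rewrite nnegrE ltW.
by rewrite -(powRDp _ _ K0) subrK powRr1// ltW.
Qed.

Section oscillatory.
Variables (H : R -> R) (dH : R -> R) (b m k : R).
Hypotheses (m0 : 0 < m) (mb : m < b) (k0 : 0 < k) (cH : continuous H).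
Hypothesis H0 : H 0 = 0.
Hypothesis Hb : H b = 0.
Hypothesis isdH : forall x, 0 < x < b -> is_derive x (1 : R) H (dH x).
Hypothesis dH_ge0 : forall x, 0 < x < m -> 0 <= dH x.
Hypothesis dH_le0 : forall x, m < x < b -> dH x <= 0.

Let cks : continuous (fun x => sin (k * x)).
Proof. by move=> x; exact: der_cont (isd_sinZ k x). Qed.
Let ckc : continuous (fun x => cos (k * x)).
Proof. by move=> x; exact: der_cont (isd_cosZ k x). Qed.
Let Hs x := H x * sin (k * x).
Let cHs : continuous Hs. Proof. exact: (rcontM cH cks). Qed.
Let I x := RI (-1) x Hs.

Let D (c : R) x := I x + H x * (cos (k * x) / k + c).

Let isd_I x : -1 < x -> is_derive x (1 : R) I (Hs x).
Proof. exact: (RI_prim cHs). Qed.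

Let isd_D c x : 0 < x < b -> is_derive x (1 : R) (D c) (dH x * (cos (k * x) / k + c)).
Proof.
move=> xI; have /andP[x0 xb] := xI.
have x1 : -1 < x by lra.
have := isdD (isd_I x1) (isdM (isdH xI) (isdD (isdM (isd_cosZ k x) (isd_cst k^-1 x)) (isd_cst c x))).
by move=> /is_derive_eq; apply; rewrite /Hs; field; rewrite gt_eqF.
Qed.

Let cont_D c (u v : R) : 0 <= u -> {within `[u, v], continuous (D c)}.
Proof.
move=> u0; apply: continuous_in_subspaceT => x /set_mem/=; rewrite in_itv/= => /andP[ux xv].
have x1 : -1 < x by lra.
apply: cvgD; first exact: der_cont (isd_I x1).
apply: cvgM; first exact: cH.
apply: cvgD; last exact: cvg_cst.
by apply: cvgM; [exact: ckc|exact: cvg_cst].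
Qed.

Let cos_itv x : - k^-1 <= cos (k * x) / k <= k^-1.
Proof.
rewrite ler_pdivlMr// ler_pdivrMr// mulNr mulVf ?gt_eqF//.
by rewrite cos_geN1 cos_le1.
Qed.

Let RI_I : RI 0 b Hs = I b - I 0.
Proof.
have b0 : 0 <= b by apply: ltW; exact: lt_trans mb.
have h1 : -1 <= 0 :> R by lra.
by rewrite /I (RI_cat h1 b0 cHs) addrAC subrr add0r.
Qed.

(* Integrating by parts, [D c] loses the integral of [dH * (cos / k + c)], whose
   integrand has the sign of [c * dH] for [c = 1 / k] and [c = - 1 / k]. *)
Lemma oscillatory_le : `|RI 0 b Hs| <= 2 * H m / k.
Proof.
have b0 : 0 < b by exact: lt_trans mb.
have ki : 0 < k^-1 by rewrite invr_gt0.
have up : D (- k^-1) m <= D (- k^-1) 0.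
  rewrite -lerN2; apply: (@der_nondecr _ 0 m (fun x => - D (- k^-1) x)
    (fun x => - (dH x * (cos (k * x) / k - k^-1)))); [| | |exact: lexx|exact: ltW|exact: lexx].
  - by move=> x /andP[x0 xm]; apply: isdN; apply: isd_D; rewrite x0 (lt_trans xm).
  - by move=> x; apply: cvgN; exact: cont_D.
  - move=> x xI; rewrite oppr_ge0 mulr_ge0_le0 ?dH_ge0// subr_le0.
    by have /andP[] := cos_itv x.
have up' : D k^-1 b <= D k^-1 m.
  rewrite -lerN2; apply: (@der_nondecr _ m b (fun x => - D k^-1 x)
    (fun x => - (dH x * (cos (k * x) / k + k^-1)))); [| | |exact: lexx|exact: ltW|exact: lexx].
  - by move=> x /andP[x0 xm]; apply: isdN; apply: isd_D; rewrite xm (lt_trans m0).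
  - by move=> x; apply: cvgN; apply: cont_D; exact: ltW.
  - move=> x xI; rewrite oppr_ge0 mulr_le0_ge0 ?dH_le0// -lerBlDr sub0r.
    by have /andP[] := cos_itv x.
have lo : D k^-1 0 <= D k^-1 m.
  apply: (@der_nondecr _ 0 m (D k^-1)
    (fun x => dH x * (cos (k * x) / k + k^-1))); [| | |exact: lexx|exact: ltW|exact: lexx].
  - by move=> x /andP[x0 xm]; apply: isd_D; rewrite x0 (lt_trans xm).
  - exact: cont_D.
  - move=> x xI; rewrite mulr_ge0 ?dH_ge0// -lerBlDr sub0r.
    by have /andP[] := cos_itv x.
have lo' : D (- k^-1) m <= D (- k^-1) b.
  apply: (@der_nondecr _ m b (D (- k^-1))
    (fun x => dH x * (cos (k * x) / k - k^-1))); [| | |exact: lexx|exact: ltW|exact: lexx].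
  - by move=> x /andP[x0 xm]; apply: isd_D; rewrite xm (lt_trans m0).
  - by apply: cont_D; exact: ltW.
  - move=> x xI; rewrite mulr_le0 ?dH_le0// subr_le0.
    by have /andP[] := cos_itv x.
(* The boundary terms in cos (k m) cancel between the two sides of m; each side leaves one H m /
   k. *)
move: up up' lo lo'; rewrite RI_I /D H0 Hb !mul0r !addr0.
rewrite -mulrA !mulrDr !mulrN.
move: (H m / k) (H m * (cos _ / k)) (I b) (I 0) (I m) => *.
by rewrite ler_norml; apply/andP; split; lra.
Qed.

End oscillatory.
End slope.

(** * Cosine coefficients *)

Section cosine_series.
Context {R : realType}.
Implicit Types (x y z t w k p c : R) (n j N : nat).

(** For the integrations by parts below, where the derivative formulas are available only inside the
    interval. *)
Lemma RI_FTC_oo (a b : R) (f F : R -> R) : a <= b -> continuous f -> continuous F ->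
  (forall x, a < x < b -> is_derive x (1 : R) F (f x)) -> RI a b f = F b - F a.
Proof.
move=> ab cf cF dF.
have P x : a <= x -> is_derive x (1 : R) (fun y => RI (a - 1) y f) (f x).
  by move=> ax; apply: RI_prim => //; lra.
have -> : RI a b f = RI (a - 1) b f - RI (a - 1) a f.
  have h : a - 1 <= a by lra.
  by rewrite (RI_cat h ab cf) addrAC subrr add0r.
have cG : {within `[a, b], continuous (fun y => RI (a - 1) y f)}.
  by apply: continuous_in_subspaceT => x /set_mem/=; rewrite in_itv/= => /andP[ax _]; exact: der_cont (P x ax).
have cF' : {within `[a, b], continuous F} by exact: continuous_subspaceT.
have h1 : RI (a - 1) a f - F a <= RI (a - 1) b f - F b.
  apply: (@der_nondecr _ a b (fun y => RI (a - 1) y f - F y) (fun x => f x - f x)); [| | |exact: lexx|exact: ab|exact: lexx].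
  - by move=> x /andP[ax xb]; apply: isdB; [exact: P (ltW ax)|apply: dF; rewrite ax].
  - by move=> x; apply: cvgB; [exact: cG|exact: cF'].
  - by move=> x _; rewrite subrr.
have h2 : F a - RI (a - 1) a f <= F b - RI (a - 1) b f.
  apply: (@der_nondecr _ a b (fun y => F y - RI (a - 1) y f) (fun x => f x - f x)); [| | |exact: lexx|exact: ab|exact: lexx].
  - by move=> x /andP[ax xb]; apply: isdB; [apply: dF; rewrite ax|exact: P (ltW ax)].
  - by move=> x; apply: cvgB; [exact: cF'|exact: cG].
  - by move=> x _; rewrite subrr.
lra.
Qed.

(** Telescoping: 1 / (N + 1)^2 <= 1 / N - 1 / (N + 1). *)
Lemma sum_inv_sq (M N : nat) : (0 < M)%N -> (M <= N)%N ->
  \sum_(M.+1 <= j < N.+1) (j%:R ^+ 2)^-1 <= M%:R^-1 - N%:R^-1 :> R.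
Proof.
move=> M0; elim: N => [|N IH]; first by rewrite leqn0 => /eqP MN; rewrite MN in M0.
rewrite leq_eqVlt => /predU1P[->|MN]; first by rewrite big_geq// subrr.
have {}MN : (M <= N)%N by [].
rewrite big_nat_recr//= ?ltnS//; apply: le_trans (lerD (IH MN) (lexx _)) _.
have N0 : 0 < N%:R :> R by rewrite ltr0n (leq_trans M0).
have e : N.+1%:R = N%:R + 1 :> R by rewrite -natr1.
rewrite e -addrA lerD2l.
have N1 : 0 < N%:R + 1 :> R by rewrite addr_gt0.
rewrite -subr_ge0 (_ : _ - _ = (N%:R * (N%:R + 1) ^+ 2)^-1); last first.
  by move: N0 N1; clear; move: (N%:R : R) => y y0 y1; field; rewrite !gt_eqF.
by rewrite invr_ge0 mulr_ge0 ?exprn_ge0 ?ltW.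
Qed.

(** The same [y] serves every even function of period 2, so an estimate between two of them need
    only be checked on [0, 1]. *)
Lemma fold_point x : exists2 y, 0 <= y <= 1 &
  forall h : R -> R, (forall z, h (- z) = h z) -> (forall z, h (z + 2) = h z) -> h x = h y.
Proof.
pose n := Num.floor ((x + 1) / 2); pose r := x - n%:~R * 2.
have /andP[n1 n2] := floor_itv ((x + 1) / 2); rewrite -/n in n1 n2.
rewrite intrD in n2.
have r1 : `|r| <= 1 by rewrite ler_norml /r; apply/andP; split; lra.
exists `|r|; first by rewrite normr_ge0.
move=> h he hp.
have hn z (m : nat) : h (z + m%:R * 2) = h z.
  elim: m => [|m IH]; first by rewrite mul0r addr0.
  by rewrite -[in RHS]IH -(hp (z + m%:R * 2)) -natr1 mulrDl mul1r addrA.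
have hz z (m : int) : h (z + m%:~R * 2) = h z.
  case: m => m; first exact: hn.
  by rewrite NegzE mulrNz mulNr -[LHS](hn _ m.+1) subrK.
have -> : h x = h r by rewrite /r -[in RHS](hz _ n) subrK.
by have [r0|r0] := leP 0 r; [rewrite ger0_norm|rewrite ltr0_norm// he].
Qed.

Lemma cosnN n x : cosn n (- x) = cosn n x.
Proof. by rewrite /cosn mulrN cosN. Qed.

Lemma cosnD2 n x : cosn n (x + 2) = cosn n x.
Proof. exact: cos_period2. Qed.

Lemma cpolyN a N x : cpoly a N (- x) = cpoly a N x.
Proof. by apply: eq_bigr => n _; rewrite cosnN. Qed.

Lemma cpolyD2 a N x : cpoly a N (x + 2) = cpoly a N x.
Proof. by apply: eq_bigr => n _; rewrite cosnD2. Qed.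

Section uniform.
Variables (f : R -> R) (tau : nat -> R) (c : R).
Hypothesis cf : continuous f.
Hypothesis tauE : forall n, RI 0 1 (fun x => f x * cosn n x) = tau n * wn n.
Hypothesis tau_le : forall n, (0 < n)%N -> `|tau n| <= c / n%:R ^+ 2.

Let c0 : 0 <= c.
Proof. by have := tau_le (ltn0Sn 0); rewrite expr1n divr1; apply: le_trans. Qed.

(** The tail starts at frequency k + 2, for which [sum_inv_sq] gives exactly 1 / (k + 1): hence the
    shift in the index. *)
Let cauchy x (k l : nat) : `|cpoly tau k.+2 x - cpoly tau l.+2 x| <= c / k.+1%:R + c / l.+1%:R.
Proof.
wlog kl : k l / (k <= l)%N.
  move=> H; have [|/ltnW lk] := leqP k l; first exact: H.
  by rewrite distrC [leRHS]addrC; exact: H.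
rewrite /cpoly (big_cat_nat (n := k.+2) _ (_ : (k.+2 <= l.+2)%N))//= opprD addNKr normrN.
apply: (@le_trans _ _ (\sum_(k.+2 <= j < l.+2) c * (j%:R ^+ 2)^-1)).
  apply: le_trans (ler_norm_sum _ _ _) _.
  rewrite [leLHS]big_nat_cond [leRHS]big_nat_cond; apply: ler_sum => j /andP[/andP[kj _] _].
  rewrite normrM; apply: le_trans (tau_le _); last exact: leq_trans kj.
  by rewrite ler_piMr// cosn_le1.
rewrite -mulr_sumr; apply: le_trans (ler_wpM2l c0 (sum_inv_sq (ltn0Sn k) (_ : (k.+1 <= l.+1)%N))) _ => //.
have cl : 0 <= c / l.+1%:R by rewrite divr_ge0.
by rewrite mulrBr lerD2l; apply: (le_trans _ cl); rewrite oppr_le0.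
Qed.

(** The series converges uniformly to a continuous [g] with the cosine coefficients of [f]. Then d =
    f - g is orthogonal to all cosine polynomials, hence to itself by uniform approximation, and
    vanishes. *)
Lemma cosine_series x (k : nat) : 0 <= x <= 1 -> `|cpoly tau k.+2 x - f x| <= c / k.+1%:R.
Proof.
have /choice[g gP] : forall x, exists y, forall k : nat, `|cpoly tau k.+2 x - y| <= c / k.+1%:R.
  by move=> z; apply: limit_with_rate => m l; exact: cauchy.
have kbig (e : R) : 0 < e -> exists k : nat, c / k.+1%:R <= e.
  move=> e0; exists (Num.bound (c / e)); rewrite ler_pdivrMr// mulrC -ler_pdivrMr//.
  apply: le_trans (ltW (archi_boundP _)) _; first by rewrite divr_ge0// ltW.
  by rewrite ler_nat.
have cg : continuous g.
  move=> z; apply/cvgrPdist_le => e e0.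
  have e3 : 0 < e / 3 by rewrite divr_gt0.
  have [m mP] := kbig _ e3.
  have := cont_cpoly tau m.+2 z; move=> /cvgrPdist_le /(_ _ e3); apply: filterS => y yP.
  have h1 := le_trans (gP y m) mP; have h2 := le_trans (gP z m) mP.
  move: h1 h2 yP; rewrite !ler_norml => /andP[? ?] /andP[? ?] /andP[? ?].
  by apply/andP; split; lra.
have gE n : RI 0 1 (fun x => g x * cosn n x) = tau n * wn n.
  apply/eqP; rewrite -subr_eq0 -normr_eq0 eq_le normr_ge0 andbT; apply/ler_addgt0Pl => e e0; rewrite addr0.
  have [m0 m0P] := kbig _ e0; pose m := maxn m0 n.
  have mP : c / m.+1%:R <= e.
    apply: le_trans m0P; rewrite ler_wpM2l// lef_pV2 ?posrE// ler_nat ltnS leq_max leqnn//.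
  have <- : RI 0 1 (fun x => cpoly tau m.+2 x * cosn n x) = tau n * wn n.
    by rewrite RI_cpoly_cosn /trunc_seq (_ : (n < m.+2)%N)// /m ltnS (leq_trans (leq_maxr m0 n)).
  have cgn := rcontM cg (cont_cosn n); have ccn := rcontM (cont_cpoly tau m.+2) (cont_cosn n).
  rewrite -(RI_B 0 1 cgn ccn); apply: le_trans (RI_abs 0 1 (rcontD cgn (rcontN ccn))) _.
  have -> : e = RI 0 1 (fun=> e) by rewrite RI_cst// subr0 mulr1.
  apply: RI_le; [|exact: rcontK|].
    by move=> z; apply: cvg_norm; exact: (rcontD cgn (rcontN ccn)).
  move=> z _; rewrite -mulrBl normrM; apply: (@le_trans _ _ (`|g z - cpoly tau m.+2 z|)).
    by rewrite ler_piMr// cosn_le1.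
  by rewrite distrC; exact: le_trans (gP z m) mP.
pose d x := f x - g x.
have cd : continuous d by exact: (rcontD cf (rcontN cg)).
have dn n : RI 0 1 (fun x => d x * cosn n x) = 0.
  rewrite (@eq_RI _ _ _ _ (fun x => f x * cosn n x - g x * cosn n x)); last by move=> z _; rewrite mulrBl.
  by rewrite (RI_B 0 1 (rcontM cf (cont_cosn n)) (rcontM cg (cont_cosn n))) tauE gE subrr.
have dpoly a N : RI 0 1 (fun x => d x * cpoly a N x) = 0.
  rewrite (@eq_RI _ _ _ _ (fun x => \sum_(0 <= n < N) a n * (d x * cosn n x))); last first.
    by move=> z _; rewrite /cpoly mulr_sumr; apply: eq_bigr => n _; rewrite mulrCA.
  rewrite RI_sum; last by move=> n; exact: (rcontM (rcontK _) (rcontM cd (cont_cosn n))).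
  by rewrite big1// => n _; rewrite (RI_Z 0 1 _ (rcontM cd (cont_cosn n))) dn mulr0.
have cdd := rcontM cd cd.
(* Orthogonality allows one factor [d] to be replaced by its distance to a close polynomial, at most
   e / (B + 1). *)
have d2 : RI 0 1 (fun x => d x * d x) <= 0.
  have [B B0 dB] := cont_bounded 0 1 cd.
  apply/ler_addgt0Pl => e e0; rewrite addr0.
  have [a [N aN]] := weierstrass_cos cd (divr_gt0 e0 (ltr_pwDr ltr01 B0)).
  have cda := rcontM cd (cont_cpoly a N).
  have -> : RI 0 1 (fun x => d x * d x) = RI 0 1 (fun x => d x * d x - d x * cpoly a N x).
    by rewrite (RI_B 0 1 cdd cda) dpoly subr0.
  have -> : e = RI 0 1 (fun=> e) by rewrite RI_cst// subr0 mulr1.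
  apply: RI_le; [exact: (rcontD cdd (rcontN cda))|exact: rcontK|].
  move=> z zI; rewrite -mulrBr; apply: le_trans (ler_norm _) _; rewrite normrM.
  apply: (@le_trans _ _ ((B + 1) * (e / (B + 1)))).
    by apply: ler_pM => //; [apply: le_trans (dB z zI) _; rewrite lerDl|exact: aN].
  by rewrite mulrC divfK// gt_eqF// ltr_wpDl.
have dz z : 0 < z < 1 -> d z = 0.
  move=> zI; apply/eqP; apply: contraT => dz0; move: d2; rewrite leNgt => /negP[].
  apply: (RI_gt0 cdd) zI _; first by move=> y _; rewrite -expr2 sqr_ge0.
  by rewrite -expr2 lt0r sqr_ge0 sqrf_eq0 dz0.
move=> xI; apply/ler_addgt0Pl => e e0.
have [dl dl0 dP] := heine (0 : R) 1 cd e0.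
(* Vanishing is known in the open interval only; the endpoints are reached from a nearby interior
   point. *)
have [y yI xy] : exists2 y, 0 < y < 1 & `|x - y| < dl.
  move: xI => /andP[x0 x1].
  have [xh|xh] := leP x 2^-1.
    exists (x + Num.min (dl / 2) (4^-1)); case: (leP (dl / 2) (4^-1)) => ?.
    + by apply/andP; split; lra.
    + by apply/andP; split; lra.
    + by rewrite opprD addNKr normrN gtr0_norm; lra.
    + by rewrite opprD addNKr normrN gtr0_norm; lra.
  exists (x - Num.min (dl / 2) (4^-1)); case: (leP (dl / 2) (4^-1)) => ?.
  + by apply/andP; split; lra.
  + by apply/andP; split; lra.
  + by rewrite opprB addrC subrK gtr0_norm; lra.
  + by rewrite opprB addrC subrK gtr0_norm; lra.
have := dP x y xI xy; rewrite (dz y yI) subr0 /d => h1; have h2 := gP x k.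
move: h1 h2; move: (c / _) (cpoly _ _ _) (f x) (g x) => b u v w.
rewrite !ler_norml ltr_norml => /andP[? ?] /andP[? ?].
by apply/andP; split; lra.
Qed.

End uniform.
End cosine_series.

(** * Sums of odd inverse squares and a bound on pi *)

Section constants.
Context {R : realType}.
Implicit Types (x y z t w k p c : R) (n j N : nat).

Lemma cos_natpi n : cos (n%:R * pi) = (-1) ^+ n :> R.
Proof. by rewrite mulr_natl -[_ *+ _]add0r (alternatingn (@cosDpi R)) cos0 mulr1. Qed.

Let freq0 n : (0 < n)%N -> 0 < n%:R * pi :> R.
Proof. by move=> n0; rewrite mulr_gt0 ?ltr0n// pi_gt0. Qed.

Lemma RI_sinn n : (0 < n)%N -> RI 0 1 (sinn n) = (1 - (-1) ^+ n) / (n%:R * pi) :> R.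
Proof.
move=> n0; have k0 := freq0 n0; have kn : n%:R * pi != 0 :> R by rewrite gt_eqF.
have cs : continuous (sinn n : R -> R) by move=> x; exact: der_cont (isd_sinZ _ x).
have dF x : 0 <= x <= 1 ->
    is_derive x (1 : R) (fun x => - (n%:R * pi)^-1 * cos (n%:R * pi * x)) (sinn n x).
  move=> _; have := isdZ (- (n%:R * pi)^-1) (isd_cosZ (n%:R * pi) x).
  by move=> /is_derive_eq; apply; rewrite mulrNN mulKf.
rewrite (RI_FTC ler01 cs dF) mulr1 mulr0 cos0 cos_natpi.
by move: ((_ * _)^-1) => u; ring.
Qed.

Lemma RI_sinnM m n : (0 < m)%N -> (0 < n)%N ->
  RI 0 1 (fun x => sinn m x * sinn n x) = (m == n)%:R / 2 :> R.
Proof.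
move=> m0 n0; have km := freq0 m0; have kmn : m%:R * pi != 0 :> R by rewrite gt_eqF.
have cs l : continuous (sinn l : R -> R) by move=> x; exact: der_cont (isd_sinZ _ x).
have c1 := rcontM (cs m) (cs n); have c2 := rcontM (@cont_cosn R m) (@cont_cosn R n).
have c3 := rcontM (rcontK (- (n%:R / m%:R))) c2.
have dF x : 0 <= x <= 1 -> is_derive x (1 : R) (fun x => - (m%:R * pi)^-1 * (cosn m x * sinn n x))
    (sinn m x * sinn n x + - (n%:R / m%:R) * (cosn m x * cosn n x)).
  move=> _; have := isdZ (- (m%:R * pi)^-1) (isdM (isd_cosZ (m%:R * pi) x) (isd_sinZ (n%:R * pi) x)).
  move=> /is_derive_eq; apply; rewrite -/(sinn m x) -/(sinn n x) -/(cosn m x) -/(cosn n x).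
  by move: (@pi R) (pi_gt0 R) => P P0; field; rewrite (gt_eqF P0) pnatr_eq0 -lt0n m0.
have := RI_FTC ler01 (rcontD c1 c3) dF.
rewrite (RI_D 0 1 c1 c3) (RI_Z 0 1 _ c2) RI_cosnM /sinn !mulr1 !mulr0 sin0 cosnpi !mulr0 subrr.
move=> /eqP; rewrite addr_eq0 => /eqP ->; rewrite mulNr opprK.
have [->|_] := eqVneq m n; last by rewrite !mul0r mulr0.
have -> : wn n = 2^-1 :> R by rewrite /wn; case: (n) n0.
by rewrite mulfV ?mul1r// pnatr_eq0 -lt0n.
Qed.

(** Bessel's inequality for the constant 1, whose sine coefficients on (0, 1) are 4 / (pi j) for odd
    j: the integral of (1 - c B)^2 with c = 4 / pi is nonnegative and equals 1 - 8 S / pi^2. *)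
Lemma sum_odd_inv_sq N : \sum_(0 <= j < N | odd j) (j%:R ^+ 2)^-1 <= pi ^+ 2 / 8 :> R.
Proof.
set S := \sum_(0 <= j < N | odd j) _.
have pi0 := pi_gt0 R.
pose a j : R := (j%:R)^-1.
pose B x := \sum_(0 <= j < N | odd j) a j * sinn j x.
have cs l : continuous (sinn l : R -> R) by move=> x; exact: der_cont (isd_sinZ _ x).
have cB : continuous B by apply: cont_sum => j; exact: (rcontM (rcontK _) (cs j)).
have aE j : a j * j%:R^-1 = (j%:R ^+ 2)^-1 by rewrite expr2 invfM.
have RB : RI 0 1 B = 2 / pi * S.
  rewrite RI_sum; last by move=> j; exact: (rcontM (rcontK _) (cs j)).
  rewrite mulr_sumr; apply: eq_bigr => j oj.
  have j0 : (0 < j)%N by case: j oj.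
  rewrite (RI_Z 0 1 _ (cs j)) RI_sinn// -signr_odd oj expr1 -aE.
  by rewrite /a; move: (@pi R) pi0 => P P0; field; rewrite (gt_eqF P0) pnatr_eq0 -lt0n j0.
have RBs (k : nat) : odd k -> (k < N)%N -> RI 0 1 (fun x => B x * sinn k x) = a k / 2.
  move=> ok kN; have k0 : (0 < k)%N by case: k ok {kN}.
  rewrite (@eq_RI _ _ _ _ (fun x => \sum_(0 <= j < N | odd j) a j * (sinn j x * sinn k x))); last first.
    by move=> x _; rewrite mulr_suml; apply: eq_bigr => j _; rewrite mulrA.
  have csk j := rcontM (cs j) (cs k).
  rewrite RI_sum; last by move=> j; exact: (rcontM (rcontK _) (csk j)).
  rewrite big_mkcond (bigD1_seq k) ?mem_index_iota ?iota_uniq//= ok.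
  rewrite (RI_Z 0 1 _ (csk k)) RI_sinnM// eqxx mul1r big1 ?addr0// => j jk.
  case: ifP => // oj; have j0 : (0 < j)%N by case: j oj {jk}.
  by rewrite (RI_Z 0 1 _ (csk j)) RI_sinnM// (negbTE jk) mul0r mulr0.
have RBB : RI 0 1 (fun x => B x * B x) = S / 2.
  rewrite (@eq_RI _ _ _ _ (fun x => \sum_(0 <= j < N | odd j) a j * (B x * sinn j x))); last first.
    by move=> x _; rewrite [X in _ * X]/B mulr_sumr; apply: eq_bigr => j _; rewrite mulrCA.
  have cBs j := rcontM cB (cs j).
  rewrite RI_sum; last by move=> j; exact: (rcontM (rcontK _) (cBs j)).
  rewrite /S mulr_suml [LHS]big_nat_cond [RHS]big_nat_cond; apply: eq_bigr => j /andP[/andP[_ jN] oj].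
  by rewrite (RI_Z 0 1 _ (cBs j)) RBs// mulrA aE.
pose c : R := 4 / pi.
have c1 : continuous (fun x => 1 + (- (2 * c)) * B x) by exact: (rcontD (rcontK 1) (rcontM (rcontK _) cB)).
have cBB := rcontM cB cB.
have : 0 <= RI 0 1 (fun x => (1 + (- (2 * c)) * B x) + c ^+ 2 * (B x * B x)).
  apply: RI_ge0 => x _; rewrite (_ : _ + _ = (1 - c * B x) ^+ 2) ?sqr_ge0//; ring.
rewrite (RI_D 0 1 c1 (rcontM (rcontK (c ^+ 2)) cBB)).
rewrite (RI_D 0 1 (rcontK 1) (rcontM (rcontK (- (2 * c))) cB)).
rewrite (RI_Z 0 1 _ cBB) (RI_Z 0 1 _ cB) RBB RB.
have -> : RI 0 1 (cst 1 : R -> R) = 1 by rewrite RI_cst// subr0 mulr1.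
have -> : 1 + - (2 * c) * (2 / pi * S) + c ^+ 2 * (S / 2) = 1 - 8 / pi ^+ 2 * S.
  by rewrite /c; move: (@pi R) pi0 => P P0; field; rewrite gt_eqF.
rewrite subr_ge0 mulrAC ler_pdivrMr ?exprn_gt0// mul1r => h.
by rewrite ler_pdivlMr// mulrC.
Qed.

Lemma sum_odd_tail N : (1 < N)%N ->
  \sum_(2 <= j < N | odd j) (j%:R ^+ 2)^-1 <= pi ^+ 2 / 8 - 1 :> R.
Proof.
move=> N1; have := sum_odd_inv_sq N.
rewrite (big_cat_nat (n := 2) _ (_ : (2 <= N)%N))//=.
rewrite big_mkcond/= big_nat_recr//= big_nat1/= expr1n invr1 add0r => h.
by rewrite lerBrDl.
Qed.

(** Successive integration of cos <= 1 yields cos x <= 1 - x^2/2 + x^4/24, which is negative at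
    1.68. The target 3.36 is just below the positive root (1 + sqrt 33) / 2 of q^2 - q - 8, as
    [pi_sqr_le] requires. *)
Lemma pi_lt_336 : pi < 336 / 100 :> R.
Proof.
have nd (f df : R -> R) : (forall x : R, is_derive x (1 : R) f (df x)) ->
    (forall x : R, 0 <= x -> 0 <= df x) -> forall x : R, 0 <= x -> f 0 <= f x.
  move=> d d0 x x0.
  have cf : {within `[0, x], continuous f}.
    by apply: continuous_subspaceT => y; exact: der_cont (d y).
  have d0' (y : R) : 0 < y < x -> 0 <= df y by move=> /andP[y0 _]; apply: d0; exact: ltW.
  exact: (der_nondecr (fun y _ => d y) cf d0' (lexx _) x0 (lexx _)).
have X (n : nat) (x : R) : is_derive x (1 : R) (fun y : R => y ^+ n.+1) (n.+1%:R * x ^+ n).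
  elim: n => [|n IH]; first by rewrite mul1r; exact: isd_id.
  have := isdM (isd_id x) IH; move=> /is_derive_eq; apply.
  by rewrite -(natr1 n.+1) exprS; ring.
have s1 (x : R) : 0 <= x -> 0 <= x - sin x.
  move=> x0; have D (y : R) := isdB (isd_id y) (is_derive_sin y).
  have := nd _ _ D _ x x0; rewrite sin0 subrr; apply.
  by move=> y _; rewrite subr_ge0 cos_le1.
have s2 (x : R) : 0 <= x -> 0 <= cos x - 1 + 2^-1 * x ^+ 2.
  move=> x0; have D (y : R) := isdD (isdB (is_derive_cos y) (isd_cst 1 y)) (isdZ 2^-1 (X 1%N y)).
  have := nd _ _ D _ x x0; rewrite cos0 subrr expr0n/= mulr0 addr0; apply.
  by move=> y y0; have := s1 y y0; rewrite expr1; lra.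
have s3 (x : R) : 0 <= x -> 0 <= sin x - x + 6^-1 * x ^+ 3.
  move=> x0; have D (y : R) := isdD (isdB (is_derive_sin y) (isd_id y)) (isdZ 6^-1 (X 2%N y)).
  have := nd _ _ D _ x x0; rewrite sin0 subrr expr0n/= mulr0 addr0; apply.
  by move=> y y0; have := s2 y y0; lra.
have s4 (x : R) : 0 <= x -> 0 <= 1 - cos x - 2^-1 * x ^+ 2 + 24^-1 * x ^+ 4.
  move=> x0; have D (y : R) := isdD (isdB (isdB (isd_cst 1 y) (is_derive_cos y)) (isdZ 2^-1 (X 1%N y)))
    (isdZ 24^-1 (X 3%N y)).
  have := nd _ _ D _ x x0; rewrite cos0 subrr expr0n/= expr0n/= !mulr0 addr0 subr0; apply.
  by move=> y y0; have := s3 y y0; rewrite expr1; lra.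
rewrite ltNge; apply/negP => h.
have [e|ne] := eqVneq (pi : R) (336 / 100).
  have := s4 (pi / 2) ltac:(by rewrite divr_ge0// pi_ge0).
  rewrite cos_pihalf e; lra.
have : 0 < cos (168 / 100 : R).
  by apply: cos_gt0_pihalf; move: h; rewrite le_eqVlt eq_sym (negbTE ne)/= => h; apply/andP; split; lra.
have h168 : 0 <= 168 / 100 :> R by lra.
by have := s4 _ h168; lra.
Qed.

End constants.

Section coefficients.
Context {R : realType}.
Implicit Types (x y z t w k c : R) (n j N : nat).
Lemma Fp1E (p : R) : Fp p 1 = pip p / 2.
Proof. by rewrite /pip mulrC mulKf. Qed.

Local Opaque sinp Fp cosp pip.

Variables (p L K : R).
Hypotheses (p1 : 1 < p) (p2 : p < 2) (LE : pip p = L).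
Hypothesis slope : forall y, 0 < y < 1 ->
  L ^+ 2 * (y `^ (p - 1) * (1 - y `^ p) `^ ((2 - p) / p)) <= K.

Let p0 : 0 < p. Proof. exact: lt_trans p1. Qed.
Let L0 : 0 < L. Proof. by rewrite -LE; exact: pip_gt0. Qed.
Let half0 : 0 < 2^-1 :> R. Proof. by rewrite invr_gt0. Qed.

Let f x := cosp p (L * x).
Let S x := sinp p (L * x).
(** On (0, 1/2), [- (L * H)] is the derivative of [f]. The absolute values make [H] continuous on
    the whole line. *)
Let H x := `|S x| `^ (p - 1) * `|f x| `^ (2 - p).

Let cLx : continuous (fun x => L * x : R).
Proof. by move=> x; apply: (der_cont (isdZ L (isd_id x))). Qed.

Lemma cont_cospL : continuous f.
Proof. by move=> x; exact: (@continuous_comp _ _ _ (fun x => L * x) (cosp p) x (@cLx x) (@cont_cosp _ _ p1 _)). Qed.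
Let cf := cont_cospL.

Let cS : continuous S.
Proof. by move=> x; exact: (@continuous_comp _ _ _ (fun x => L * x) (sinp p) x (@cLx x) (@cont_sinp _ _ p1 _)). Qed.

Let cH : continuous H.
Proof.
have a0 : 0 < p - 1 by rewrite subr_gt0.
have b0 : 0 < 2 - p by rewrite subr_gt0.
exact: (rcontM (cont_powR_abs a0 cS) (cont_powR_abs b0 cf)).
Qed.

Lemma cospL_N x : f (- x) = f x.
Proof. by rewrite /f mulrN (cospN p1). Qed.

Lemma cospL_D2 x : f (x + 2) = f x.
Proof.
rewrite /f mulrDr; have := cosp_shift p1 (L * x) 2; rewrite LE.
by rewrite -exprnP sqrrN expr1n mul1r (mulrC L 2).
Qed.

Let f_refl x : f (1 - x) = - f x.
Proof.
rewrite /f mulrBr mulr1; have := cosp_shift p1 (- (L * x)) 1; rewrite LE mul1r.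
by rewrite (cospN p1) expr1z mulN1r (addrC L).
Qed.

Let halfL x : 0 <= x <= 2^-1 -> 0 <= L * x <= pip p / 2.
Proof.
by move=> /andP[x0 x1]; rewrite LE mulr_ge0 ?(ltW L0)//= ler_pM2l.
Qed.

Let halfLoo x : 0 < x < 2^-1 -> 0 < L * x < pip p / 2.
Proof. by move=> /andP[x0 x1]; rewrite LE mulr_gt0//= ltr_pM2l. Qed.

Let f_half : f 2^-1 = 0.
Proof. by rewrite /f -LE; exact: cosp_half. Qed.

Let S_half : S 2^-1 = 1.
Proof. by rewrite /S -LE; exact: sinp_half. Qed.

Let S0 : S 0 = 0.
Proof. by rewrite /S mulr0; exact: sinp0. Qed.

Let isd_S x : is_derive x (1 : R) S (L * f x).
Proof.
have := isdC (f := sinp p) (g := fun x => L * x) (isd_sinp p1 (L * x)) (isdZ L (isd_id x)).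
by rewrite mulr1 mulrC.
Qed.

Let S_itv x : 0 < x < 2^-1 -> 0 < S x < 1.
Proof. by move=> /halfLoo; exact: sinp_itvoo. Qed.

Let f_gt0 x : 0 < x < 2^-1 -> 0 < f x.
Proof. by move=> /halfLoo; exact: cosp_gt0. Qed.

Let isd_f x : 0 < x < 2^-1 -> is_derive x (1 : R) f (- (L * H x)).
Proof.
move=> xI; have /andP[s0 s1] := S_itv xI; have f0 := f_gt0 xI.
have := isdC (f := cosp p) (g := fun x => L * x) (isd_cosp p1 (halfLoo xI)) (isdZ L (isd_id x)).
by rewrite mulr1 mulNr (mulrC _ L) /H (gtr0_norm s0) (gtr0_norm f0).
Qed.

Let H0 : H 0 = 0.
Proof. by rewrite /H S0 normr0 powR0 ?mul0r// subr_eq0 gt_eqF. Qed.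

Let H_half : H 2^-1 = 0.
Proof. by rewrite /H f_half normr0 powR0 ?mulr0// subr_eq0 gt_eqF. Qed.

Let dH x := L * (S x `^ (p - 2) * f x `^ (3 - 2 * p) * (p - 1 - S x `^ p)).

Let isd_H x : 0 < x < 2^-1 -> is_derive x (1 : R) H (dH x).
Proof.
move=> xI; have /andP[s0 s1] := S_itv xI; have f0 := f_gt0 xI; have /andP[x0 x1] := xI.
apply: (@near_eq_is_derive _ _ _ (fun x => S x `^ (p - 1) * f x `^ (2 - p))).
  near=> z.
  have zI : 0 < z < 2^-1 by apply/andP; split; near: z; [exact: lt_nbhsr|exact: lt_nbhsl].
  by have /andP[sz _] := S_itv zI; rewrite /H (gtr0_norm sz) (gtr0_norm (f_gt0 zI)).
have d1 := isdC (f := fun u => u `^ (p - 1)) (g := S) (is_derive1_powR (p - 1) s0) (isd_S x).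
have d2 := isdC (f := fun u => u `^ (2 - p)) (g := f) (is_derive1_powR (2 - p) f0) (isd_f xI).
have := isdM d1 d2; move=> /is_derive_eq; apply.
rewrite /dH /H (gtr0_norm s0) (gtr0_norm f0).
have e1 : p - 1 - 1 = p - 2 by ring.
have e2 : 2 - p - 1 = 1 - p by ring.
have fp' : f x `^ p = 1 - S x `^ p by apply: (cosp_powR p1); apply: halfL; rewrite !ltW.
have fE : f x * f x `^ (2 - p) = f x `^ (3 - 2 * p) * f x `^ p.
  by rewrite -{1}(powRr1 (ltW f0)) -!(powRDp _ _ f0); congr powR; ring.
have fE' : f x `^ (1 - p) * f x `^ (2 - p) = f x `^ (3 - 2 * p).
  by rewrite -!(powRDp _ _ f0); congr powR; ring.
have SE : S x `^ (p - 1) * S x `^ (p - 1) = S x `^ (p - 2) * S x `^ p.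
  by rewrite -!(powRDp _ _ s0); congr powR; ring.
rewrite e1 e2.
transitivity (L * ((p - 1) * S x `^ (p - 2) * (f x * f x `^ (2 - p)) -
  (2 - p) * (S x `^ (p - 1) * S x `^ (p - 1)) * (f x `^ (1 - p) * f x `^ (2 - p)))).
  by ring.
rewrite fE fE' SE fp'.
by ring.
Unshelve. all: by end_near. Qed.

(* The derivative of [H] has the sign of [p - 1 - S ^ p]. *)
Let H_turn : exists m : R, [/\ 0 < m < 2^-1, forall x, 0 < x < m -> 0 <= dH x &
  forall x, m < x < 2^-1 -> dH x <= 0].
Proof.
have a0 : 0 < p - 1 by rewrite subr_gt0.
have a1 : p - 1 < 1 by rewrite ltrBlDr.
(* [y] is the value of [S] at which p - 1 - S^p changes sign, and [m] the point of (0, 1/2) where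
   [S] takes it. *)
pose y := (p - 1) `^ (p^-1).
have y0 : 0 < y by rewrite powR_gt0.
have y1 : y < 1 by apply: powR_lt1; rewrite ?invr_gt0// ltW.
have yp : y `^ p = p - 1 by rewrite /y -powRrM mulVf ?gt_eqF// powRr1// ltW.
pose m := Fp p y / L.
have LmE : L * m = Fp p y by rewrite /m mulrC divfK// gt_eqF.
have m0 : 0 < m by rewrite divr_gt0// -(Fp0 p) (Fp_incr p1)// ltW.
have mh : m < 2^-1.
  rewrite -(ltr_pM2l L0) LmE -LE.
  by rewrite -Fp1E (Fp_incr p1)// ltW.
have Sm : S m = y by rewrite /S LmE (sinp_Fp p1)// !ltW.
have mP : L * m <= pip p / 2 by rewrite LE ler_pM2l// ltW.
have sgn x : 0 < x < 2^-1 -> 0 <= L * (S x `^ (p - 2) * f x `^ (3 - 2 * p)).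
  by move=> xI; rewrite !mulr_ge0 ?powR_ge0// ltW.
exists m; split; first by rewrite m0.
  move=> x /andP[x0 xm]; have xI : 0 < x < 2^-1 by rewrite x0 (lt_trans xm).
  rewrite /dH mulrA mulr_ge0 ?sgn// subr_ge0 -yp; have /andP[s0 _] := S_itv xI.
  apply: (ge0_ler_powR (ltW p0)); rewrite ?nnegrE ?(ltW s0) ?(ltW y0)//.
  rewrite -Sm; apply: (sinp_le p1) => //; last by rewrite ler_pM2l// ltW.
  by rewrite mulr_ge0// ltW.
move=> x /andP[mx xh]; have xI : 0 < x < 2^-1 by rewrite xh (lt_trans m0).
rewrite /dH mulrA mulr_ge0_le0 ?sgn// subr_le0 -yp; have /andP[s0 _] := S_itv xI.
apply: (ge0_ler_powR (ltW p0)); rewrite ?nnegrE ?(ltW s0) ?(ltW y0)//.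
rewrite -Sm; apply: (sinp_le p1).
- by rewrite mulr_ge0// ltW.
- by rewrite ler_pM2l// ltW.
- by have /halfLoo/andP[_ /ltW] := xI.
Qed.

Let H_le x : 0 < x < 2^-1 -> L ^+ 2 * H x <= K.
Proof.
move=> xI; have sI := S_itv xI; have /andP[s0 s1] := sI; have f0 := f_gt0 xI.
apply: le_trans (slope sI); rewrite /H (gtr0_norm s0) (gtr0_norm f0).
have xI' : 0 <= L * x <= pip p / 2 by have /andP[a b] := halfLoo xI; rewrite !ltW.
have fE : f x = (1 - S x `^ p) `^ (p^-1) by exact: (cospE p1 xI').
by rewrite fE -powRrM (mulrC p^-1).
Qed.

Definition tau n : R := RI 0 1 (fun x => f x * cosn n x) / wn n.

Lemma tauE n : RI 0 1 (fun x => f x * cosn n x) = tau n * wn n.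
Proof. by rewrite /tau divfK// /wn; case: n => [|n]; rewrite ?oner_eq0// invr_eq0. Qed.

Let cosn_refl n x : cosn n (1 - x) = (-1) ^+ n * cosn n x.
Proof.
rewrite /cosn mulrBr mulr1 cosB cos_natpi cosnpi mul0r addr0.
by [].
Qed.

Let cfn n : continuous (fun x => f x * cosn n x). Proof. exact: (rcontM cf (@cont_cosn R n)). Qed.

(** Under x |-> 1 - x, [f] changes sign and [cosn n] is multiplied by (-1)^n: the halves cancel for
    even n and add up for odd n. *)
Let RI_half n : RI 0 1 (fun x => f x * cosn n x) = (1 - (-1) ^+ n) * RI 0 2^-1 (fun x => f x * cosn n x).
Proof.
have h1 : 2^-1 <= 1 :> R by lra.
rewrite (RI_cat (ltW half0) h1 (@cfn n)).
have := @RI_refl _ 1 0 2^-1 _ (ltW half0) (@cfn n).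
have -> : 1 - 2^-1 = 2^-1 :> R by lra.
rewrite subr0 => <-.
rewrite [X in _ + X](@eq_RI _ _ _ _ (fun x => - (-1) ^+ n * (f x * cosn n x))); last first.
  by move=> x _; rewrite f_refl cosn_refl; ring.
by rewrite (RI_Z 0 2^-1 _ (@cfn n)); ring.
Qed.

Lemma tau_even n : ~~ odd n -> tau n = 0.
Proof. by move=> on; rewrite /tau RI_half -signr_odd (negbTE on) expr0 subrr !mul0r. Qed.

Let tau_odd n : odd n -> tau n = 4 * RI 0 2^-1 (fun x => f x * cosn n x).
Proof.
move=> on; rewrite /tau RI_half -signr_odd on expr1.
by have -> : wn n = 2^-1 :> R by [case: n on]; rewrite invrK; ring.
Qed.

Let half_cosn n : odd n -> cosn n 2^-1 = 0 :> R.
Proof.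
move=> on; have := cosn_refl n 2^-1; rewrite -signr_odd on expr1 mulN1r.
have -> : 1 - 2^-1 = 2^-1 :> R by lra.
by lra.
Qed.

(** For odd n, folding and division by [wn n] give a factor 4, the first integration by parts L / k
    with k = n pi, and [oscillatory_le] gives 2 H m / k. It remains to use L^2 H m <= K. *)
Lemma tau_le n : (0 < n)%N -> `|tau n| <= (8 * K / (L * pi ^+ 2)) / n%:R ^+ 2.
Proof.
move=> n0; have K0 : 0 <= K.
  apply: le_trans (H_le (x := 4^-1) _); last by apply/andP; split; lra.
  by rewrite mulr_ge0 ?exprn_ge0 ?(ltW L0)// mulr_ge0// powR_ge0.
have [on|en] := boolP (odd n); last first.
  rewrite (tau_even en) normr0 divr_ge0 ?exprn_ge0// divr_ge0 ?mulr_ge0 ?exprn_ge0 ?(ltW L0) ?pi_ge0//.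
pose k : R := n%:R * pi.
have k0 : 0 < k by rewrite mulr_gt0 ?ltr0n// pi_gt0.
have [m [/andP[m0 mh] up dn]] := H_turn.
have osc := oscillatory_le m0 mh k0 cH H0 H_half isd_H up dn.
have cs : continuous (fun x => sin (k * x)) by move=> x; exact: der_cont (isd_sinZ k x).
have cHs := rcontM cH cs.
have byparts : RI 0 2^-1 (fun x => f x * cosn n x) = L / k * RI 0 2^-1 (fun x => H x * sin (k * x)).
  have cG := rcontD (@cfn n) (rcontM (rcontK (- (L / k))) cHs).
  have cF := rcontM (rcontK k^-1) (rcontM cf cs).
  have := RI_FTC_oo (ltW half0) cG cF.
  rewrite (RI_D 0 2^-1 (@cfn n) (rcontM (rcontK (- (L / k))) cHs)) (RI_Z 0 2^-1 _ cHs).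
  rewrite f_half !mulr0 sin0 mul0r !mulr0 subrr => h.
  apply/eqP; rewrite -subr_eq0 -mulNr; apply/eqP; apply: h => x xI.
  have := isdZ k^-1 (isdM (isd_f xI) (isd_sinZ k x)).
  move=> /is_derive_eq; apply; rewrite /cosn -/k /cst.
  by move: (k) k0 (H x) (f x) (sin _) (cos _) => k' k'0 a b c d; field; rewrite gt_eqF.
rewrite (tau_odd on) byparts mulrA normrM ger0_norm; last first.
  by rewrite mulr_ge0// divr_ge0// ltW.
have Lk : 0 <= 4 * (L / k) by rewrite mulr_ge0// divr_ge0// ltW.
apply: (le_trans (ler_wpM2l Lk osc)).
have mI : 0 < m < 2^-1 by rewrite m0.
have := H_le mI => hK.
have -> : 4 * (L / k) * (2 * H m / k) = 8 / (L * k ^+ 2) * (L ^+ 2 * H m).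
  by move: (k) k0 (L) L0 (H m) => k' k'0 l l0 a; field; rewrite !gt_eqF.
have -> : 8 * K / (L * pi ^+ 2) / n%:R ^+ 2 = 8 / (L * k ^+ 2) * K.
  have : n%:R != 0 :> R by rewrite pnatr_eq0 -lt0n.
  rewrite /k; move: (n%:R : R) (@pi R) (pi_gt0 R) (L) L0 => v q q0 l l0 v0; field.
  by rewrite ?v0 ?(gt_eqF q0) ?(gt_eqF l0).
by rewrite ler_wpM2l// divr_ge0// mulr_ge0 ?exprn_ge0// ltW.
Qed.

(** One integration by parts makes [tau 1] equal to 4 pi / L times the integral of S x sin (pi x)
    over [0, 1/2]. Replacing [S] by the smaller sin (pi x) gives pi / L, as sin^2 (pi x) has
    integral 1/4 there. *)
Lemma tau1_gt : pi / L < tau 1.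
Proof.
have pi0 := pi_gt0 R.
have -> : tau 1 = 4 * RI 0 2^-1 (fun x => f x * cosn 1 x) by exact: tau_odd.
have E1 x : cosn 1 x = cos (pi * x) :> R by rewrite /cosn mul1r.
have cs : continuous (fun x => sin (pi * x) : R) by move=> x; exact: der_cont (isd_sinZ pi x).
have cSs := rcontM cS cs.
have byparts : RI 0 2^-1 (fun x => f x * cosn 1 x) = pi / L * RI 0 2^-1 (fun x => S x * sin (pi * x)).
  have cG := rcontD (@cfn 1) (rcontM (rcontK (- (pi / L))) cSs).
  have cF := rcontM (rcontK L^-1) (rcontM cS (@cont_cosn R 1)).
  have := RI_FTC_oo (ltW half0) cG cF.
  rewrite (RI_D 0 2^-1 (@cfn 1) (rcontM (rcontK (- (pi / L))) cSs)) (RI_Z 0 2^-1 _ cSs).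
  rewrite half_cosn// S0 mul0r !mulr0 subrr => h.
  apply/eqP; rewrite -subr_eq0 -mulNr; apply/eqP; apply: h => x xI.
  have := isdZ L^-1 (isdM (isd_S x) (isd_cosZ (1 * pi) x)).
  move=> /is_derive_eq; apply; rewrite /cosn !mul1r /cst.
  by move: (L) L0 (@pi R) (S x) (f x) (sin _) (cos _) => l l0 q a b c d; field; rewrite gt_eqF.
have css := rcontM cs cs.
have ssq : RI 0 2^-1 (fun x => sin (pi * x) * sin (pi * x)) = 4^-1 :> R.
  have dF (x : R) : 0 <= x <= 2^-1 -> is_derive x (1 : R)
      (fun x => 2^-1 * x - (2 * pi)^-1 * (sin (pi * x) * cos (pi * x))) (sin (pi * x) * sin (pi * x)).
    move=> _; have := isdB (isdZ 2^-1 (isd_id x)) (isdZ (2 * pi)^-1 (isdM (isd_sinZ pi x) (isd_cosZ pi x))).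
    move=> /is_derive_eq; apply; have := cos2Dsin2 (pi * x).
    move: (@pi R) pi0 (sin _) (cos _) => q q0 a b; rewrite !expr2 => e.
    have -> : a * a = 2^-1 * (b * b + a * a) - 2^-1 * (b * b - a * a) by lra.
    by rewrite e; field; rewrite gt_eqF.
  rewrite (RI_FTC (ltW half0) css dF) !mulr0 sin0 mul0r mulr0 subrr subr0.
  by rewrite cos_pihalf !mulr0 subr0; lra.
have gt : 0 < RI 0 2^-1 (fun x => S x * sin (pi * x) - sin (pi * x) * sin (pi * x)).
  have sp x : 0 < x < 2^-1 -> 0 < S x * sin (pi * x) - sin (pi * x) * sin (pi * x).
    move=> xI; rewrite -mulrBl mulr_gt0//.
      by rewrite subr_gt0 /S -LE; exact: sin_lt_sinp.
    have /andP[x0 x1] := xI; apply: sin_gt0_pi; apply/andP; split; first by rewrite mulr_gt0.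
    by rewrite -[ltRHS]mulr1 ltr_pM2l//; lra.
  apply: (RI_gt0 (x := 4^-1) (rcontD cSs (rcontN css))).
  - move=> x /andP[]; rewrite le_eqVlt => /predU1P[<- _|x0].
      by rewrite !mulr0 sin0 !mulr0 subrr.
    rewrite le_eqVlt => /predU1P[->|x1]; last by rewrite ltW// sp// x0.
    rewrite S_half mul1r -{1}[sin _]mul1r -mulrBl mulr_ge0 ?subr_ge0 ?sin_le1//.
    by rewrite sin_pihalf.
  - by apply/andP; split; lra.
  - by apply: sp; apply/andP; split; lra.
rewrite (RI_B 0 2^-1 cSs css) ssq subr_gt0 in gt.
rewrite byparts mulrCA -[ltLHS]mulr1 ltr_pM2l ?divr_gt0//.
by lra.
Qed.

(** The critical constant appears here: summing [tau_le] over odd j >= 3 gives K (pi^2 - 8) / (L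
    pi^2), which is at most pi / L exactly when K (pi^2 - 8) <= pi^3. *)
Lemma sum_tau_tail N : K * (pi ^+ 2 - 8) <= pi ^+ 3 ->
  (1 < N)%N -> \sum_(2 <= j < N) `|tau j| <= pi / L.
Proof.
move=> Kpi N1; have pi0 := pi_gt0 R.
pose c := 8 * K / (L * pi ^+ 2).
apply: (@le_trans _ _ (\sum_(2 <= j < N | odd j) c * (j%:R ^+ 2)^-1)).
  rewrite [leRHS]big_mkcond [leLHS]big_nat_cond [leRHS]big_nat_cond.
  apply: ler_sum => j /andP[/andP[j2 _] _]; case: ifPn => [_|ej].
    by apply: tau_le; exact: leq_trans j2.
  by rewrite (tau_even ej) normr0.
rewrite -mulr_sumr.
have c0 : 0 <= c.
  by have := tau_le (ltn0Sn 0); rewrite expr1n divr1; apply: le_trans.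
have tail : \sum_(2 <= j < N | odd j) (j%:R ^+ 2)^-1 <= pi ^+ 2 / 8 - 1 :> R := sum_odd_tail N1.
apply: (le_trans (ler_wpM2l c0 tail)).
have -> : c * (pi ^+ 2 / 8 - 1) = (K * (pi ^+ 2 - 8)) / (L * pi ^+ 2).
  by rewrite /c; move: (@pi R) pi0 (L) L0 => q q0 l l0; field; rewrite !gt_eqF.
have -> : pi / L = pi ^+ 3 / (L * pi ^+ 2).
  by move: (@pi R) pi0 (L) L0 => q q0 l l0; field; rewrite !gt_eqF.
by rewrite ler_pM2r// invr_gt0 mulr_gt0// exprn_gt0.
Qed.

Lemma cosp_series x (k : nat) :
  `|cpoly tau k.+2 x - f x| <= (8 * K / (L * pi ^+ 2)) / k.+1%:R.
Proof.
have [y yI h] := fold_point x.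
rewrite (h (cpoly tau k.+2) (cpolyN tau k.+2) (cpolyD2 tau k.+2)) (h f cospL_N cospL_D2).
exact: (cosine_series cf tauE tau_le).
Qed.

End coefficients.

(** * Perturbation of the cosine basis *)

Section dilation.
Context {R : realType}.
Implicit Types (x y z t d : R) (n j k N M m : nat) (a b : nat -> R).

Lemma ns_cosn_gt0 s n : 1 < s -> 0 < ns s (cosn n : R -> R).
Proof.
move=> s1; rewrite lt0r ns_ge0 andbT; apply/eqP => n0.
have s0 : 0 < s by exact: lt_trans s1.
pose s' : R := (1 - s^-1)^-1.
have si : 0 < 1 - s^-1 by rewrite subr_gt0 invf_lt1.
have s'1 : 1 < s' by rewrite /s' -[ltLHS]invr1 ltf_pV2 ?posrE// gtrBl invr_gt0.
have e : s^-1 + s'^-1 = 1 by rewrite /s' invrK; ring.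
have := ns_hoelder s1 s'1 e (@cont_cosn R n) (@cont_cosn R n).
rewrite n0 mul0r RI_cosnM eqxx mul1r normr_le0.
by rewrite /wn; case: (n) => [|?]; rewrite ?oner_eq0// invr_eq0 (pnatr_eq0 R 2).
Qed.

(** Being even and 2-periodic, [h] is symmetric about every integer, so [n + 1, n + 2] mirrors
    [n, n + 1]. This underlies the invariance of norms under integer dilations. *)
Lemma RI_unit_translate (h : R -> R) n : continuous h -> (forall z, h (- z) = h z) ->
  (forall z, h (z + 2) = h z) -> RI n%:R n.+1%:R h = RI 0 1 h.
Proof.
move=> ch he hp; elim: n => [//|n IH].
have hr x : h (2 * n.+1%:R - x) = h x.
  elim: n.+1 => [|m IHm]; first by rewrite mulr0 sub0r he.
  by rewrite -[RHS]IHm -[RHS]hp -natr1; congr h; ring.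
have le : n%:R <= n.+1%:R :> R by rewrite ler_nat.
rewrite -IH; have := RI_refl (2 * n.+1%:R) le ch.
under eq_fun do rewrite hr.
have e1 : 2 * n.+1%:R - n.+1%:R = n.+1%:R :> R by ring.
have e2 : 2 * n.+1%:R - n%:R = n.+2%:R :> R by rewrite -(natr1 n.+1) -(natr1 n); ring.
by rewrite e1 e2 => ->.
Qed.

Lemma RI_dilate (h : R -> R) j : continuous h -> (forall z, h (- z) = h z) ->
  (forall z, h (z + 2) = h z) -> (0 < j)%N -> RI 0 1 (fun x => h (j%:R * x)) = RI 0 1 h.
Proof.
move=> ch he hp j0; have j0' : 0 < j%:R :> R by rewrite ltr0n.
have H m : RI 0 m%:R h = m%:R * RI 0 1 h.
  elim: m => [|m IH].
    by rewrite mul0r /RI set_itv1 Rintegral_set1.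
  have a : 0 <= m%:R :> R by [].
  have b : m%:R <= m.+1%:R :> R by rewrite ler_nat.
  by rewrite (RI_cat a b ch) IH RI_unit_translate// -natr1 mulrDl mul1r.
apply: (mulfI (lt0r_neq0 j0')); rewrite -H.
have := RI_affine 0 ler01 j0' ch; rewrite mulr0 mulr1 !addr0 => <-.
by congr (_ * _); apply: eq_RI => x _; rewrite addr0.
Qed.

Lemma ns_dilate s (G : R -> R) j : 1 <= s -> continuous G -> (forall z, G (- z) = G z) ->
  (forall z, G (z + 2) = G z) -> (0 < j)%N -> ns s (fun x => G (j%:R * x)) = ns s G.
Proof.
move=> s1 cG Ge Gp j0; have s0 : 0 < s by exact: lt_le_trans s1.
have cj : continuous (fun x => G (j%:R * x)).
  move=> x; apply: (@continuous_comp _ _ _ (fun x => j%:R * x) G); last exact: cG.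
  exact: (der_cont (isdZ j%:R (isd_id x))).
have e1 (z : R) : `|G (- z)| `^ s = `|G z| `^ s by rewrite Ge.
have e2 (z : R) : `|G (z + 2)| `^ s = `|G z| `^ s by rewrite Gp.
have E := RI_dilate (cont_powR_abs s0 cG) e1 e2 j0.
by rewrite (ns_cont s1 cj) E -(ns_cont s1 cG).
Qed.

Lemma cosn_dilate n j x : cosn n (j%:R * x) = cosn (n * j) x :> R.
Proof. by rewrite /cosn natrM; congr cos; ring. Qed.

Lemma is_cpoly_dilate a N j : is_cpoly (fun x => cpoly a N (j%:R * x) : R).
Proof.
have H : is_cpoly (fun x => \sum_(n <- index_iota 0 N) a n * cosn (n * j) x : R).
  by apply: is_cpoly_sum => n; apply: is_cpolyZ; exact: is_cpoly_cosn.
by apply: is_cpoly_ext H _ => x; apply: eq_bigr => n _; rewrite cosn_dilate.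
Qed.

Section perturbation.
Variables (s : R) (f : R -> R) (tau : nat -> R) (c rho : R).
Hypotheses (s1 : 1 < s) (cf : continuous f).
Hypothesis tau0 : tau 0%N = 0.
Hypothesis tail : forall N, (1 < N)%N -> \sum_(2 <= j < N) `|tau j| <= rho.
Hypothesis rho_lt : rho < tau 1%N.
Hypothesis unif : forall x (k : nat), `|cpoly tau k.+2 x - f x| <= c / k.+1%:R.

Let s1' : 1 <= s. Proof. exact: ltW. Qed.
Let e n x := f (n%:R * x).
Let rho0 : 0 <= rho.
Proof. by have := tail (isT : (1 < 2)%N); rewrite big_geq. Qed.
Let t1 : 0 < tau 1%N. Proof. exact: le_lt_trans rho_lt. Qed.

Let ce n : continuous (e n).
Proof.
move=> x; apply: (@continuous_comp _ _ _ (fun x => n%:R * x) f); last exact: cf.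
exact: (der_cont (isdZ n%:R (isd_id x))).
Qed.

Let eL n : inLs s (e n). Proof. exact: (cont_inLs s1' (@ce n)). Qed.

Let ces a N : continuous (esum e a N).
Proof. by apply: cont_sum => n; exact: (rcontM (rcontK _) (@ce n)). Qed.
Let esL a N : inLs s (esum e a N). Proof. exact: (cont_inLs s1' (@ces a N)). Qed.

Let Gd a N j x := cpoly a N (j%:R * x).
Let cGd a N j : continuous (Gd a N j).
Proof.
move=> x; apply: (@continuous_comp _ _ _ (fun x => j%:R * x) (cpoly a N)); last exact: cont_cpoly.
exact: (der_cont (isdZ j%:R (isd_id x))).
Qed.
Let GdL a N j : inLs s (Gd a N j). Proof. exact: (cont_inLs s1' (@cGd a N j)). Qed.
Let ns_Gd a N j : (0 < j)%N -> ns s (Gd a N j) = ns s (cpoly a N).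
Proof.
by apply: ns_dilate => //; [exact: cont_cpoly|exact: cpolyN|exact: cpolyD2].
Qed.

Let rest a N k x := \sum_(2 <= j < k.+2) tau j * Gd a N j x.
Let crest a N k : continuous (rest a N k).
Proof. by apply: cont_sum => j; exact: (rcontM (rcontK _) (@cGd a N j)). Qed.
Let restL a N k : inLs s (rest a N k). Proof. exact: (cont_inLs s1' (@crest a N k)). Qed.

Let ns_rest a N k : ns s (rest a N k) <= rho * ns s (cpoly a N).
Proof.
apply: (@le_trans _ _ ((\sum_(2 <= j < k.+2) `|tau j|) * ns s (cpoly a N))); last first.
  by rewrite ler_wpM2r ?ns_ge0// tail.
elim: k => [|k IH].
  rewrite (@eq_ns _ _ _ (cst 0)); last by move=> x; rewrite /rest big_geq.
  by rewrite ns_cst// big_geq// mul0r.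
rewrite (@eq_ns _ _ _ (fun x => rest a N k x + tau k.+2 * Gd a N k.+2 x)); last first.
  by move=> x; rewrite /rest big_nat_recr.
apply: le_trans (ns_triangle s1' (restL a N k) (inLsZ s1' (tau k.+2) (GdL a N k.+2))) _.
by rewrite big_nat_recr//= mulrDl lerD// (nsZ s1' _ (GdL a N k.+2)) ns_Gd.
Qed.

(* [f] is the sum of the [tau j * cosn j], so [esum e a N] is the image of
   [cpoly a N] under the operator [G |-> \sum_j tau j * G (j x)]. *)
Let diff a N k x := esum e a N x - (tau 1%N * cpoly a N x + rest a N k x).

Let cdiff a N k : continuous (diff a N k).
Proof.
apply: (rcontD (@ces a N) (rcontN _)).
exact: (rcontD (rcontM (rcontK _) (@cont_cpoly R a N)) (@crest a N k)).
Qed.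
Let diffL a N k : inLs s (diff a N k). Proof. exact: (cont_inLs s1' (@cdiff a N k)). Qed.

Let c0 : 0 <= c.
Proof. by have := unif 0 0; rewrite divr1; apply: le_trans. Qed.

(** Exchanging the two sums works because [cosn n (j x)] and [cosn j (n x)] coincide. The left side
    is thus the combination of the e_n with [f] replaced by a partial sum of its series. *)
Let TkE a N k x : tau 1%N * cpoly a N x + rest a N k x =
  \sum_(0 <= n < N) a n * cpoly tau k.+2 (n%:R * x).
Proof.
have -> : tau 1%N * cpoly a N x + rest a N k x = \sum_(0 <= j < k.+2) tau j * Gd a N j x.
  rewrite (big_cat_nat (n := 2) _ (_ : (2 <= k.+2)%N))//= big_nat_recr//= big_nat1 tau0 mul0r add0r.
  by rewrite /Gd mul1r.
rewrite (eq_bigr (fun j => \sum_(0 <= n < N) tau j * (a n * cosn n (j%:R * x)))); last first.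
  by move=> j _; rewrite /Gd /cpoly mulr_sumr.
rewrite exchange_big; apply: eq_bigr => n _; rewrite mulr_sumr; apply: eq_bigr => j _.
by rewrite mulrCA !cosn_dilate mulnC.
Qed.

Let ns_diff a N k : ns s (diff a N k) <= (\sum_(0 <= n < N) `|a n|) * c / k.+1%:R.
Proof.
have b0 : 0 <= (\sum_(0 <= n < N) `|a n|) * c / k.+1%:R.
  by rewrite !mulr_ge0 ?invr_ge0// sumr_ge0.
apply: (ns_le_sup s1' (@cdiff a N k) b0) => x _.
rewrite /diff TkE /esum -sumrB -mulrA mulr_suml; apply: le_trans (ler_norm_sum _ _ _) _.
by apply: ler_sum => n _; rewrite -mulrBr normrM ler_wpM2l// distrC unif.
Qed.

Let diff_small a N d : 0 < d -> exists k, ns s (diff a N k) <= d.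
Proof.
move=> d0; set B := (\sum_(0 <= n < N) `|a n|) * c.
exists (Num.bound (B / d)); apply: (le_trans (ns_diff a N _)); rewrite -/B.
have B0 : 0 <= B by rewrite mulr_ge0// sumr_ge0.
rewrite ler_pdivrMr// mulrC -ler_pdivrMr//.
apply: le_trans (ltW (archi_boundP _)) _; first by rewrite divr_ge0// ltW.
by rewrite ler_nat.
Qed.

Let TG a N k := fun x => tau 1%N * cpoly a N x + rest a N k x.
Let tGL a N : inLs s (fun x => tau 1%N * cpoly a N x).
Proof. apply: (inLsZ s1'); exact: (cont_inLs s1' (@cont_cpoly R a N)). Qed.
Let TGL a N k : inLs s (TG a N k). Proof. exact: (inLsD s1' (tGL a N) (restL a N k)). Qed.
Let ns_tG a N : ns s (fun x => tau 1%N * cpoly a N x) = tau 1%N * ns s (cpoly a N).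
Proof. by rewrite (nsZ s1' _ (cont_inLs s1' (@cont_cpoly R a N))) gtr0_norm. Qed.

Let esum_le a N : ns s (esum e a N) <= (tau 1%N + rho) * ns s (cpoly a N).
Proof.
apply/ler_addgt0Pr => d d0; have [k kP] := diff_small a N d0.
rewrite (@eq_ns _ _ _ (fun x => TG a N k x + diff a N k x)); last first.
  by move=> x; rewrite /diff /TG addrC subrK.
apply: le_trans (ns_triangle s1' (TGL a N k) (diffL a N k)) _; rewrite lerD//.
apply: le_trans (ns_triangle s1' (tGL a N) (restL a N k)) _.
by rewrite mulrDl ns_tG lerD2l ns_rest.
Qed.

(** Together with [esum_le], it makes the norms of a combination of the e_n and of the cosine
    polynomial with the same coefficients equivalent, which transports the bound on partial sums. *)
Let esum_ge a N : (tau 1%N - rho) * ns s (cpoly a N) <= ns s (esum e a N).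
Proof.
apply/ler_addgt0Pr => d d0; have [k kP] := diff_small a N d0.
rewrite mulrBl lerBlDr -ns_tG.
rewrite (@eq_ns _ _ _ (fun x => (esum e a N x - diff a N k x) - rest a N k x)); last first.
  by move=> x; rewrite /diff; ring.
apply: le_trans (ns_triangleB s1' (inLsB s1' (esL a N) (diffL a N k)) (restL a N k)) _.
rewrite lerD ?ns_rest//.
by apply: le_trans (ns_triangleB s1' (esL a N) (diffL a N k)) _; rewrite lerD2l.
Qed.

Let e_gt0 n : 0 < ns s (e n).
Proof.
have td : 0 < tau 1%N - rho by rewrite subr_gt0.
pose a (i : nat) : R := (i == n)%:R.
have aE (g : nat -> R -> R) x : \sum_(0 <= i < n.+1) a i * g i x = g n x.
  rewrite big_nat_recr//= /a eqxx mul1r big1_seq ?add0r// => i.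
  by rewrite mem_index_iota => /andP[_ /andP[_ iltn]]; rewrite ltn_eqF// mul0r.
have := esum_ge a n.+1; rewrite (eq_ns s (cpoly a n.+1) (cosn n) (aE cosn)) (eq_ns s (esum e a n.+1) (e n) (aE e)).
by apply: lt_le_trans; rewrite mulr_gt0// ns_cosn_gt0.
Qed.

Let r := rho / tau 1%N.
Let r1 : 0 <= r < 1.
Proof. by rewrite divr_ge0 ?(ltW t1)//= ltr_pdivrMr// mul1r. Qed.

Let esum_lin (k : R) a N b M : exists a' N', esum e a' N' =1 (fun x => k * esum e a N x + esum e b M x).
Proof.
exists (fun n => k * trunc_seq a N n + trunc_seq b M n), (maxn N M) => x.
rewrite -(esum_pad e a N _ (leq_maxl N M)) -(esum_pad e b M _ (leq_maxr N M)) /esum mulr_sumr -big_split /=.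
by apply: eq_bigr => n _; rewrite mulrDl mulrA.
Qed.

Let is_cpoly_rest a N k : is_cpoly (fun x => - (tau 1%N)^-1 * rest a N k x).
Proof.
apply: is_cpolyZ; apply: is_cpoly_sum => j; apply: is_cpolyZ; exact: is_cpoly_dilate.
Qed.

(** Neumann iteration: with G = [cpoly a N], up to truncation, G minus its image divided by [tau 1]
    is - rest / [tau 1], again a cosine polynomial, of norm at most r times that of G. Repeating
    this m times leaves r^m, and [d] absorbs the truncation errors. *)
Let approx m a N d : 0 < d -> exists b M,
  ns s (fun x => cpoly a N x - esum e b M x) <= r ^+ m * ns s (cpoly a N) + d.
Proof.
have /andP[r0 _] := r1; have ti0 : 0 < (tau 1%N)^-1 by rewrite invr_gt0.
elim: m a N d => [|m IH] a N d d0.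
  exists (fun=> 0), 0%N; rewrite expr0 mul1r.
  rewrite (@eq_ns _ _ _ (cpoly a N)); last by move=> x; rewrite /esum big_geq// subr0.
  by rewrite lerDl ltW.
have d20 : 0 < d / 2 by rewrite divr_gt0.
(* The truncation error is divided by [tau 1] below, hence this factor; the other half of [d] goes
   to the remaining steps. *)
have [k kP] := diff_small a N (mulr_gt0 t1 d20).
have [a' [N' aE]] := is_cpoly_rest a N k.
have [b [M bP]] := IH a' N' _ d20.
have [b' [M' bE]] := esum_lin (tau 1%N)^-1 a N b M.
exists b', M'.
have cL := cont_inLs s1' (@cont_cpoly R a' N').
rewrite (@eq_ns _ _ _ (fun x => (cpoly a' N' x - esum e b M x) - (tau 1%N)^-1 * diff a N k x)); last first.
  by move=> x; rewrite bE -aE /diff; field; rewrite gt_eqF.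
apply: le_trans (ns_triangleB s1' (inLsB s1' cL (esL b M)) (inLsZ s1' _ (diffL a N k))) _.
have nsa' : ns s (cpoly a' N') <= r * ns s (cpoly a N).
  rewrite -(eq_ns s _ _ aE) (nsZ s1' _ (restL a N k)) normrN gtr0_norm// /r.
  by rewrite (mulrC rho) -mulrA ler_wpM2l ?ns_rest// ltW.
have h1 : ns s (fun x => (tau 1%N)^-1 * diff a N k x) <= d / 2.
  by rewrite (nsZ s1' _ (diffL a N k)) gtr0_norm// mulrC ler_pdivrMr// (mulrC (d / 2)).
apply: (le_trans (lerD bP h1)); rewrite exprSr -mulrA -addrA -splitr lerD2r.
by rewrite ler_wpM2l// exprn_ge0.
Qed.

Let dense_e g : inLs s g -> forall d, 0 < d -> exists b M, ns s (fun x => g x - esum e b M x) < d.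
Proof.
move=> lg d d0; have d3 : 0 < d / 3 by rewrite divr_gt0.
have [a [N aP]] := cpoly_dense s1 lg d3.
have /andP[r0 rl1] := r1.
have [m mP] : exists m : nat, r ^+ m * ns s (cpoly a N) <= d / 3.
  have n0 := ns_ge0 s (cpoly a N).
  have rn : `|r| < 1 by rewrite ger0_norm.
  have B0 : 0 < d / 3 / (ns s (cpoly a N) + 1) by rewrite divr_gt0// ltr_wpDl.
  have /cvgrPdist_lt/(_ _ B0) [m _ /(_ m (leqnn m))] := cvg_expr rn.
  rewrite /= sub0r normrN ger0_norm ?exprn_ge0// ltr_pdivlMr ?ltr_wpDl// => h.
  exists m; apply: le_trans (ltW h); rewrite ler_wpM2l ?exprn_ge0//.
  by rewrite lerDl.
have [b [M bP]] := approx m a N d3.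
exists b, M.
have cL := cont_inLs s1' (@cont_cpoly R a N).
rewrite (@eq_ns _ _ _ (fun x => (g x - cpoly a N x) + (cpoly a N x - esum e b M x))); last first.
  by move=> x; rewrite addrA subrK.
apply: (le_lt_trans (ns_triangle s1' (inLsB s1' lg cL) (inLsB s1' cL (esL b M)))).
have := le_trans bP (lerD mP (lexx _)).
move: aP; move: (ns _ _) (ns _ _) => u v; lra.
Qed.

(** The constant for the partial sums is [K] times the two norm comparisons: [esum_le] to pass to
    cosines, [esum_ge] to come back. *)
Lemma perturbed_basis : schauder_basis (lebesgue01 R) s%:E e.
Proof.
have [K K1 KP] := partial_sum_bound s1.
have td : 0 < tau 1%N - rho by rewrite subr_gt0.
have K0 : 0 <= K by exact: le_trans K1.
have tr0 : 0 <= tau 1%N + rho by rewrite addr_ge0// ltW.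
apply: (@schauder_of_projections _ _ s1' e ((tau 1%N + rho) * K / (tau 1%N - rho))) => //.
  by rewrite divr_ge0 ?mulr_ge0// ltW.
move=> a M N MN; apply: le_trans (esum_le a M) _.
rewrite -!mulrA ler_wpM2l//; apply: le_trans (KP a M N MN) _.
by rewrite ler_wpM2l// mulrC ler_pdivlMr// mulrC.
Qed.

End perturbation.

Lemma cosn_basis s : 1 < s -> schauder_basis (lebesgue01 R) s%:E cosn.
Proof.
move=> s1; have s1' := ltW s1.
have [K K1 KP] := partial_sum_bound s1.
apply: (@schauder_of_projections _ _ s1' cosn K).
- exact: le_trans K1.
- by move=> n; exact: (cont_inLs s1' (@cont_cosn R n)).
- by move=> n; exact: ns_cosn_gt0.
- exact: KP.
- by move=> g lg d d0; exact: (cpoly_dense s1 lg d0).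
Qed.

End dilation.

(** Equivalent, once pi^2 > 8, to pi^2 <= pi^3 / (pi^2 - 8): the condition at the end p = 2 of the
    interpolation. *)
Lemma pi_sqr_le (R : realType) : pi ^+ 2 - 8 <= pi :> R.
Proof.
have := @pi_lt_336 R; have := pi_gt0 R; move: (@pi R) => q q0 q3.
(* The product (3.36 - q) (q + 2.36) equals 7.9296 + q - q^2. *)
have h1 : 0 < 336 / 100 - q by lra.
have h2 : 0 < q + 236 / 100 by lra.
have := mulr_gt0 h1 h2; rewrite expr2; lra.
Qed.

Theorem corollary1 (R : realType) (p0 : R)
    (p0_gt1 : 1 < p0) (p0_lt2 : p0 < 2)
    (p0E : pip p0 ^+ 2 * cp p0 = pi ^+ 3 / (pi ^+ 2 - 8))
    (s : R) (s_gt1 : 1 < s)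
    (p : R) (p0_le : p0 <= p) (p_le2 : p <= 2) :
  schauder_basis (lebesgue01 R) s%:E
    (fun (n : nat) (x : R) => cosp p (n%:R * pip p * x)).
Proof.
have p1 : 1 < p by exact: lt_le_trans p0_le.
move: p_le2; rewrite le_eqVlt => /predU1P[->|p2].
  have -> : (fun (n : nat) (x : R) => cosp 2 (n%:R * pip 2 * x)) = @cosn R.
    by apply/funext => n; apply/funext => x; rewrite pip2 cosp2E.
  exact: cosn_basis.
have pi0 := pi_gt0 R.
have [K KE] : exists K : R, pi ^+ 3 / (pi ^+ 2 - 8) = K by eexists.
have K0 : 0 < K.
  by rewrite -KE -p0E mulr_gt0 ?exprn_gt0 ?pip_gt0 ?cp_gt0.
(* The left side of [p0E] is positive, which forces the sign of its denominator. *)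
have pi8 : 0 < pi ^+ 2 - 8 :> R.
  by move: K0; rewrite -KE pmulr_rgt0 ?exprn_gt0// invr_gt0.
have piK : pi ^+ 2 <= K.
  rewrite -KE ler_pdivlMr// [leRHS]exprSr ler_wpM2l ?exprn_ge0 ?(ltW pi0)//.
  exact: pi_sqr_le.
have Kpi : K * (pi ^+ 2 - 8) <= pi ^+ 3 by rewrite -KE divfK// gt_eqF.
rewrite KE in p0E.
have slope y : 0 < y < 1 -> pip p ^+ 2 * (y `^ (p - 1) * (1 - y `^ p) `^ ((2 - p) / p)) <= K.
  exact: (slope_bound p0_gt1 p0_lt2 p0_le p2 p0E piK).
have cf := @cont_cospL R p (pip p) p1.
have t0 := @tau_even R p (pip p) p1 erefl 0%N isT.
have t1 := tau1_gt p1 p2 (erefl (pip p)).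
have tl (N : nat) := @sum_tau_tail R p (pip p) K p1 p2 erefl slope N Kpi.
have un := cosp_series p1 p2 (erefl (pip p)) slope.
have -> : (fun (n : nat) (x : R) => cosp p (n%:R * pip p * x)) =
    (fun n x => cosp p (pip p * (n%:R * x))).
  by apply/funext => n; apply/funext => x; congr (cosp p _); rewrite mulrA (mulrC (pip p)).
exact: (perturbed_basis s_gt1 cf t0 tl t1 un).
Qed.
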